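(* Let $l,\rho,c,\tau_q,k>0$ and $\mu^2>0$ be constants, and let $\mathcal{H}$, $\mathcal{A}$ and $D(\mathcal{A})$ be the Hilbert space, operator and domain defined in the context. Then the Cauchy problem $$U_t(t)=\mathcal{A}U(t)\ \text{ for all } t>0,\qquad U(0)=U_0,$$ is well-posed, i.e., for any $U_0\in\mathcal{H}$ it has a unique weak solution $U(t)=e^{\mathcal{A}t}U_0\in C\big([0,\infty);\mathcal{H}\big)$. Furthermore, if $U_0\in D(\mathcal{A})$, then $U(t)\in C^1\big([0,\infty);\mathcal{H}\big)\cap C\big([0,\infty);D(\mathcal{A})\big)$ is the classical solution of the Cauchy problem.
   Context: The Cauchy problem is the first-order formulation, with $U=(u,v)^\top=(T,q)^\top$ and $U_0=(T_0,q_0)^\top$, of the one-dimensional Guyer–Krumhansl system $$\rho c\,T_t+q_x=0,\qquad \tau_q q_t+q-\mu^2 q_{xx}+kT_x=0\quad\text{in }(0,l)\times(0,\infty),$$ with boundary conditions $q(0,t)=q(l,t)=0$ for all $t\ge 0$ and initial data $T(x,0)=T_0(x)$, $q(x,0)=q_0(x)$, $x\in(0,l)$. The phase space is $\mathcal{H}:=L^2(0,l)\times L^2(0,l)$ (real-valued functions) with the norm $\|(u,v)^\top\|_{\mathcal{H}}^2=\rho c\|u\|^2+\frac{\tau_q}{k}\|v\|^2$ and the corresponding inner product, where $\|\cdot\|$ is the $L^2(0,l)$ norm. The operator $\mathcal{A}:D(\mathcal{A})\subset\mathcal{H}\to\mathcal{H}$ is $$\mathcal{A}\begin{pmatrix}u\\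 v\end{pmatrix}=\begin{pmatrix}-\frac{1}{\rho c}v_x\\[2pt] \frac{1}{\tau_q}\big(\mu^2 v_x-ku\big)_x-\frac{1}{\tau_q}v\end{pmatrix},$$ (formally, the second component is $-\frac{k}{\tau_q}u_x-\frac1{\tau_q}v+\frac{\mu^2}{\tau_q}v_{xx}$, with derivatives in the sense of distributions), with domain $$D(\mathcal{A}):=\Big\{U=(u,v)^\top\in\mathcal{H}:\ \mu^2v_x-ku\in H^1(0,l),\ v\in H^1_0(0,l)\Big\},$$ endowed with the graph norm. Here $e^{\mathcal{A}t}$ denotes the $C_0$-semigroup on $\mathcal{H}$ generated by $\mathcal{A}$, and weak (mild) and classical solutions are understood in the usual sense of the theory of $C_0$-semigroups. *)

(* Defs.v *)
From HB Require Import structures.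
From mathcomp Require Import all_boot all_order all_algebra.
From mathcomp Require Import all_classical all_reals all_analysis.
From mathcomp Require Import measurable_realfun ess_sup_inf ring lra.

Set Implicit Arguments.
Unset Strict Implicit.
Unset Printing Implicit Defensive.
Import Order.TTheory GRing.Theory Num.Theory.
Import numFieldNormedType.Exports.

Local Open Scope classical_set_scope.
Local Open Scope ring_scope.

Section Lspace_lmodule.
Context d (T : measurableType d) (R : realType).
Variables (mu : {measure set T -> \bar R}) (p : \bar R) (p1 : (1 <= p)%E).
Implicit Types (F G : LspaceType mu p1) (f g : LfunType mu p1).

(* Vector space operations and norm on the library's quotient type of L^p
   classes, computed on representatives. *)
HB.instance Definition _ := gen_eqMixin (LspaceType mu p1).
HB.instance Definition _ := gen_choiceMixin (LspaceType mu p1).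

Lemma LspaceP F G : F = G %[ae mu] -> F = G.
Proof.
move=> FG.
have : (F : {mfun_ mu, T >-> measurableTypeR R}) = G.
  by rewrite -[LHS]reprK -[RHS]reprK; apply/eqP/ae_eqP.
case: F G {FG} => [F [[pF]]] [G [[pG]]] /= FG.
case: _ / FG in pG *.
by have -> : pF = pG by [].
Qed.

Definition Lspace_fun F : T -> R := F.

Lemma Lspace_fun_measurable F : measurable_fun [set: T] (Lspace_fun F).
Proof. exact: (measurable_funPT (repr (F : {mfun_ mu, T >-> measurableTypeR R}))). Qed.

Lemma Lspace_fun_finite F : finite_norm mu p (Lspace_fun F).
Proof. exact: Lebesgue_finite. Qed.

Lemma Lspace_fun_Lfun F : Lspace_fun F \in Lfun mu p.
Proof.
by rewrite inE; apply/andP; split; rewrite inE/=;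
  [exact: Lspace_fun_measurable|exact: Lspace_fun_finite].
Qed.

Definition Lspace_repr F : LfunType mu p1 := Lfun_Sub p1 (Lspace_fun_Lfun F).

Definition Lfun_mfun f : {mfun T >-> measurableTypeR R} :=
  HB.pack_for {mfun T >-> measurableTypeR R} (f : T -> measurableTypeR R)
    (@isMeasurableFun.Build _ _ T (measurableTypeR R) f (measurable_funPT f)).

Definition Lfun_class f : {mfun_ mu, T >-> measurableTypeR R} :=
  \pi_({mfun_ mu, T >-> measurableTypeR R})%qT (Lfun_mfun f).

Lemma Lfun_class_ae f : (Lfun_class f : T -> R) = f %[ae mu].
Proof.
apply/asboolP.
have /eqP := reprK (Lfun_class f).
by rewrite eqmodE.
Qed.

Lemma ae_eq_Lnorm (f g : T -> R) : measurable_fun setT f ->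
  measurable_fun setT g -> f = g %[ae mu] ->
  'N[mu]_p[EFin \o f]%E = 'N[mu]_p[EFin \o g]%E.
Proof.
move=> mf mg fg; rewrite unlock; case: p p1 => [r r1|_|//].
  congr (_ `^ _)%E; apply: ae_eq_integral => //=.
  - apply/measurable_EFinP.
    apply: (@measurableT_comp _ _ _ _ _ _ (@powR R ^~ r)) => //.
    exact: measurableT_comp.
  - apply/measurable_EFinP.
    apply: (@measurableT_comp _ _ _ _ _ _ (@powR R ^~ r)) => //.
    exact: measurableT_comp.
  - by apply: filterS fg => x /= /(_ I) -> _.
case: ifPn => // _; apply: eq_ess_sup.
by apply: filterS fg => x /= /(_ I) ->.
Qed.

Lemma Lfun_class_finite f : finite_norm mu p (Lfun_class f : T -> R).
Proof.
have mF : measurable_fun setT (Lfun_class f : T -> R).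
  exact: (measurable_funPT (repr (Lfun_class f))).
rewrite /finite_norm (ae_eq_Lnorm mF (measurable_funPT f) (Lfun_class_ae f)).
exact: Lfunction_finite.
Qed.

Definition Lspace_of f : LspaceType mu p1 :=
  HB.pack_for (LspaceType mu p1) (Lfun_class f)
    (@isFinLebesgue.Build _ _ _ _ _ p1 _ (Lfun_class_finite f)).

Lemma Lspace_ofE f : (Lspace_of f : T -> R) = f %[ae mu].
Proof. exact: Lfun_class_ae. Qed.

Lemma Lspace_reprE F : Lspace_repr F = F :> (T -> R).
Proof. by []. Qed.

Definition Lspace_zero : LspaceType mu p1 := Lspace_of 0.
Definition Lspace_opp F : LspaceType mu p1 := Lspace_of (- Lspace_repr F).
Definition Lspace_add F G : LspaceType mu p1 :=
  Lspace_of (Lspace_repr F + Lspace_repr G).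
Definition Lspace_scale (a : R) F : LspaceType mu p1 :=
  Lspace_of (a *: Lspace_repr F).

Lemma Lspace_zeroE : (Lspace_zero : T -> R) = cst 0 %[ae mu].
Proof. exact: Lspace_ofE. Qed.
Lemma Lspace_oppE F : (Lspace_opp F : T -> R) = (fun x => - F x) %[ae mu].
Proof. exact: Lspace_ofE. Qed.
Lemma Lspace_addE F G :
  (Lspace_add F G : T -> R) = (fun x => F x + G x) %[ae mu].
Proof. exact: Lspace_ofE. Qed.
Lemma Lspace_scaleE a F :
  (Lspace_scale a F : T -> R) = (fun x => a * F x) %[ae mu].
Proof. exact: Lspace_ofE. Qed.

Lemma Lspace_addA : associative Lspace_add.
Proof.
move=> F G H; apply: LspaceP.
apply: filterS (filterI (filterI (Lspace_addE F (Lspace_add G H))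
  (Lspace_addE G H)) (filterI (Lspace_addE (Lspace_add F G) H)
  (Lspace_addE F G))).
by move=> x [] [] /(_ I) e1 /(_ I) e2 [] /(_ I) e3 /(_ I) e4 _; rewrite e1 e2 e3 e4 addrA.
Qed.

Lemma Lspace_addC : commutative Lspace_add.
Proof.
move=> F G; apply: LspaceP.
apply: filterS (filterI (Lspace_addE F G) (Lspace_addE G F)).
by move=> x [] /(_ I) e1 /(_ I) e2 _; rewrite e1 e2 addrC.
Qed.

Lemma Lspace_add0 : left_id Lspace_zero Lspace_add.
Proof.
move=> F; apply: LspaceP.
apply: filterS (filterI (Lspace_addE Lspace_zero F) Lspace_zeroE).
by move=> x [] /(_ I) e1 /(_ I) e2 _; rewrite e1 e2 add0r.
Qed.

Lemma Lspace_addN : left_inverse Lspace_zero Lspace_opp Lspace_add.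
Proof.
move=> F; apply: LspaceP.
apply: filterS (filterI (Lspace_addE (Lspace_opp F) F)
  (filterI Lspace_zeroE (Lspace_oppE F))).
by move=> x [] /(_ I) e1 [] /(_ I) e2 /(_ I) e3 _; rewrite e1 e2 e3 addNr.
Qed.

HB.instance Definition _ := GRing.isZmodule.Build (LspaceType mu p1)
  Lspace_addA Lspace_addC Lspace_add0 Lspace_addN.

Lemma Lspace_scaleA a b F :
  Lspace_scale a (Lspace_scale b F) = Lspace_scale (a * b) F.
Proof.
apply: LspaceP.
apply: filterS (filterI (Lspace_scaleE a (Lspace_scale b F))
  (filterI (Lspace_scaleE b F) (Lspace_scaleE (a * b) F))).
by move=> x [] /(_ I) e1 [] /(_ I) e2 /(_ I) e3 _; rewrite e1 e2 e3 mulrA.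
Qed.

Lemma Lspace_scale1 : left_id 1 Lspace_scale.
Proof.
move=> F; apply: LspaceP.
apply: filterS (Lspace_scaleE 1 F).
by move=> x /(_ I) e1 _; rewrite e1 mul1r.
Qed.

Lemma Lspace_scaleDr : right_distributive Lspace_scale +%R.
Proof.
move=> a F G; apply: LspaceP.
apply: filterS (filterI (filterI (Lspace_scaleE a (F + G)) (Lspace_addE F G))
  (filterI (Lspace_addE (Lspace_scale a F) (Lspace_scale a G))
  (filterI (Lspace_scaleE a F) (Lspace_scaleE a G)))).
move=> x [] [] /(_ I) e1 /(_ I) e2 [] /(_ I) e3 [] /(_ I) e4 /(_ I) e5 _.
by rewrite e1 [(F + G) x]e2 [RHS]e3 e4 e5 mulrDr.
Qed.

Lemma Lspace_scaleDl F : {morph Lspace_scale^~ F : a b / a + b}.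
Proof.
move=> a b; apply: LspaceP.
apply: filterS (filterI (Lspace_scaleE (a + b) F)
  (filterI (Lspace_addE (Lspace_scale a F) (Lspace_scale b F))
  (filterI (Lspace_scaleE a F) (Lspace_scaleE b F)))).
move=> x [] /(_ I) e1 [] /(_ I) e3 [] /(_ I) e4 /(_ I) e5 _.
by rewrite e1 [RHS]e3 e4 e5 mulrDl.
Qed.

HB.instance Definition _ := GRing.Zmodule_isLmodule.Build R (LspaceType mu p1)
  Lspace_scaleA Lspace_scale1 Lspace_scaleDr Lspace_scaleDl.

Definition Lspace_norm F : R := fine ('N[mu]_p[EFin \o (F : T -> R)])%E.

Lemma Lspace_normE F (f : T -> R) : measurable_fun setT f ->
  (F : T -> R) = f %[ae mu] ->
  Lspace_norm F = fine ('N[mu]_p[EFin \o f])%E.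
Proof.
move=> mf Ff; rewrite /Lspace_norm.
by rewrite (ae_eq_Lnorm (Lspace_fun_measurable F) mf Ff).
Qed.

Lemma Lspace_norm_ge0 F : 0 <= Lspace_norm F.
Proof. exact/fine_ge0/Lnorm_ge0. Qed.

Lemma ler_Lspace_normD F G :
  Lspace_norm (F + G) <= Lspace_norm F + Lspace_norm G.
Proof.
have mFG := measurable_funPT (Lspace_repr F + Lspace_repr G).
rewrite (Lspace_normE mFG (Lspace_addE F G)).
exact: (ler_LnormD (Lspace_repr F) (Lspace_repr G)).
Qed.

Lemma Lspace_normZ a F : Lspace_norm (a *: F) = `|a| * Lspace_norm F.
Proof.
have maF := measurable_funPT (a *: Lspace_repr F).
rewrite (Lspace_normE maF (Lspace_scaleE a F)).
have -> := LnormZ (Lspace_repr F) a.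
by rewrite fineM// ge0_fin_numE ?Lnorm_ge0//; exact: Lspace_fun_finite.
Qed.

Lemma Lspace_norm_eq0 F : Lspace_norm F = 0 -> F = 0.
Proof.
move=> /(@fine_Lnormr_eq0 _ _ _ _ _ _ (Lspace_repr F)) F0.
apply: LspaceP.
apply: filterS (filterI F0 Lspace_zeroE).
by move=> x [] /(_ I) e1 /(_ I) e2 _; rewrite [LHS]e1 [RHS]e2.
Qed.

HB.instance Definition _ := Lmodule_isNormed.Build R (LspaceType mu p1)
  ler_Lspace_normD Lspace_normZ Lspace_norm_eq0.

End Lspace_lmodule.

Section weighted_norm.
Context (R : realType) (V W : normedModType R) (a b : {posnum R}).
Implicit Types u v : V * W.

Let q u : R := a%:num * `|u.1| ^+ 2 + b%:num * `|u.2| ^+ 2.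

Definition weighted_norm u : R :=
  Num.sqrt (a%:num * `|u.1| ^+ 2 + b%:num * `|u.2| ^+ 2).

Let q_ge0 u : 0 <= q u.
Proof. by rewrite addr_ge0// mulr_ge0// sqr_ge0. Qed.

Lemma ler_weighted_normD u v :
  weighted_norm (u + v) <= weighted_norm u + weighted_norm v.
Proof.
pose x := `|u.1|; pose y := `|u.2|; pose z := `|v.1|; pose w := `|v.2|.
have cs : a%:num * (x * z) + b%:num * (y * w) <= Num.sqrt (q u * q v).
  apply: (le_trans (ler_norm _)); rewrite -sqrtr_sqr ler_wsqrtr//.
  rewrite -subr_ge0 (_ : _ - _ = a%:num * b%:num * (x * w - y * z) ^+ 2).
    by rewrite mulr_ge0// sqr_ge0.
  by rewrite /q -/x -/y -/z -/w; ring.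
have le_sq (N : normedModType R) (s t : N) :
    `|s + t| ^+ 2 <= `|s| ^+ 2 + 2 * (`|s| * `|t|) + `|t| ^+ 2.
  rewrite (_ : _ + _ = (`|s| + `|t|) ^+ 2); last by ring.
  by rewrite lerXn2r ?nnegrE ?addr_ge0// ler_normD.
rewrite /weighted_norm -/(q u) -/(q v).
rewrite -[leRHS]ger0_norm ?addr_ge0 ?sqrtr_ge0// -sqrtr_sqr ler_wsqrtr//.
rewrite sqrrD !sqr_sqrtr// -sqrtrM//.
have h1 := ler_wpM2l (ltW [gt0 of a%:num]) (le_sq _ u.1 v.1).
have h2 := ler_wpM2l (ltW [gt0 of b%:num]) (le_sq _ u.2 v.2).
move: cs h1 h2; set s := Num.sqrt _.
rewrite /q -/x -/y -/z -/w /=.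
lra.
Qed.

Lemma weighted_normZ r u : weighted_norm (r *: u) = `|r| * weighted_norm u.
Proof.
rewrite -(sqrtr_sqr r) -sqrtrM ?sqr_ge0// /weighted_norm /= !normrZ.
by congr Num.sqrt; rewrite -(real_normK (num_real r)); ring.
Qed.

Lemma weighted_norm_eq0 u : weighted_norm u = 0 -> u = 0.
Proof.
move=> /eqP; rewrite sqrtr_eq0 => q0.
have /eqP : q u = 0 by apply/eqP; rewrite eq_le q0 q_ge0.
rewrite paddr_eq0 ?mulr_ge0 ?sqr_ge0// !mulf_eq0 !orbb.
rewrite (gt_eqF [gt0 of a%:num]) (gt_eqF [gt0 of b%:num]) /=.
rewrite !normr_eq0 => /andP[/eqP u1 /eqP u2].
by case: u u1 u2 {q0} => ? ? /= -> ->.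
Qed.

End weighted_norm.

Section Sobolev_interval.
Context (R : realType) (l : R).

Definition interval_measure : {measure set (measurableTypeR R) -> \bar R} :=
  mrestr (@lebesgue_measure R) (measurable_itv `]0, l[).

Definition L2 : Type := LspaceType2 interval_measure.

HB.instance Definition _ := NormedModule.copy L2 (LspaceType2 interval_measure).

Definition L2_fun (u : L2) : R -> R := Lspace_fun u.

Lemma L2_normE (u : L2) :
  `|u| = fine ('N[interval_measure]_2[EFin \o L2_fun u])%E.
Proof. by []. Qed.

Definition test_function (phi : R -> R) : Prop :=
  (forall n x, derivable (derive1n n phi) x 1) /\
  exists a b, [/\ 0 < a, b < l & forall x, x \notin `[a, b] -> phi x = 0].

Definition is_weak_derivative (u w : L2) : Prop :=
  forall phi, test_function phi ->
    \int[interval_measure]_x (L2_fun u x * derive1 phi x) =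
    - \int[interval_measure]_x (L2_fun w x * phi x).

(* A weak derivative is unique in [L2] when it exists; the value is 0, and
   meaningless, when it does not exist. *)
Definition weak_derivative (u : L2) : L2 :=
  xget 0 [set w | is_weak_derivative u w].

Definition Sobolev_H1 : set L2 := [set u | exists w, is_weak_derivative u w].

(* closure of the test functions for the norm of [Sobolev_H1] *)
Definition Sobolev_H10 : set L2 := [set u | exists2 w, is_weak_derivative u w &
  forall e : R, 0 < e -> exists phi, [/\ test_function phi,
    ('N[interval_measure]_2[(fun x => (L2_fun u x - phi x)%:E)] < e%:E)%E &
    ('N[interval_measure]_2[(fun x => (L2_fun w x - derive1 phi x)%:E)]
       < e%:E)%E]].

End Sobolev_interval.

(* A copy of the product, because the product of normed modules carries the
   sup norm; the weights [a] and [b] only enter the norm. *)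
Definition phase_space (R : realType) (l : R) (a b : {posnum R}) : Type :=
  (L2 l * L2 l)%type.

Section phase_space_norm.
Context (R : realType) (l : R) (a b : {posnum R}).

HB.instance Definition _ :=
  GRing.Lmodule.copy (phase_space l a b) (L2 l * L2 l)%type.
HB.instance Definition _ := Lmodule_isNormed.Build R (phase_space l a b)
  (@ler_weighted_normD R (L2 l) (L2 l) a b)
  (@weighted_normZ R (L2 l) (L2 l) a b)
  (@weighted_norm_eq0 R (L2 l) (L2 l) a b).

Lemma phase_space_normE (U : phase_space l a b) :
  `|U| ^+ 2 = a%:num * `|U.1| ^+ 2 + b%:num * `|U.2| ^+ 2.
Proof. by rewrite sqr_sqrtr// addr_ge0// mulr_ge0// sqr_ge0. Qed.

End phase_space_norm.

(* Functions of time are total functions on [R]; only their values on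
   [0, +oo[ are ever constrained. *)
Section semigroup.
Context (R : realType) (X : normedModType R).
Implicit Types (S : R -> X -> X) (D : set X) (A : X -> X) (U : R -> X).

Record C0_semigroup S : Prop := C0Semigroup {
  semigroup_linear : forall t : R, 0 <= t -> linear (S t);
  semigroup_bounded : forall t : R, 0 <= t -> continuous (S t);
  semigroup0 : forall x, S 0 x = x;
  semigroupD : forall (s t : R) x, 0 <= s -> 0 <= t -> S (s + t) x = S s (S t x);
  semigroup_cvg0 : forall x, S t x @[t --> 0^'+] --> x }.

(* In this section an unbounded operator is a domain [D] and a function [A]
   of which only the restriction to [D] matters. *)
Definition is_generator S D A : Prop :=
  forall x y, (D x /\ A x = y) <->
    h^-1 *: (S h x - x) @[h --> 0^'+] --> y.

Definition C0_semigroup_generated_by S D A : Prop :=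
  C0_semigroup S /\ is_generator S D A.

Definition tagged_partition (a b : R) (n : nat) (x xi : nat -> R) : Prop :=
  [/\ x 0%N = a, x n = b & forall i, (i < n)%N -> x i <= xi i <= x i.+1].

Definition Riemann_sum U (n : nat) (x xi : nat -> R) : X :=
  \sum_(i < n) (x i.+1 - x i) *: U (xi i).

Definition is_Riemann_integral U (a b : R) (I : X) : Prop :=
  forall e : R, 0 < e -> exists2 delta : R, 0 < delta &
    forall n x xi, tagged_partition a b n x xi ->
      (forall i, (i < n)%N -> x i.+1 - x i < delta) ->
      `|Riemann_sum U n x xi - I| < e.

Definition mild_solution D A (U0 : X) U : Prop :=
  {within `[0, +oo[, continuous U} /\
  forall t : R, 0 <= t -> exists I, [/\ is_Riemann_integral U 0 t I, D I &
    U t = U0 + A I].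

(* continuously differentiable on [0, +oo[, from the right at 0 *)
Definition C1_halfline U : Prop := exists dU : R -> X,
  [/\ {within `[0, +oo[, continuous dU},
      forall t : R, 0 < t -> is_derive t 1 U (dU t) &
      h^-1 *: (U h - U 0) @[h --> 0^'+] --> dU 0].

Definition graph_norm A (x : X) : R := `|x| + `|A x|.

Definition C0_halfline_domain D A U : Prop :=
  forall t : R, 0 <= t ->
    D (U t) /\
    graph_norm A (U s - U t) @[s --> within `[0, +oo[ (nbhs t)]
      --> (0 : R).

Definition classical_solution D A (U0 : X) U : Prop :=
  [/\ {within `[0, +oo[, continuous U},
      forall t : R, 0 < t -> {for t, continuous (derive1 U)},
      forall t : R, 0 < t -> D (U t) /\ is_derive t 1 U (A (U t)) &
      U 0 = U0].

End semigroup.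

Section Guyer_Krumhansl.
Context (R : realType) (l rho c tauq k : {posnum R}) (mu : R).

Definition GK_space : Type :=
  phase_space l%:num (rho%:num * c%:num)%:pos (tauq%:num / k%:num)%:pos.

HB.instance Definition _ := NormedModule.copy GK_space
  (phase_space l%:num (rho%:num * c%:num)%:pos (tauq%:num / k%:num)%:pos).

Definition GK_flux (U : GK_space) : L2 l%:num :=
  mu ^+ 2 *: weak_derivative U.2 - k%:num *: U.1.

Definition GK_domain : set GK_space :=
  [set U | Sobolev_H10 U.2 /\ Sobolev_H1 (GK_flux U)].

Definition GK_operator (U : GK_space) : GK_space :=
  (- (rho%:num * c%:num)^-1 *: weak_derivative U.2,
   tauq%:num^-1 *: weak_derivative (GK_flux U) - tauq%:num^-1 *: U.2).

End Guyer_Krumhansl.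

(* Main.v *)
Require Import Defs.
From HB Require Import structures.
From mathcomp Require Import all_boot all_order all_algebra.
From mathcomp Require Import all_classical all_reals all_analysis.
From mathcomp Require Import measurable_realfun ring lra.

Set Implicit Arguments.
Unset Strict Implicit.
Unset Printing Implicit Defensive.
Import Order.TTheory GRing.Theory Num.Theory.
Import numFieldNormedType.Exports.

Local Open Scope classical_set_scope.
Local Open Scope ring_scope.

(** The system is the evolution equation of an m-dissipative operator, and the
theorem is the Hille-Yosida / Lumer-Phillips theory for it.

The Guyer-Krumhansl operator is m-dissipative ([GK_m_dissipative]).  In the
energy inner product the coupling terms between temperature and heat flux
cancel after an integration by parts, which leaves
  [<A U, U> = - (mu^2 |v_x|^2 + |v|^2) / k <= 0].
For the range condition, eliminate [u] from [U - h A U = (f, g)].  What remains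
is an elliptic problem for [v] in H^1_0,
  [m v - kappa v_xx = tau/h g - k f_x]  with  [m = tau/h + 1],
  [kappa = mu^2 + k h/(rho c)],
whose bilinear form is the inner product of the pairs [(v, v_x)] in a phase
space with weights [m] and [kappa].  Its weak solution is therefore an
orthogonal projection onto the closure of the pairs [(phi, phi')], [phi] a test
function.  A vector orthogonal to the domain is [x - A x] for some [x] in the domain, so [|x|^2 = <A x, x> <= 0]
and the vector is zero: the domain is dense.  Behind this stand the completeness
of L^2, the uniqueness of weak derivatives, and smooth bump functions.

An m-dissipative operator on a complete normed space generates a semigroup
([m_dissipative_generates]): apply the backward Euler scheme with dyadic steps.
Halving the step costs [O(h^2)] per step on vectors [x] such that [A x] and
[A (A x)] exist, so the approximations of [S t x] are Cauchy there, and by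
density and contractivity everywhere.

Conversely, let [S] be any semigroup generated by the operator, known only to be
strongly continuous.  The uniform boundedness principle bounds it near 0; hence
its orbits in the domain have left derivatives, and a dissipative operator
forces every left-differentiable solution to have nonincreasing norm
([dissipative_nonincreasing]).  So [S] is contractive.  The same monotonicity,
applied to differences, gives uniqueness: of classical solutions directly, and
of mild solutions after passing to their integrals, the difference of which
solves the equation classically.  An orbit starting in the domain is Lipschitz,
hence has a primitive built from dyadic sums; every orbit is the difference of
one of these and its derivative, because [x = z - A z] for some [z].  The
integral of an orbit then lies in the domain, which is the mild formulation. *)

(** * Dissipative operators *)

(** On an inner product space this is [<A x, x> <= 0].  The formulation by norms
makes sense in any normed space and is what the estimates use. *)
Definition dissipative (R : realType) (X : normedModType R) (D : set X)
    (A : X -> X) : Prop :=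
  forall (h : R) x, 0 <= h -> D x -> `|x| <= `|x - h *: A x|.

Section Dini.
Context (R : realType).

(** Monotonicity from a bound on one left Dini derivative.  Fix [e] and consider
the times [t] from which [phi] grows by at most [e (T - t)] up to [T].  Right
continuity puts the infimum of these times in the set, and the derivative bound
lets one step further to the left unless that infimum is 0. *)
Lemma left_Dini_nonincreasing (phi : R -> R) (T : R) : 0 <= T ->
  (forall t, 0 <= t < T -> phi (t + h) @[h --> 0^'+] --> phi t) ->
  (forall t e, 0 < t <= T -> 0 < e ->
    \forall h \near 0^'+, phi t <= phi (t - h) + e * h) ->
  phi T <= phi 0.
Proof.
move=> T0 rc ld; suff H e : 0 < e -> phi T <= phi 0 + e * T.
  apply/ler_addgt0Pr => e e0; case: (ltgtP 0 T) T0 => // [T0 _|<- _].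
    by have := H (e / T) (divr_gt0 e0 T0); rewrite divfK// gt_eqF.
  by rewrite lerDl ltW.
move=> e0; pose E := [set t | 0 <= t <= T /\ phi T <= phi t + e * (T - t)].
have ET : E T by split; [rewrite T0 lexx|rewrite subrr mulr0 addr0].
have lbE : lbound E 0 by move=> t [/andP[]].
have hE : has_inf E by split; [exists T|exists 0].
pose i := inf E.
have i0 : 0 <= i by apply: lb_le_inf => //; exists T.
have iT : i <= T by apply: ge_inf => //; exists 0.
have Ei : E i.
  have [->//|iNT] := eqVneq i T.
  have ltiT : i < T by rewrite lt_neqAle iNT.
  split; first by rewrite i0.
  apply/ler_addgt0Pr => d d0.
  have d20 : 0 < d / 2 by rewrite divr_gt0.
  have c1 : \forall h \near 0^'+, `|phi i - phi (i + h)| < d / 2.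
    have /rc/cvgrPdist_lt/(_ _ d20) cv : 0 <= i < T by rewrite i0 ltiT.
    exact: cv.
  have [r /= r0 hr] := c1.
  have [t Et ti] := inf_adherent r0 hE.
  have [ti0|tNi] := eqVneq t i; first (move: Et; rewrite ti0).
    by move=> [] _ /le_trans; apply; rewrite lerDl ltW.
  have lit : i < t.
    by rewrite lt_neqAle eq_sym tNi; apply: ge_inf => //; exists 0.
  have := hr (t - i); rewrite /ball_/= sub0r normrN gtr0_norm ?subr_gt0//.
  rewrite ltrBlDl ti subrKC => /(_ isT lit).
  rewrite ltr_norml => /andP[h1 h2].
  case: Et => _ h3; apply: (le_trans h3).
  have : e * (T - t) <= e * (T - i) by rewrite ler_pM2l// lerB// ltW.
  by lra.
have [i0' | ipos] := eqVneq i 0.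
  by case: Ei; rewrite i0' subr0.
have {}ipos : 0 < i by rewrite lt_neqAle eq_sym ipos.
have [|r /= r0 hr] := ld i e _ e0; first by rewrite ipos.
pose h := Num.min (r / 2) (i / 2).
have h0 : 0 < h by rewrite lt_min !divr_gt0.
have hlr : h < r by rewrite gt_min ltr_pdivrMr// ltr_pMr// ltr1n.
have hli : h < i by rewrite gt_min orbC ltr_pdivrMr// ltr_pMr// ltr1n.
have := hr h; rewrite /ball_/= sub0r normrN gtr0_norm// => /(_ hlr h0) hh.
have : E (i - h).
  split; first by rewrite subr_ge0 (ltW hli)/= lerBlDr (le_trans iT)// lerDl ltW.
  by case: Ei => _ /le_trans; apply; lra.
have lb : has_lbound E by exists 0.
move=> /(ge_inf lb); rewrite -/i; lra.
Qed.

Variable X : normedModType R.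

(** Up to [o(h)], [G (t - h)] is [G t - h A (G t)], whose norm is at least that
of [G t] by dissipativity.  Uniqueness of solutions and contractivity of
semigroups rest on this lemma. *)
Lemma dissipative_nonincreasing (D : set X) (A : X -> X) (G : R -> X) (T : R) :
  dissipative D A -> 0 <= T ->
  (forall t, 0 <= t < T -> G (t + h) @[h --> 0^'+] --> G t) ->
  (forall t, 0 < t <= T -> D (G t) /\
     h^-1 *: (G t - G (t - h)) @[h --> 0^'+] --> A (G t)) ->
  `|G T| <= `|G 0|.
Proof.
move=> dA T0 rc ld; apply: (left_Dini_nonincreasing T0 (phi := fun t => `|G t|)).
  by move=> t /rc cG; apply: cvg_norm.
move=> t e tT e0; have [DG /cvgrPdist_lt/(_ _ e0) cG] := ld t tT.
near=> h; have h0 : 0 < h by near: h; exact: nbhs_right_gt.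
rewrite /=; apply: (le_trans (dA _ _ (ltW h0) DG)).
have -> : G t - h *: A (G t) =
    G (t - h) - h *: (A (G t) - h^-1 *: (G t - G (t - h))).
  by rewrite scalerBr scalerA mulfV ?gt_eqF// scale1r [G (t - h) - _]addrC opprB addrAC subrK.
apply: (le_trans (ler_normB _ _)); rewrite lerD2l normrZ gtr0_norm// mulrC.
rewrite ler_pM2r// ltW//; near: h; exact: cG.
Unshelve. all: by end_near. Qed.

End Dini.

(** * Resolvents *)

(** The hypotheses of the Lumer-Phillips theorem, with the range condition for
all step sizes. *)
Record m_dissipative (R : realType) (X : normedModType R) (D : set X)
    (A : X -> X) : Prop := {
  mdis_linear : forall (a : R) x y, D x -> D y ->
    D (a *: x + y) /\ A (a *: x + y) = a *: A x + A y;
  mdis_dissipative : dissipative D A;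
  mdis_range : forall (h : R) f, 0 < h -> exists x, D x /\ x - h *: A x = f;
  mdis_dense : forall x (e : R), 0 < e -> exists2 y, D y & `|x - y| < e }.

(** Completeness as a property of a normed space rather than as a structure, so
that it can be proved of a given space afterwards. *)
Definition seq_complete (R : realType) (X : normedModType R) : Prop :=
  forall u : nat -> X,
    (forall e : R, 0 < e -> exists N, forall m n,
      (N <= m)%N -> (N <= n)%N -> `|u m - u n| <= e) ->
    exists v : X, u @ \oo --> v.

Section linear_on_domain.
Context (R : realType) (X : normedModType R) (D : set X) (A : X -> X).
Hypothesis mA : m_dissipative D A.

Lemma mdis0 : D 0 /\ A 0 = 0.
Proof.
have [x [Dx _]] := mdis_range mA 0 (@ltr01 R).
by have := mdis_linear mA (-1) Dx Dx; rewrite !scaleN1r !addNr.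
Qed.

Lemma mdisZ (a : R) x : D x -> D (a *: x) /\ A (a *: x) = a *: A x.
Proof.
move=> Dx; have [D0 A0] := mdis0; have := mdis_linear mA a Dx D0.
by rewrite A0 !addr0.
Qed.

Lemma mdisB x y : D x -> D y -> D (x - y) /\ A (x - y) = A x - A y.
Proof.
move=> Dx Dy; have := mdis_linear mA (-1) Dy Dx.
by rewrite !scaleN1r ![- _ + _]addrC.
Qed.

(** [(1 - h A)^-1], one step of the backward Euler scheme. *)
Definition resolvent (h : R) (f : X) : X :=
  if pselect (0 < h) is left h0 then sval (cid (mdis_range mA f h0)) else f.

Section resolvent.
Variable h : R.
Hypothesis h0 : 0 < h.
Local Notation J := (resolvent h).

Lemma resolventP f : D (J f) /\ J f - h *: A (J f) = f.
Proof. by rewrite /resolvent; case: pselect => // h1; case: cid. Qed.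

(** Dissipativity makes [x - h A x] determine [x]. *)
Lemma resolventK x : D x -> J (x - h *: A x) = x.
Proof.
move=> Dx; have [DJ EJ] := resolventP (x - h *: A x).
have [Dd Ad] := mdisB DJ Dx; apply/eqP; rewrite -subr_eq0 -normr_le0.
apply: (le_trans (mdis_dissipative mA (ltW h0) Dd)).
by rewrite Ad scalerBr opprD addrACA EJ -opprD subrr normr0.
Qed.

Lemma resolvent_linear (a : R) x y : J (a *: x + y) = a *: J x + J y.
Proof.
have [Dx Ex] := resolventP x; have [Dy Ey] := resolventP y.
have [Dz Az] := mdis_linear mA a Dx Dy.
rewrite -{1}Ex -{1}Ey -[RHS]resolventK// Az; congr J.
by rewrite !scalerBr !scalerDr opprD addrACA !scalerA mulrC.
Qed.

Lemma resolventB x y : J (x - y) = J x - J y.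
Proof.
by have := resolvent_linear (-1) y x; rewrite !scaleN1r ![- _ + _]addrC.
Qed.

Lemma resolvent_contract f : `|J f| <= `|f|.
Proof.
have [DJ EJ] := resolventP f; rewrite -{2}EJ.
exact: (mdis_dissipative mA (ltW h0)).
Qed.

Lemma resolventA x : D x -> A (J x) = J (A x).
Proof.
move=> Dx; have [DJ EJ] := resolventP x.
have hAJ : h *: A (J x) = J x - x by rewrite -{3}EJ subKr.
have DA : D (A (J x)).
  rewrite -[A _](scalerK (lt0r_neq0 h0)); apply: (mdisZ _ _).1.
  by rewrite hAJ; exact: (mdisB DJ Dx).1.
rewrite -[LHS](resolventK DA); congr J.
have [DhA AhA] := mdisZ h DA.
by rewrite -AhA -(mdisB DJ DhA).2 EJ.
Qed.

Lemma resolvent_sub x : D x -> `|J x - x| <= h * `|A x|.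
Proof.
move=> Dx; have [DJ EJ] := resolventP x.
rewrite (_ : J x - x = h *: A (J x)); last by rewrite -{2}EJ subKr.
rewrite normrZ gtr0_norm// resolventA// ler_pM2l//.
exact: resolvent_contract.
Qed.

Lemma iter_resolventB n x y : iter n J (x - y) = iter n J x - iter n J y.
Proof. by elim: n => //= n ->; exact: resolventB. Qed.

Lemma iter_resolvent_linear n (a : R) x y :
  iter n J (a *: x + y) = a *: iter n J x + iter n J y.
Proof. by elim: n => //= n ->; exact: resolvent_linear. Qed.

Lemma iter_resolvent_contract n x : `|iter n J x| <= `|x|.
Proof. by elim: n => //= n; apply: le_trans; exact: resolvent_contract. Qed.

Lemma iter_resolventA n x : D x ->
  D (iter n J x) /\ A (iter n J x) = iter n J (A x).
Proof.
move=> Dx; elim: n => //= n [Dn An]; split; first exact: (resolventP _).1.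
by rewrite resolventA// An.
Qed.

Lemma iter_resolvent_sub n x : D x -> `|iter n J x - x| <= n%:R * h * `|A x|.
Proof.
move=> Dx; elim: n => [|n IH] /=; first by rewrite subrr normr0 !mul0r.
have -> : J (iter n J x) - x = J (iter n J x - x) + (J x - x).
  by rewrite resolventB addrA subrK.
apply: (le_trans (ler_normD _ _)); rewrite -natr1 mulrDl mul1r mulrDl lerD//.
  exact: le_trans (resolvent_contract _) _.
exact: resolvent_sub.
Qed.

(** The Euler scheme follows the tangent [x + t A x] up to second order, with a
constant that does not depend on the step: in the limit this computes the
generator. *)
Lemma iter_resolvent_taylor n x : D x -> D (A x) ->
  `|iter n J x - x - (n%:R * h) *: A x| <= (n%:R * h) ^+ 2 * `|A (A x)|.
Proof.
move=> Dx DAx; elim: n => [|n IH] /=.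
  by rewrite subrr sub0r mul0r scale0r oppr0 normr0 expr0n/= mul0r.
have [Dn An] := iter_resolventA n Dx.
have E m : J (iter m J x) - iter m J x = h *: J (A (iter m J x)).
  have [Dm _] := iter_resolventA m Dx.
  have [_ {2}<-] := resolventP (iter m J x).
  by rewrite subKr resolventA.
have -> : J (iter n J x) - x - (n.+1%:R * h) *: A x =
   (iter n J x - x - (n%:R * h) *: A x) + h *: (iter n.+1 J (A x) - A x).
  rewrite -natr1 mulrDl mul1r scalerDl scalerBr /= -An -E opprD !addrA.
  by congr (_ - _); rewrite [RHS]addrC -!addrA addKr [LHS]addrC -!addrA.
apply: (le_trans (ler_normD _ _)).
have hn : `|h *: (iter n.+1 J (A x) - A x)| <= h * (n.+1%:R * h * `|A (A x)|).
  by rewrite normrZ gtr0_norm// ler_pM2l// iter_resolvent_sub.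
apply: (le_trans (lerD IH hn)).
rewrite -subr_ge0 -natr1.
rewrite (_ : _ - _ = n%:R * h ^+ 2 * `|A (A x)|); last by ring.
by rewrite !mulr_ge0// ltW.
Qed.

End resolvent.
End linear_on_domain.

(** * Dyadic time steps *)

Lemma subrACA (V : zmodType) (a b c d : V) : a - b - (c - d) = a - c - (b - d).
Proof. by rewrite opprD addrACA -opprD. Qed.

Lemma cvg_norm_le (R : realType) (X : normedModType R) (u : nat -> X) (v : X)
    (b : nat -> R) (c : R) : u @ \oo --> v -> b @ \oo --> c ->
  (forall m, `|u m| <= b m) -> `|v| <= c.
Proof.
move=> uv bc ub; apply: (ler_cvg_to (f := fun m => `|u m|) _ bc).
- exact: cvg_norm.
- exact: nearW.
Qed.

Lemma cvg_norm_unique (R : realType) (X : normedModType R) (I : Type)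
    (F : set_system I) {FF : ProperFilter F} (f : I -> X) (a b : X) :
  f @ F --> a -> f @ F --> b -> a = b.
Proof. exact: (cvg_unique (@norm_hausdorff _ X)). Qed.

Section dyadic.
Context {R : realType}.

Definition dyadic_mesh (m : nat) : R := 2^-1 ^+ m.
Definition dyadic_steps (m : nat) (t : R) : nat := Num.truncn (t * 2 ^+ m).
Local Notation mesh := dyadic_mesh.
Local Notation steps := dyadic_steps.

Lemma dyadic_mesh_gt0 m : 0 < mesh m.
Proof. by rewrite exprn_gt0// invr_gt0. Qed.

Lemma dyadic_meshS m : mesh m.+1 = mesh m / 2.
Proof. by rewrite /dyadic_mesh exprSr. Qed.

Lemma cvg_dyadic_mesh : mesh @ \oo --> 0.
Proof. by apply: cvg_expr; rewrite gtr0_norm ?invr_gt0// invf_lt1// ltr1n. Qed.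

Lemma dyadic_steps_le m t : 0 <= t -> (steps m t)%:R * mesh m <= t.
Proof.
move=> t0; rewrite /dyadic_mesh exprVn ler_pdivrMr ?exprn_gt0//.
by rewrite truncn_le mulr_ge0// exprn_ge0.
Qed.

Lemma dyadic_steps_gt m t : t < (steps m t).+1%:R * mesh m.
Proof. by rewrite /dyadic_mesh exprVn ltr_pdivlMr ?exprn_gt0// truncnS_gt. Qed.

(** Halving the mesh doubles the number of full steps before [t], up to one. *)
Lemma dyadic_stepsS m t : 0 <= t -> exists2 b, (b <= 1)%N &
  steps m.+1 t = ((steps m t).*2 + b)%N.
Proof.
move=> t0; have h1 := dyadic_steps_le m t0; have h2 := dyadic_steps_gt m t.
have h3 := dyadic_steps_le m.+1 t0; have h4 := dyadic_steps_gt m.+1 t.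
have h0 := dyadic_mesh_gt0 m; have h0' := dyadic_mesh_gt0 m.+1.
have E : mesh m = 2 * mesh m.+1 by rewrite dyadic_meshS mulrC divfK.
exists (steps m.+1 t - (steps m t).*2)%N.
  rewrite leq_subLR addn1 -ltnS -(ltr_nat R) -(ltr_pM2r h0').
  apply: (le_lt_trans h3); apply: (lt_le_trans h2).
  by rewrite E mulrA -natrM muln2 doubleS.
rewrite subnKC// -ltnS -(ltr_nat R) -(ltr_pM2r h0').
apply: le_lt_trans h4; apply: le_trans h1.
by rewrite E mulrA -natrM muln2.
Qed.

Lemma dyadic_stepsD m s t : 0 <= s -> 0 <= t -> exists2 b, (b <= 1)%N &
  steps m (s + t) = (steps m s + steps m t + b)%N.
Proof.
move=> s0 t0; have h1 := dyadic_steps_le m s0; have h2 := dyadic_steps_gt m s.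
have h3 := dyadic_steps_le m t0; have h4 := dyadic_steps_gt m t.
have st0 := addr_ge0 s0 t0.
have h5 := dyadic_steps_le m st0; have h6 := dyadic_steps_gt m (s + t).
have h0 := dyadic_mesh_gt0 m.
exists (steps m (s + t) - (steps m s + steps m t))%N.
  rewrite leq_subLR -ltnS -(ltr_nat R) -(ltr_pM2r h0).
  apply: (le_lt_trans h5); apply: (lt_le_trans (ltrD h2 h4)).
  by rewrite -mulrDl -natrD addSn addnS addn1.
rewrite subnKC// -ltnS -(ltr_nat R) -(ltr_pM2r h0).
apply: le_lt_trans h6; by rewrite natrD mulrDl; exact: lerD.
Qed.

Lemma dyadic_steps_cvg t : 0 <= t -> (steps m t)%:R * mesh m @[m --> \oo] --> t.
Proof.
move=> t0; apply: (squeeze_cvgr (f := fun m => t - mesh m) (h := cst t)).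
- apply: nearW => m; rewrite dyadic_steps_le// andbT lerBlDr.
  by have := ltW (dyadic_steps_gt m t); rewrite -natr1 mulrDl mul1r.
- by rewrite -[X in _ --> X]subr0; apply: cvgB; [exact: cvg_cst|exact: cvg_dyadic_mesh].
- exact: cvg_cst.
Qed.

(** The increments are dominated by a geometric series: the distance from [m]
to [m + p] telescopes to at most [2 C (mesh m - mesh (m + p))]. *)
Lemma dyadic_cauchy (X : normedModType R) (u : nat -> X) (C e : R) :
  (forall m, `|u m - u m.+1| <= C * mesh m) -> 0 < e ->
  exists N, forall p, `|u N - u (N + p)%N| <= e.
Proof.
move=> uC e0.
have C0 : 0 <= C by rewrite -(pmulr_lge0 _ (dyadic_mesh_gt0 0)) (le_trans _ (uC 0%N)).
have H m p : `|u m - u (m + p)%N| <= 2 * C * (mesh m - mesh (m + p)%N).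
  elim: p => [|p IH]; first by rewrite addn0 !subrr mulr0 normr0.
  rewrite addnS; apply: (le_trans (ler_distD (u (m + p)%N) _ _)).
  apply: (le_trans (lerD IH (uC _))); rewrite dyadic_meshS -subr_ge0.
  by rewrite (_ : _ - _ = 0)//; field.
have d0 : 0 < e / (2 * C + 1) by rewrite divr_gt0// ltr_wpDl// mulr_ge0.
have [N _ hN] : \forall m \near \oo, mesh m < e / (2 * C + 1).
  move/cvgrPdist_lt : cvg_dyadic_mesh => /(_ _ d0); apply: filterS => m.
  by rewrite sub0r normrN gtr0_norm// dyadic_mesh_gt0.
exists N => p; apply: (le_trans (H _ _)).
have h1 := hN N (leqnn N); have h2 := ltW (dyadic_mesh_gt0 (N + p)).
have h3 := ltW (dyadic_mesh_gt0 N).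
rewrite ltr_pdivlMr ?ltr_wpDl// ?mulr_ge0// in h1.
apply: le_trans (ltW h1); rewrite mulrC.
apply: (@le_trans _ _ (mesh N * (2 * C))).
  by rewrite ler_wpM2r ?mulr_ge0// lerBlDr lerDl.
by rewrite ler_wpM2l// lerDl.
Qed.

End dyadic.

Arguments dyadic_mesh_gt0 {R} m.
Arguments dyadic_meshS {R} m.
Arguments cvg_dyadic_mesh {R}.

(** * Generation of a semigroup *)

Section generation.
Context (R : realType) (X : normedModType R) (D : set X) (A : X -> X).
Hypotheses (cX : seq_complete X) (mA : m_dissipative D A).
Local Notation J := (resolvent mA).

Lemma resolvent_approx f (e : R) : 0 < e -> exists2 h, 0 < h & `|J h f - f| <= e.
Proof.
move=> e0; have e30 : 0 < e / 3 by rewrite divr_gt0.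
have [g Dg fg] := mdis_dense mA f e30.
exists (e / 3 / (`|A g| + 1)); first by rewrite divr_gt0// ltr_wpDl.
set h := _ / _; have h0 : 0 < h by rewrite divr_gt0// ltr_wpDl.
have -> : J h f - f = J h (f - g) + (J h g - g) + (g - f).
  by rewrite resolventB// !addrA !subrK.
apply: (le_trans (ler_normD _ _)); rewrite [`|g - f|]distrC.
have h1 := ler_normD (J h (f - g)) (J h g - g).
have h2 := resolvent_contract mA h0 (f - g).
have h3 := resolvent_sub mA h0 Dg.
have h4 : h * `|A g| <= e / 3.
  rewrite /h mulrAC ler_pdivrMr ?ltr_wpDl// ler_pM2l//.
  by rewrite lerDl.
by lra.
Qed.

(** Two applications of the operator are needed for second-order estimates;
[J h] improves a vector of the domain to such a vector and moves it little. *)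
Lemma dense_domain2 x (e : R) : 0 < e ->
  exists y, [/\ D y, D (A y) & `|x - y| < e].
Proof.
move=> e0; have e20 : 0 < e / 2 by rewrite divr_gt0.
have e30 : 0 < e / 3 by rewrite divr_gt0.
have [z Dz xz] := mdis_dense mA x e20; have [h h0 Jz] := resolvent_approx z e30.
have [DJ _] := resolventP mA h0 z; exists (J h z); split => //.
  by rewrite resolventA//; exact: (resolventP _ _ _).1.
rewrite -(subrK z x) -addrA; apply: (le_lt_trans (ler_normD _ _)).
by rewrite [`|z - _|]distrC; lra.
Qed.

(** The local error of one step against two half steps.  With [y] the result of
the two half steps, [x = (1 - h/2 A)^2 y] exceeds [(1 - h A) y] by
[h^2/4 A (A y)], and [J h] contracts. *)
Lemma resolvent_halving (h : R) x : 0 < h -> D x -> D (A x) ->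
  `|J h x - J (h / 2) (J (h / 2) x)| <= h ^+ 2 / 4 * `|A (A x)|.
Proof.
move=> h0 Dx DAx; have k0 : 0 < h / 2 by rewrite divr_gt0.
set k := h / 2 in k0 *; set z := J k x; set y := J k z.
have [Dz Ez] : D z /\ z - k *: A z = x := resolventP mA k0 x.
have [Dy Ey] : D y /\ y - k *: A y = z := resolventP mA k0 z.
have [_ Ay] : D y /\ A y = J k (J k (A x)) := iter_resolventA mA k0 2 Dx.
have [DAy AAy] : D (A y) /\ A (A y) = J k (J k (A (A x))).
  by rewrite Ay; exact: (iter_resolventA mA k0 2 DAx).
have Az : A z = A y - k *: A (A y).
  have [DkA <-] := mdisZ mA k DAy.
  by rewrite -(mdisB mA Dy DkA).2 Ey.
have Ex : x = (h ^+ 2 / 4) *: A (A y) + (y - h *: A y).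
  transitivity (y - k *: A y - k *: (A y - k *: A (A y))).
    by rewrite Ey -Az Ez.
  rewrite scalerBr scalerA opprB addrCA; congr (_ *: _ + _).
    by rewrite /k; field.
  by rewrite -addrA -opprD -scalerDl -splitr.
rewrite {1}Ex resolvent_linear// resolventK// addrK normrZ AAy.
have c0 : 0 <= h ^+ 2 / 4 by rewrite divr_ge0// sqr_ge0.
rewrite ger0_norm// ler_wpM2l//.
apply: (le_trans (resolvent_contract mA h0 _)).
exact: le_trans (resolvent_contract mA k0 _) (resolvent_contract mA k0 _).
Qed.

(** Accumulation of the local errors: contractivity of [J h] keeps earlier
errors from being amplified. *)
Lemma iter_resolvent_halving (h : R) n x : 0 < h -> D x -> D (A x) ->
  `|iter n (J h) x - iter n.*2 (J (h / 2)) x|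
    <= n%:R * (h ^+ 2 / 4) * `|A (A x)|.
Proof.
move=> h0 Dx DAx; have k0 : 0 < h / 2 by rewrite divr_gt0.
elim: n => [|n IH] /=; first by rewrite subrr normr0 !mul0r.
set u := iter n _ _ in IH *; set v := iter n.*2 _ _ in IH *.
have [Dv Av] : D v /\ A v = _ := iter_resolventA mA k0 n.*2 Dx.
have [DAv AAv] : D (A v) /\ A (A v) = iter n.*2 (J (h / 2)) (A (A x)).
  by rewrite Av; exact: iter_resolventA.
have -> : J h u - J (h / 2) (J (h / 2) v) =
    J h (u - v) + (J h v - J (h / 2) (J (h / 2) v)).
  by rewrite resolventB// addrA subrK.
apply: (le_trans (ler_normD _ _)).
have h1 := resolvent_contract mA h0 (u - v).
have h2 := resolvent_halving h0 Dv DAv.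
have h3 : `|A (A v)| <= `|A (A x)|.
  by rewrite AAv; exact: iter_resolvent_contract.
have c0 : 0 <= h ^+ 2 / 4 by rewrite divr_ge0// sqr_ge0.
rewrite -[n.+1%:R]natr1 !mulrDl mul1r; apply: lerD; first exact: le_trans h1 IH.
by apply: (le_trans h2); rewrite ler_wpM2l.
Qed.

Lemma iter_resolvent_extra (h : R) n p x : 0 < h -> D x ->
  `|iter (n + p) (J h) x - iter n (J h) x| <= p%:R * h * `|A x|.
Proof.
move=> h0 Dx; rewrite iterD -iter_resolventB//.
apply: (le_trans (iter_resolvent_contract _ _ _ _)) => //.
exact: iter_resolvent_sub.
Qed.

Local Notation mesh := (@dyadic_mesh R).
Local Notation steps := dyadic_steps.
Let mesh_gt0 m : 0 < mesh m. Proof. exact: dyadic_mesh_gt0. Qed.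

Let approx (m : nat) (t : R) x := iter (steps m t) (J (mesh m)) x.

(** [t / mesh m] steps with local error [mesh m ^ 2] give a global error of
order [mesh m], and the possible extra half step costs the same. *)
Let approx_step m t x : 0 <= t -> D x -> D (A x) ->
  `|approx m t x - approx m.+1 t x| <= (t * `|A (A x)| + `|A x|) * mesh m.
Proof.
move=> t0 Dx DAx; have [b b1 E] := dyadic_stepsS m t0.
have h0 : 0 < mesh m := dyadic_mesh_gt0 m.
have h0' : 0 < mesh m.+1 := dyadic_mesh_gt0 m.+1.
have h1 := iter_resolvent_halving (steps m t) h0 Dx DAx.
have h2 := iter_resolvent_extra (steps m t).*2 b h0' Dx.
rewrite -(subrK (iter (steps m t).*2 (J (mesh m.+1)) x) (approx m t x)) -addrA.
apply: (le_trans (ler_normD _ _)); rewrite mulrDl; apply: lerD.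
  rewrite dyadic_meshS; apply: (le_trans h1); rewrite [leRHS]mulrAC.
  rewrite ler_wpM2r//; have h3 := dyadic_steps_le m t0.
  rewrite (_ : _ * _ = (steps m t)%:R * mesh m * (mesh m / 4)); last by field.
  apply: ler_pM => //; rewrite ?mulr_ge0 ?divr_ge0 ?(ltW h0)//.
  by rewrite ler_pdivrMr// ler_peMr ?(ltW h0)// ler1n.
rewrite distrC /approx E; apply: (le_trans h2); rewrite mulrC ler_wpM2l//.
rewrite dyadic_meshS mulrCA -[leRHS]mulr1 ler_pM2l// ler_pdivrMr// mul1r ler_nat.
exact: leq_trans b1 _.
Qed.

Let approxB m t x y : approx m t (x - y) = approx m t x - approx m t y.
Proof. exact: iter_resolventB. Qed.

Let approx_contract m t x : `|approx m t x| <= `|x|.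
Proof. exact: iter_resolvent_contract. Qed.

Let approx_cvg t x : 0 <= t -> exists v : X, approx m t x @[m --> \oo] --> v.
Proof.
move=> t0; apply: cX => e e0; have e40 : 0 < e / 4 by rewrite divr_gt0.
have [y [Dy DAy xy]] := dense_domain2 x e40.
have [N H] := dyadic_cauchy (fun m => approx_step m t0 Dy DAy) e40.
exists N => m n Nm Nn.
have Hm := H (m - N)%N; have Hn := H (n - N)%N; rewrite !subnKC// in Hm Hn.
have am := approx_contract m t (x - y); have an := approx_contract n t (x - y).
rewrite approxB in am; rewrite approxB in an.
have h1 := ler_distD (approx m t y) (approx m t x) (approx n t x).
have h2 := ler_distD (approx n t y) (approx m t y) (approx n t x).
have h3 := ler_distD (approx N t y) (approx m t y) (approx n t y).
rewrite [`|approx m t y - approx N t y|]distrC in h3.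
rewrite [`|approx n t y - approx n t x|]distrC in h2.
lra.
Qed.

Definition generated_semigroup (t : R) (x : X) : X :=
  lim (approx m t x @[m --> \oo]).
Local Notation T := generated_semigroup.

Let T_cvg t x : 0 <= t -> approx m t x @[m --> \oo] --> T t x.
Proof. by move=> /(approx_cvg x) [v /cvgP]. Qed.

Arguments T_cvg [t] x _.

Let T_linear t (a : R) x y : 0 <= t -> T t (a *: x + y) = a *: T t x + T t y.
Proof.
move=> t0; apply: (cvg_norm_unique (T_cvg _ t0)).
rewrite (_ : (fun m => _) = (fun m => a *: approx m t x + approx m t y)).
  by apply: cvgD; [apply: cvgZl_tmp; exact: T_cvg|exact: T_cvg].
by apply/funext => m; exact: iter_resolvent_linear.
Qed.

Let TB t x y : 0 <= t -> T t (x - y) = T t x - T t y.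
Proof.
move=> t0; have := T_linear (-1) y x t0.
by rewrite !scaleN1r ![- _ + _]addrC.
Qed.

Let T_contract t x : 0 <= t -> `|T t x| <= `|x|.
Proof.
move=> t0; apply: (cvg_norm_le (T_cvg x t0) (cvg_cst `|x|)) => m.
exact: approx_contract.
Qed.

Let T0 x : T 0 x = x.
Proof.
apply: (cvg_norm_unique (T_cvg _ _)) => //.
rewrite (_ : (fun m => _) = (fun=> x)); first exact: cvg_cst.
by apply/funext => m; rewrite /approx /dyadic_steps mul0r truncn0.
Qed.

Let T_sub t x : 0 <= t -> D x -> `|T t x - x| <= t * `|A x|.
Proof.
move=> t0 Dx; apply: (cvg_norm_le (u := fun m => approx m t x - x)
  _ (cvg_cst (t * `|A x|))).
  by apply: cvgB; [exact: T_cvg|exact: cvg_cst].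
move=> m; apply: (le_trans (iter_resolvent_sub mA _ _ Dx)) => //.
by rewrite ler_wpM2r// dyadic_steps_le.
Qed.

Let T_taylor t x : 0 <= t -> D x -> D (A x) ->
  `|T t x - x - t *: A x| <= t ^+ 2 * `|A (A x)|.
Proof.
move=> t0 Dx DAx; apply: (cvg_norm_le
  (u := fun m => approx m t x - x - ((steps m t)%:R * mesh m) *: A x)
  (b := fun m => ((steps m t)%:R * mesh m) ^+ 2 * `|A (A x)|)).
- apply: cvgB; last by apply: cvgZr_tmp; exact: dyadic_steps_cvg.
  by apply: cvgB; [exact: T_cvg|exact: cvg_cst].
- apply: cvgM; last exact: cvg_cst.
  by rewrite expr2; apply: cvgM; exact: dyadic_steps_cvg.
- by move=> m; exact: iter_resolvent_taylor.
Qed.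

(** The numbers of steps for [s] and [t] add up to that for [s + t] up to one
step, whose effect vanishes on the domain. *)
Let T_add_domain s t x : 0 <= s -> 0 <= t -> D x -> T (s + t) x = T s (T t x).
Proof.
move=> s0 t0 Dx; have st0 := addr_ge0 s0 t0.
apply/eqP; rewrite -subr_eq0 -normr_le0.
apply: (cvg_norm_le (u := fun m => approx m (s + t) x - approx m s (T t x))
  (b := fun m => mesh m * `|A x| + `|approx m t x - T t x|)).
- by apply: cvgB; exact: T_cvg.
- rewrite [X in _ --> X](_ : 0 = 0 * `|A x| + `|T t x - T t x|); last first.
    by rewrite subrr normr0 mul0r addr0.
  apply: cvgD; first by apply: cvgM; [exact: cvg_dyadic_mesh|exact: cvg_cst].
  by apply: cvg_norm; apply: cvgB; [exact: T_cvg|exact: cvg_cst].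
- move=> m; have [b b1 E] := dyadic_stepsD m s0 t0.
  apply: (le_trans (ler_distD (approx m s (approx m t x)) _ _)).
  rewrite -approxB; apply: lerD; last exact: approx_contract.
  rewrite {1}/approx E /approx -iterD.
  apply: (le_trans (iter_resolvent_extra _ _ _ Dx)) => //.
  rewrite ler_wpM2r// -[leRHS]mul1r ler_pM2r//.
  by rewrite lern1.
Qed.

Let T_add s t x : 0 <= s -> 0 <= t -> T (s + t) x = T s (T t x).
Proof.
move=> s0 t0; have st0 := addr_ge0 s0 t0.
apply/eqP; rewrite -subr_eq0 -normr_le0; apply/ler_addgt0Pr => e e0.
rewrite add0r; have e20 : 0 < e / 2 by rewrite divr_gt0.
have [y Dy xy] := mdis_dense mA x e20.
have h1 := T_contract (x - y) st0; have h2 := T_contract (x - y) t0.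
have h3 := T_contract (T t (x - y)) s0.
rewrite TB// (T_add_domain s0 t0 Dy) in h1; rewrite !TB// in h3.
have h4 := ler_distD (T s (T t y)) (T (s + t) x) (T s (T t x)).
rewrite [`|T s (T t y) - _|]distrC in h4.
rewrite TB// in h2; lra.
Qed.

Let T_cvg0 x : T t x @[t --> 0^'+] --> x.
Proof.
apply/cvgrPdist_le => e e0; have e30 : 0 < e / 3 by rewrite divr_gt0.
have [y Dy xy] := mdis_dense mA x e30.
have a0 : 0 < `|A y| + 1 by rewrite ltr_wpDl.
near=> t; have t0 : 0 < t by near: t; exact: nbhs_right_gt.
have t0' := ltW t0; have h1 := T_contract (x - y) t0'; rewrite TB// in h1.
have h2 := T_sub t0' Dy.
have h3 : t * `|A y| <= e / 3.
  have : t * (`|A y| + 1) <= e / 3.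
    rewrite -ler_pdivlMr//; near: t; apply: nbhs_right_le.
    by rewrite divr_gt0.
  by apply: le_trans; rewrite ler_pM2l// lerDl.
have h4 := ler_distD y x (T t x); have h5 := ler_distD (T t y) y (T t x).
rewrite [`|y - T t y|]distrC [`|T t y - T t x|]distrC in h5; lra.
Unshelve. all: by end_near. Qed.

(** [T_taylor] gives the derivative only where [A (A x)] exists.  A general [x]
of the domain is compared with [z = J k x], for which [A z = J k (A x)] is
close to [A x]; the difference [x - z] moves at speed at most [|A x - A z|]. *)
Let T_generator_domain x : D x -> h^-1 *: (T h x - x) @[h --> 0^'+] --> A x.
Proof.
move=> Dx; apply/cvgrPdist_le => e e0; have e60 : 0 < e / 6 by rewrite divr_gt0.
have [k k0 Jk] := resolvent_approx (A x) e60.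
pose z := J k x; have [Dz _] : D z /\ _ := resolventP mA k0 x.
have Az : A z = J k (A x) by exact: resolventA.
have DAz : D (A z) by rewrite Az; exact: (resolventP mA k0 _).1.
have a0 : 0 < `|A (A z)| + 1 by rewrite ltr_wpDl.
near=> t; have t0 : 0 < t by near: t; exact: nbhs_right_gt.
have t0' := ltW t0; have [Dd Ad] := mdisB mA Dx Dz.
have h1 := T_sub t0' Dd; rewrite Ad TB// in h1.
have h2 := T_taylor t0' Dz DAz.
have h3 : t * `|A (A z)| <= e / 6.
  have : t * (`|A (A z)| + 1) <= e / 6.
    rewrite -ler_pdivlMr//; near: t; apply: nbhs_right_le.
    by rewrite divr_gt0.
  by apply: le_trans; rewrite ler_pM2l// lerDl.
rewrite -(ler_pM2l t0) -{1}(gtr0_norm t0) -normrZ scalerBr scalerA mulfV ?gt_eqF//.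
rewrite scale1r distrC.
have h4 := ler_distD (T t z - z) (T t x - x) (t *: A x).
have h5 := ler_distD (t *: A z) (T t z - z) (t *: A x).
have h6 : `|t *: A z - t *: A x| <= t * (e / 6).
  by rewrite -scalerBr normrZ gtr0_norm// ler_pM2l// Az.
rewrite subrACA in h1.
have h7 : t * `|A x - A z| <= t * (e / 6) by rewrite ler_pM2l// distrC Az.
have h8 : t ^+ 2 * `|A (A z)| <= t * (e / 6).
  by rewrite expr2 -mulrA ler_pM2l.
have := mulr_gt0 t0 e0; lra.
Unshelve. all: by end_near. Qed.

Let T_continuous t : 0 <= t -> continuous (T t).
Proof.
move=> t0 x; apply/cvgrPdist_le => e e0; near=> y.
rewrite -TB//; apply: (le_trans (T_contract _ t0)); near: y.
by apply: (@cvgrPdist_le _ _ _ (nbhs x) _ id x).1.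
Unshelve. all: by end_near. Qed.

(** A vector on which the generator acts as the identity would be expanded by a
factor about [1 + h] in time [h], against contractivity. *)
Let T_no_growth d : h^-1 *: (T h d - d) @[h --> 0^'+] --> d -> d = 0.
Proof.
move=> /cvgrPdist_le cd; apply: contrapT => /eqP d0.
have nd : 0 < `|d| / 2 by rewrite divr_gt0// normr_gt0.
have [h [h0 hd]] : exists h : R, 0 < h /\ `|d - h^-1 *: (T h d - d)| <= `|d| / 2.
  near (0 : R)^'+ => h; exists h; split; first by near: h; exact: nbhs_right_gt.
  by near: h; exact: cd.
rewrite -(ler_pM2l h0) -{1}(gtr0_norm h0) -normrZ scalerBr scalerA mulfV ?gt_eqF// scale1r in hd.
have h1 := T_contract d (ltW h0).
have h2 := ler_norm (`|d + h *: d| - `|T h d|).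
have h3 := ler_dist_dist (d + h *: d) (T h d).
have h4 : `|d + h *: d - T h d| <= h * (`|d| / 2).
  by move: hd; rewrite opprB addrCA addrA.
have h5 : `|d + h *: d| = (1 + h) * `|d|.
  by rewrite -{1}(scale1r d) -scalerDl normrZ gtr0_norm// addr_gt0.
have := mulr_gt0 h0 nd; lra.
Unshelve. all: by end_near. Qed.

(** The generator [B] of the limit extends [A].  It cannot be larger: if
[B x = y], the range condition gives [z] in [D] such that [z - A z = x - y], so
that [B (x - z) = x - z], which [T_no_growth] excludes unless [x = z]. *)
Lemma m_dissipative_generates : exists S, C0_semigroup_generated_by S D A.
Proof.
exists T; split.
  split; [|exact: T_continuous|exact: T0|exact: T_add|exact: T_cvg0].
  by move=> t t0 a x y; exact: T_linear.
move=> x y; split=> [[Dx <-]|Bx]; first exact: T_generator_domain.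
have [z [Dz]] := mdis_range mA (x - y) ltr01; rewrite scale1r => Ez.
suff xz : x = z by rewrite xz; split=> //; move: Ez; rewrite xz => /addrI/oppr_inj.
apply/eqP; rewrite -subr_eq0; apply/eqP; apply: T_no_growth.
rewrite [X in _ --> X](_ : x - z = y - A z); last first.
  by rewrite -[z in LHS](subrK (A z)) Ez opprD opprB addrA addrCA subrr addr0.
have /cvgB/(_ (T_generator_domain Dz)) := Bx.
apply: cvg_trans; apply: near_eq_cvg; near=> h.
have h0 : 0 < h by near: h; exact: nbhs_right_gt.
by rewrite TB ?(ltW h0)// subrACA scalerBr.
Unshelve. all: by end_near. Qed.

End generation.

(** * Uniform boundedness *)

(** A filter version of completeness, needed to see the space as an instance of
the complete normed spaces of the uniform boundedness theorem: a Cauchy filter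
has the limit of a sequence of centers of small balls that belong to it. *)
Lemma seq_complete_cauchy_cvg (R : realType) (X : normedModType R) :
  seq_complete X ->
  forall F : set_system X, ProperFilter F -> cauchy F -> cvg F.
Proof.
move=> cX F FF cF.
have /choice[u Fu] n : exists x, F (ball x (n.+1%:R^-1 : R)).
  by move/cauchyP : cF; apply; rewrite invr_gt0.
have d m n : `|u m - u n| <= m.+1%:R^-1 + n.+1%:R^-1.
  have [y []] := filter_ex (filterI (Fu m) (Fu n)).
  rewrite -ball_normE /ball_/= => h1 h2.
  apply: (le_trans (ler_distD y _ _)); rewrite [`|y - _|]distrC.
  by apply: lerD; exact: ltW.
have small (e : R) : 0 < e -> exists N, forall n, (N <= n)%N -> n.+1%:R^-1 <= e.
  move=> e0; exists (Num.truncn e^-1) => n Nn.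
  rewrite invf_ple ?posrE//; apply: ltW; apply: (lt_le_trans (truncnS_gt _)).
  by rewrite ler_nat.
have [v uv] : exists v : X, u @ \oo --> v.
  apply: cX => e e0; have [N hN] := small _ (divr_gt0 e0 (ltr0n _ 2)).
  exists N => m n Nm Nn; apply: (le_trans (d m n)).
  by rewrite [leRHS]splitr lerD// hN.
apply/cvg_ex; exists v; apply/cvgrPdist_lt => e e0.
have e20 : 0 < e / 2 by rewrite divr_gt0.
have [N hN] := small _ e20.
have [n [Nn un]] : exists n, (N <= n)%N /\ `|v - u n| < e / 2.
  move/cvgrPdist_lt : uv => /(_ _ e20) [M _ hM]; exists (maxn M N).
  by rewrite leq_maxr; split=> //; apply: hM; exact: leq_maxl.
apply: filterS (Fu n) => y; rewrite -ball_normE /ball_/= => uy.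
apply: (le_lt_trans (ler_distD (u n) _ _)); rewrite [ltRHS]splitr ltrD//.
by apply: (lt_le_trans uy); exact: hN.
Qed.

Lemma uniform_boundedness (R : realType) (X : normedModType R)
    (F : set (X -> X)) : seq_complete X ->
  (forall f, F f -> continuous f /\ linear f) ->
  (forall x, exists M, forall f, F f -> `|f x| <= M) ->
  exists2 M, 0 <= M & forall f x, F f -> `|f x| <= M * `|x|.
Proof.
move=> cX Fl Fb.
pose Y : completeNormedModType R := HB.pack_for (completeNormedModType R) X
  (Uniform_isComplete.Build X (seq_complete_cauchy_cvg cX)).
pose pack (f : Y -> Y) (lf : linear f) : {linear Y -> Y} :=
  HB.pack f (GRing.isLinear.Build _ _ _ _ _ lf).
have Fbl (f : Y -> Y) : F f -> bounded_fun_norm f /\ linear f.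
  move=> /Fl[cf lf]; split=> // r.
  have /linear_boundedP/pinfty_ex_gt0[M M0 hM] : bounded_near (pack f lf) (nbhs 0).
    by apply: continuous_linear_bounded; exact: cf.
  exists (M * r) => x xr; apply: (le_trans (hM x)).
  by rewrite ler_pM2l.
have /(_ 1)[M hM] := Banach_Steinhauss Fbl Fb.
have lf0 (f : X -> X) : F f -> f 0 = 0.
  by move=> /Fl[_ lf]; exact: (linear0 (pack f lf)).
exists (Num.max 0 M); first by rewrite le_max lexx.
move=> f x Ff; have [->|x0] := eqVneq x 0.
  by rewrite lf0// !normr0 mulr0.
have nx : 0 < `|x| by rewrite normr_gt0.
have := hM f Ff (`|x|^-1 *: x).
rewrite normrZ gtr0_norm ?invr_gt0// mulVf ?gt_eqF// => /(_ (lexx _)).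
have [_ lf] := Fl f Ff.
have -> : f (`|x|^-1 *: x) = `|x|^-1 *: f x by exact: (linearZ_LR (pack f lf)).
rewrite normrZ gtr0_norm ?invr_gt0// ler_pdivrMl// mulrC => /le_trans; apply.
by rewrite ler_wpM2r// le_max lexx orbT.
Qed.

(** * Primitives of functions with values in a normed space *)

Section primitive.
Context (R : realType) (X : normedModType R).
Implicit Types F G f g : R -> X.

(** Uniform strict differentiability: [F' = f] with an error estimate that is
uniform in the interval and in the evaluation point.  One notion thus yields the
derivative, both one-sided derivatives, and the convergence of Riemann sums. *)
Definition primitive_of F f : Prop := forall e : R, 0 < e ->
  exists2 d : R, 0 < d & forall a b xi, 0 <= a -> a <= xi <= b -> b - a < d ->
    `|F b - F a - (b - a) *: f xi| <= e * (b - a).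

Lemma primitiveB F G f g : primitive_of F f -> primitive_of G g ->
  primitive_of (fun t => F t - G t) (fun t => f t - g t).
Proof.
move=> Ff Gg e e0; have e20 : 0 < e / 2 by rewrite divr_gt0.
have [d1 d10 h1] := Ff _ e20; have [d2 d20 h2] := Gg _ e20.
exists (Num.min d1 d2); first by rewrite lt_min d10.
move=> a b xi a0 ab; rewrite lt_min => /andP[bd1 bd2].
rewrite scalerBr [F b - G b - _]subrACA (subrACA (F b - F a)); apply: (le_trans (ler_normB _ _)).
by rewrite [e]splitr mulrDl; apply: lerD; [exact: h1|exact: h2].
Qed.

Lemma primitive_left F f (t : R) : primitive_of F f -> 0 < t ->
  h^-1 *: (F t - F (t - h)) @[h --> 0^'+] --> f t.
Proof.
move=> Ff t0; apply/cvgrPdist_le => e e0; have [d d0 hd] := Ff e e0.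
near=> h; have h0 : 0 < h by near: h; exact: nbhs_right_gt.
have ht : h <= t by near: h; exact: nbhs_right_le.
have hltd : h < d by near: h; exact: nbhs_right_lt.
have E : t - (t - h) = h by rewrite subKr.
rewrite -(ler_pM2l h0) -{1}(gtr0_norm h0) -normrZ scalerBr scalerA mulfV ?gt_eqF//.
rewrite scale1r distrC mulrC; have := hd (t - h) t t; rewrite E; apply=> //.
  by rewrite subr_ge0.
by rewrite lexx andbT lerBlDr lerDl ltW.
Unshelve. all: by end_near. Qed.

Lemma primitive_right F f (t : R) : primitive_of F f -> 0 <= t ->
  h^-1 *: (F (t + h) - F t) @[h --> 0^'+] --> f t.
Proof.
move=> Ff t0; apply/cvgrPdist_le => e e0; have [d d0 hd] := Ff e e0.
near=> h; have h0 : 0 < h by near: h; exact: nbhs_right_gt.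
have hltd : h < d by near: h; exact: nbhs_right_lt.
have E : t + h - t = h by rewrite addrAC subrr add0r.
rewrite -(ler_pM2l h0) -{1}(gtr0_norm h0) -normrZ scalerBr scalerA mulfV ?gt_eqF//.
rewrite scale1r distrC mulrC; have := hd t (t + h) t; rewrite E; apply=> //.
by rewrite lexx lerDl ltW.
Unshelve. all: by end_near. Qed.

Lemma primitive_right_cvg F f (t : R) : primitive_of F f -> 0 <= t ->
  F (t + h) @[h --> 0^'+] --> F t.
Proof.
move=> Ff t0; have q := primitive_right Ff t0.
have : F t + h *: (h^-1 *: (F (t + h) - F t)) @[h --> 0^'+] --> F t + 0 *: f t.
  apply: cvgD; first exact: cvg_cst.
  by apply: cvgZ => //; apply: cvg_at_right_filter; exact: cvg_id.
rewrite scale0r addr0; apply: cvg_trans; apply: near_eq_cvg; near=> h.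
have h0 : 0 < h by near: h; exact: nbhs_right_gt.
by rewrite scalerA mulfV ?gt_eqF// scale1r subrKC.
Unshelve. all: by end_near. Qed.

Lemma primitive_is_derive F f (t : R) : primitive_of F f -> 0 < t ->
  is_derive t 1 F (f t).
Proof.
move=> Ff t0.
have H : h^-1 *: (F (h *: (1 : R^o) + t) - F t) @[h --> 0^'] --> f t.
  apply/cvgrPdist_le => e e0; have [d d0 hd] := Ff e e0.
  near=> h; have h0 : h != 0 by near: h; exact: nbhs_dnbhs_neq.
  have hltd : `|h| < d by near: h; exact: dnbhs0_lt.
  have ht : `|h| <= t by near: h; exact: dnbhs0_le.
  have nh0 : 0 < `|h| by rewrite normr_gt0.
  rewrite -(ler_pM2l nh0) -normrZ scalerBr scalerA mulfV// scale1r mulrC.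
  rewrite (_ : h *: 1 + t = t + h); last by rewrite addrC; congr (_ + _); exact: mulr1.
  case: (ltP 0 h) => h0'.
    have := hd t (t + h) t (ltW t0); rewrite addrAC subrr add0r distrC.
    rewrite gtr0_norm// in hltd *; apply=> //.
    by rewrite lexx lerDl ltW.
  rewrite ler0_norm// in hltd ht *.
  have E : t - (t + h) = - h by rewrite opprD addrA subrr sub0r.
  have := hd (t + h) t t; rewrite E scaleNr opprK => H.
  rewrite opprB addrC; apply: H => //.
    by rewrite -lerBlDr sub0r.
  by rewrite lexx andbT gerDl.
split; first by apply/cvg_ex; exists (f t).
by apply: cvg_lim => //; exact: norm_hausdorff.
Unshelve. all: by end_near. Qed.

(** The mean value inequality, through the left Dini derivative of
[|F t - F 0| - C t]. *)
Lemma primitive_le F f (C t : R) : primitive_of F f ->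
  (forall s, 0 <= s -> `|f s| <= C) -> 0 <= t -> `|F t - F 0| <= C * t.
Proof.
move=> Ff fC t0; rewrite -subr_le0.
have := @left_Dini_nonincreasing _ (fun t => `|F t - F 0| - C * t) t t0.
rewrite /= subrr normr0 mulr0 subrr; apply.
- move=> s /andP[s0 _]; apply: cvgB.
    by apply: cvg_norm; apply: cvgB; [exact: primitive_right_cvg Ff s0|exact: cvg_cst].
  apply: cvgM; first exact: cvg_cst.
  rewrite -[X in _ --> X]addr0; apply: cvgD; first exact: cvg_cst.
  by apply: cvg_at_right_filter; exact: cvg_id.
- move=> s e /andP[s0 _] e0.
  move/cvgrPdist_le : (primitive_left Ff s0) => /(_ _ e0) H; near=> h.
  have h0 : 0 < h by near: h; exact: nbhs_right_gt.
  have : `|f s - h^-1 *: (F s - F (s - h))| <= e by near: h; exact: H.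
  rewrite -(ler_pM2l h0) -{1}(gtr0_norm h0) -normrZ scalerBr scalerA mulfV ?gt_eqF//.
  rewrite scale1r => h1.
  have h2 := ler_distD (h *: f s) (F s - F (s - h)) 0.
  rewrite !subr0 [`|F s - _ - _|]distrC normrZ gtr0_norm// in h2.
  have h3 := ler_distD (F (s - h)) (F s) (F 0).
  have h4 : h * `|f s| <= h * C by rewrite ler_pM2l// fC// ltW.
  lra.
Unshelve. all: by end_near. Qed.

Lemma primitive_unique F G f t : primitive_of F f -> primitive_of G f ->
  0 <= t -> F t - F 0 = G t - G 0.
Proof.
move=> Ff Gf t0; apply/eqP; rewrite -subr_eq0 -normr_le0 subrACA.
apply: (le_trans (primitive_le (C := 0) (primitiveB Ff Gf) _ t0)) => [s _|].
  by rewrite subrr normr0.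
by rewrite mul0r.
Qed.

Lemma partition_ge0 (a b : R) n x xi : tagged_partition a b n x xi -> 0 <= a ->
  forall i, (i <= n)%N -> 0 <= x i.
Proof.
move=> [x0 _ xS] a0; elim=> [_|i IH]; first by rewrite x0.
move=> iln; have /andP[h1 h2] := xS i iln.
by rewrite (le_trans (IH (ltnW iln)))// (le_trans h1).
Qed.

(** The increments of [F] over a partition telescope, and each differs from the
corresponding term of the sum by a small multiple of the length. *)
Lemma primitive_Riemann F f t : primitive_of F f -> 0 <= t ->
  is_Riemann_integral f 0 t (F t - F 0).
Proof.
move=> Ff t0 e e0; have t1 : 0 < t + 1 by rewrite ltr_wpDl.
have [d d0 hd] := Ff _ (divr_gt0 e0 t1); exists d => // n x xi px mesh.
have xge0 := partition_ge0 px (lexx 0); case: px => x0 xn xS.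
have -> : F t - F 0 = \sum_(i < n) (F (x i.+1) - F (x i)).
  by rewrite -x0 -xn -(telescope_sumr (F \o x))// big_mkord.
rewrite /Riemann_sum -sumrB; apply: (le_lt_trans (ler_norm_sum _ _ _)).
apply: (@le_lt_trans _ _ (\sum_(i < n) e / (t + 1) * (x i.+1 - x i))).
  apply: ler_sum => i _; rewrite distrC; apply: hd; [|exact: xS|exact: mesh].
  by apply: xge0; exact: ltnW.
rewrite -mulr_sumr -(big_mkord xpredT (fun i => x i.+1 - x i)).
rewrite telescope_sumr// x0 xn subr0 -mulrA gtr_pMr// mulrC ltr_pdivrMr// mul1r.
by rewrite ltrDl.
Qed.

End primitive.

Section Lipschitz_primitive.
Context (R : realType) (X : normedModType R) (f : R -> X) (L : R).
Hypothesis cX : seq_complete X.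
Hypothesis fL : forall s t, 0 <= s -> 0 <= t -> `|f s - f t| <= L * `|s - t|.

Local Notation mesh := (@dyadic_mesh R).
Local Notation steps := dyadic_steps.
Let mesh_gt0 m : 0 < mesh m. Proof. exact: dyadic_mesh_gt0. Qed.

Let L0 : 0 <= L.
Proof.
by have := fL ler01 (lexx 0); rewrite subr0 normr1 mulr1; exact: le_trans.
Qed.

Let dyadic_sum m (t : R) : X :=
  \sum_(0 <= j < steps m t) mesh m *: f (j%:R * mesh m).

(** Each interval of length [h] contributes an error [L h^2], since [f] varies
by at most [L h] there. *)
Let dyadic_sum_halving (h : R) n : 0 < h ->
  `|\sum_(0 <= j < n) h *: f (j%:R * h)
     - \sum_(0 <= j < n.*2) (h / 2) *: f (j%:R * (h / 2))|
    <= n%:R * h * (L * h).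
Proof.
move=> h0; elim: n => [|n IH]; first by rewrite !big_nil subrr normr0 !mul0r.
have key : `|h *: f (n%:R * h) - ((h / 2) *: f (n.*2%:R * (h / 2))
    + (h / 2) *: f (n.*2.+1%:R * (h / 2)))| <= h * (L * h).
  have E1 : n.*2%:R * (h / 2) = n%:R * h by rewrite -muln2 natrM; field.
  have E2 : n.*2.+1%:R * (h / 2) = n%:R * h + h / 2.
    by rewrite -[n.*2.+1%:R]natr1 mulrDl E1 mul1r.
  have nh : 0 <= n%:R * h by rewrite mulr_ge0// ltW.
  have h20 : 0 <= h / 2 by rewrite divr_ge0// ltW.
  have -> : h *: f (n%:R * h) = (h / 2) *: f (n%:R * h) + (h / 2) *: f (n%:R * h).
    by rewrite -scalerDl -splitr.
  rewrite E1 E2 opprD addrACA subrr add0r -scalerBr normrZ ger0_norm//.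
  apply: (@le_trans _ _ (h / 2 * (L * (h / 2)))).
    rewrite ler_wpM2l//; apply: (le_trans (fL nh (addr_ge0 nh h20))).
    by rewrite opprD addrA subrr sub0r normrN ger0_norm.
  rewrite -subr_ge0 (_ : _ - _ = 3 / 4 * (h * (L * h))); last by field.
  by rewrite !mulr_ge0// ?divr_ge0// ltW.
rewrite doubleS !big_nat_recr//= -[X in _ - X]addrA opprD addrACA.
apply: (le_trans (ler_normD _ _)).
by rewrite -[n.+1%:R]natr1 !mulrDl mul1r lerD.
Qed.

Let f_le s t : 0 <= s <= t -> `|f s| <= `|f 0| + L * t.
Proof.
move=> /andP[s0 st]; have := fL s0 (lexx 0).
rewrite subr0 ger0_norm// => h.
have h2 := ler_distD (f 0) (f s) 0; rewrite !subr0 in h2.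
have h3 : L * s <= L * t by rewrite ler_wpM2l.
lra.
Qed.

Let dyadic_sum_step m t : 0 <= t ->
  `|dyadic_sum m t - dyadic_sum m.+1 t|
     <= (t * L + (`|f 0| + L * t)) * mesh m.
Proof.
move=> t0; have [b b1 E] := dyadic_stepsS m t0.
have h0 := mesh_gt0 m; rewrite /dyadic_sum E.
rewrite [X in _ - X](@big_cat_nat _ _ _ (steps m t).*2) ?leq_addr//=.
rewrite opprD addrA dyadic_meshS mulrDl.
apply: (le_trans (ler_normB _ _)); apply: lerD.
  apply: (le_trans (dyadic_sum_halving _ h0)); rewrite mulrA ler_pM2r//.
  by rewrite ler_wpM2r// dyadic_steps_le.
case: b b1 E => [|[|//]] _ E.
  by rewrite addn0 big_geq// normr0 mulr_ge0 ?addr_ge0 ?mulr_ge0// ltW.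
rewrite addn1 big_nat1 normrZ gtr0_norm ?divr_gt0// mulrC.
apply: ler_pM => //; first by rewrite divr_ge0// ltW.
  apply: f_le; rewrite mulr_ge0//= ?divr_ge0 ?(ltW h0)//.
  have := dyadic_steps_le m.+1 t0; rewrite E dyadic_meshS addn1; apply: le_trans.
  by rewrite ler_pM2r ?divr_gt0// ler_nat.
by rewrite ler_pdivrMr// ler_peMr ?(ltW h0)// ler1n.
Qed.

(** The sum over the dyadic points between [a] and [b], compared term by term
with the constant [f xi]; it passes to the limit as the estimate that defines a
primitive. *)
Let dyadic_sum_increment m a b xi : 0 <= a -> a <= xi <= b ->
  `|dyadic_sum m b - dyadic_sum m a
     - ((steps m b)%:R * mesh m - (steps m a)%:R * mesh m) *: f xi|
    <= ((steps m b)%:R * mesh m - (steps m a)%:R * mesh m)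
       * (L * (b - a + mesh m)).
Proof.
move=> a0 /andP[axi xib]; have h0 := mesh_gt0 m.
have b0 : 0 <= b by rewrite (le_trans a0)// (le_trans axi).
have ab : (steps m a <= steps m b)%N.
  by apply: le_truncn; rewrite ler_pM2r ?exprn_gt0// (le_trans axi).
have -> : dyadic_sum m b - dyadic_sum m a =
    \sum_(steps m a <= j < steps m b) mesh m *: f (j%:R * mesh m).
  by rewrite /dyadic_sum (@big_cat_nat _ _ _ (steps m a) 0%N (steps m b))//= addrAC subrr add0r.
rewrite -mulrBl -natrB//.
have -> : ((steps m b - steps m a)%:R * mesh m) *: f xi =
    \sum_(steps m a <= j < steps m b) mesh m *: f xi.
  by rewrite sumr_const_nat mulr_natl scalerMnl.
rewrite -sumrB; apply: (le_trans (ler_norm_sum _ _ _)).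
apply: (@le_trans _ _ (\sum_(steps m a <= j < steps m b)
    mesh m * (L * (b - a + mesh m)))); last first.
  by rewrite sumr_const_nat mulr_natl mulrnAl.
rewrite !big_nat; apply: ler_sum => j /andP[aj jb].
rewrite -scalerBr normrZ gtr0_norm// ler_pM2l//.
have j0 : 0 <= j%:R * mesh m by rewrite mulr_ge0// ltW.
apply: (le_trans (fL j0 (le_trans a0 axi))); rewrite ler_wpM2l//.
have h1 : j%:R * mesh m + mesh m <= b.
  apply: le_trans (dyadic_steps_le m b0).
  by rewrite -[X in _ + X]mul1r -mulrDl natr1 ler_pM2r// ler_nat.
have h2 : a <= j%:R * mesh m + mesh m.
  apply: (le_trans (ltW (dyadic_steps_gt m a))).
  by rewrite -[X in _ + X]mul1r -mulrDl natr1 ler_pM2r// ler_nat.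
by rewrite ler_norml; apply/andP; split; lra.
Qed.

(** Dyadic Riemann sums converge in a complete space, and the limit inherits the
uniform estimate of [dyadic_sum_increment]. *)
Lemma Lipschitz_primitive : exists F, primitive_of F f.
Proof.
have cv t : 0 <= t -> exists v : X, dyadic_sum m t @[m --> \oo] --> v.
  move=> t0; apply: cX => e e0.
  have [N hN] := dyadic_cauchy (fun m => dyadic_sum_step m t0)
    (divr_gt0 e0 (ltr0n _ 2)).
  exists N => m n Nm Nn; have h1 := hN (m - N)%N; have h2 := hN (n - N)%N.
  rewrite !subnKC// in h1 h2; apply: (le_trans (ler_distD (dyadic_sum N t) _ _)).
  by rewrite distrC [leRHS]splitr lerD.
have /choice[F hF] (t : R) : exists v : X, 0 <= t ->
    dyadic_sum m t @[m --> \oo] --> v.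
  have [/cv[v hv]|] := leP 0 t; first by exists v.
  by exists 0.
exists F => e e0; have L1 : 0 < L + 1 by rewrite ltr_wpDl.
exists (e / (L + 1)); first exact: divr_gt0.
move=> a b xi a0 axb bad.
have ab : a <= b by case/andP : axb => /le_trans; apply.
have b0 := le_trans a0 ab.
apply: (@le_trans _ _ ((b - a) * (L * (b - a + 0)))); last first.
  rewrite addr0 mulrC ler_wpM2r ?subr_ge0//; move: bad; rewrite ltr_pdivlMr//.
  have : 0 <= b - a by rewrite subr_ge0.
  nra.
apply: (cvg_norm_le (u := fun m => dyadic_sum m b - dyadic_sum m a
     - ((steps m b)%:R * mesh m - (steps m a)%:R * mesh m) *: f xi)
    (b := fun m => ((steps m b)%:R * mesh m - (steps m a)%:R * mesh m)
       * (L * (b - a + mesh m)))).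
- apply: cvgB; first by apply: cvgB; exact: hF.
  by apply: cvgZr_tmp; apply: cvgB; exact: dyadic_steps_cvg.
- apply: cvgM; first by apply: cvgB; exact: dyadic_steps_cvg.
  apply: cvgM; first exact: cvg_cst.
  by apply: cvgD; [exact: cvg_cst|exact: cvg_dyadic_mesh].
- by move=> m; exact: dyadic_sum_increment.
Qed.

End Lipschitz_primitive.

(** * Functions on the half-line *)

Section halfline.
Context (R : realType) (X : normedModType R).
Implicit Types U V I : R -> X.

Lemma within_halflineP U : {within `[0, +oo[, continuous U} <->
  forall t, 0 <= t -> forall e : R, 0 < e -> exists2 d : R, 0 < d &
    forall s, 0 <= s -> `|t - s| < d -> `|U t - U s| <= e.
Proof.
split=> [/subspace_continuousP cU t t0 e e0|cU].
  have /cU/cvgrPdist_le/(_ _ e0)[d /= d0 hd] : (`[0, +oo[%classic : set R) t.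
    by rewrite /= in_itv/= t0.
  by exists d => // s s0 ts; apply: hd => //; rewrite /= in_itv/= s0.
apply/subspace_continuousP => t; rewrite /= in_itv/= andbT => t0.
apply/cvgrPdist_le => e e0; have [d d0 hd] := cU t t0 e e0.
by exists d => //= s ts; rewrite in_itv/= andbT => s0; exact: hd.
Qed.

Lemma within_halfline_right U t : {within `[0, +oo[, continuous U} -> 0 <= t ->
  U (t + h) @[h --> 0^'+] --> U t.
Proof.
move=> /within_halflineP cU t0; apply/cvgrPdist_le => e e0.
have [d d0 hd] := cU t t0 e e0; near=> h.
have h0 : 0 < h by near: h; exact: nbhs_right_gt.
apply: hd; first by rewrite addr_ge0// ltW.
rewrite opprD addrA subrr sub0r normrN (gtr0_norm h0).
by near: h; exact: nbhs_right_lt.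
Unshelve. all: by end_near. Qed.

Lemma within_halfline_at U t : {within `[0, +oo[, continuous U} -> 0 < t ->
  {for t, continuous U}.
Proof.
move=> /within_halflineP cU t0; apply/cvgrPdist_le => e e0.
have [d d0 hd] := cU t (ltW t0) e e0.
exists (Num.min d t) => /=; first by rewrite lt_min d0.
move=> s /=; rewrite lt_min => /andP[sd st]; apply: hd => //.
by move: st; rewrite ltr_norml => /andP[_]; rewrite ltrBlDr ltrDl => /ltW.
Qed.

(** The difference of the integrals up to [b] and up to [a], estimated like a
single integral from [a] to [b].  Both are computed on one sequence of points
that is a partition of [0, a] in its first half and of [a, b] in its second. *)
Lemma Riemann_integral_increment V I (a b e : R) (v : X) :
  (forall t, 0 <= t -> is_Riemann_integral V 0 t (I t)) -> 0 <= a -> a <= b ->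
  (forall xi, a <= xi <= b -> `|V xi - v| <= e) ->
  `|I b - I a - (b - a) *: v| <= e * (b - a).
Proof.
move=> VI a0 ab Vv; have b0 := le_trans a0 ab.
apply/ler_addgt0Pr => eta eta0; have eta20 : 0 < eta / 2 by rewrite divr_gt0.
have [d1 d10 h1] := VI a a0 _ eta20; have [d2 d20 h2] := VI b b0 _ eta20.
pose d := Num.min d1 d2; have d0 : 0 < d by rewrite lt_min d10.
pose N := (Num.truncn (b / d)).+1.
have N0 : 0 < N%:R :> R by rewrite ltr0n.
have mesh : b / N%:R < d.
  by rewrite ltr_pdivrMr// mulrC -ltr_pdivrMr// truncnS_gt.
have aN : a / N%:R < d by apply: le_lt_trans mesh; rewrite ler_pM2r ?invr_gt0.
have baN : (b - a) / N%:R < d.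
  by apply: le_lt_trans mesh; rewrite ler_pM2r ?invr_gt0// lerBlDr lerDl.
(* After [N] equal steps from 0 to [a], equal steps from [a] on: the first [N]
   form a partition of [0, a], and the first [N + N] one of [0, b]. *)
pose x i : R := (minn i N)%:R * (a / N%:R) + (i - N)%:R * ((b - a) / N%:R).
have xS i : x i.+1 - x i = if (i < N)%N then a / N%:R else (b - a) / N%:R.
  rewrite /x; case: ltnP => iN.
    rewrite (minn_idPl iN).
    have /eqP -> : (i.+1 - N == 0)%N by rewrite subn_eq0.
    have /eqP -> : (i - N == 0)%N by rewrite subn_eq0 ltnW.
    by rewrite !mul0r !addr0 -mulrBl -natrB// subSnn mul1r.
  rewrite (minn_idPr (leqW iN)) subSn//.
  by rewrite -[(i - N).+1%:R]natr1; ring.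
have xle i : x i <= x i.+1.
  by rewrite -subr_ge0 xS; case: ifP => _; rewrite divr_ge0// ?subr_ge0.
have x0 : x 0%N = 0 by rewrite /x min0n sub0n !mul0r addr0.
have xN : x N = a by rewrite /x minnn subnn mul0r addr0 mulrC divfK ?gt_eqF.
have xNN : x (N + N)%N = b.
  rewrite /x (minn_idPr (leq_addr _ _)) addnK -mulrDr -mulrDl subrKC.
  by rewrite mulrC divfK ?gt_eqF.
have tag n y : (n = N /\ y = a) \/ (n = (N + N)%N /\ y = b) ->
    tagged_partition 0 y n x x.
  move=> ny; split=> //; last by move=> i _; rewrite lexx xle.
  by case: ny => -[-> ->].
have fine_mesh i : x i.+1 - x i < d by rewrite xS; case: ifP.
have S1 : `|Riemann_sum V N x x - I a| < eta / 2.
  apply: h1; first by apply: tag; left.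
  by move=> i _; apply: (lt_le_trans (fine_mesh i)); rewrite ge_min lexx.
have S2 : `|Riemann_sum V (N + N) x x - I b| < eta / 2.
  apply: h2; first by apply: tag; right.
  by move=> i _; apply: (lt_le_trans (fine_mesh i)); rewrite ge_min lexx orbT.
have key : `|Riemann_sum V (N + N) x x - Riemann_sum V N x x - (b - a) *: v|
    <= e * (b - a).
  have xab i : (N <= i <= N + N)%N -> a <= x i <= b.
    have mono j p : x j <= x (j + p)%N.
      elim: p => [|p IH]; first by rewrite addn0.
      by rewrite addnS (le_trans IH).
    move=> /andP[Ni iN]; rewrite -{1}xN -xNN -{1}(subnKC Ni) mono/=.
    by rewrite -(subnKC iN) mono.
  have ba_sum (w : X) : (b - a) *: w = \sum_(i < N) ((b - a) / N%:R) *: w.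
    by rewrite sumr_const card_ord scalerMnl -mulr_natr divfK ?gt_eqF.
  rewrite /Riemann_sum big_split_ord/= [X in X - _ *: _]addrC addKr ba_sum -sumrB.
  apply: (le_trans (ler_norm_sum _ _ _)).
  apply: (@le_trans _ _ (\sum_(i < N) (b - a) / N%:R * e)).
    apply: ler_sum => i _; have xSi := xS (N + i)%N.
    rewrite ltnNge leq_addr/= in xSi.
    have c0 : 0 <= (b - a) / N%:R by rewrite divr_ge0// subr_ge0.
    rewrite xSi -scalerBr normrZ ger0_norm// ler_wpM2l// Vv// xab//.
    by rewrite leq_addr leq_add2l ltnW.
  rewrite sumr_const card_ord -[leLHS]mulr_natr mulrAC divfK ?gt_eqF//.
  by rewrite mulrC.
have h3 := ler_distD (Riemann_sum V (N + N) x x - Riemann_sum V N x x)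
  (I b - I a) ((b - a) *: v).
have h4 := ler_normB (I b - Riemann_sum V (N + N) x x)
  (I a - Riemann_sum V N x x).
rewrite subrACA [`|I b - _|]distrC [`|I a - _|]distrC in h4.
lra.
Qed.

End halfline.

Lemma is_derive_left_quotient (R : realType) (X : normedModType R) (V : R -> X)
    (t : R) (v : X) : is_derive t 1 V v ->
  h^-1 *: (V t - V (t - h)) @[h --> 0^'+] --> v.
Proof.
move=> [dV <-]; apply/cvgrPdist_le => e e0.
have /cvgrPdist_le/(_ _ e0)[d /= d0 hd] := dV.
near=> h; have h0 : 0 < h by near: h; exact: nbhs_right_gt.
have hltd : h < d by near: h; exact: nbhs_right_lt.
have := hd (- h); rewrite /ball_/= sub0r opprK gtr0_norm// => /(_ hltd).
rewrite oppr_eq0 gt_eqF// => /(_ isT).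
rewrite invrN scaleNr -scalerN opprB.
rewrite (_ : - h *: 1 + t = t - h)//.
by rewrite addrC; congr (_ + _); exact: mulr1.
Unshelve. all: by end_near. Qed.

(** * Semigroups generated by an m-dissipative operator *)

Section generated_semigroup_properties.
Context (R : realType) (X : normedModType R) (D : set X) (A : X -> X).
Context (S : R -> X -> X).
Hypotheses (cX : seq_complete X) (mA : m_dissipative D A).
Hypothesis gS : C0_semigroup_generated_by S D A.

Let S0 x : S 0 x = x. Proof. exact: (semigroup0 gS.1). Qed.

Let SD s t x : 0 <= s -> 0 <= t -> S (s + t) x = S s (S t x).
Proof. exact: (semigroupD gS.1). Qed.

Let S_linear t (a : R) x y : 0 <= t -> S t (a *: x + y) = a *: S t x + S t y.
Proof. by move=> t0; exact: semigroup_linear gS.1 t t0 a x y. Qed.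

Let SB t x y : 0 <= t -> S t (x - y) = S t x - S t y.
Proof.
move=> t0; have := S_linear (-1) y x t0.
by rewrite !scaleN1r ![- _ + _]addrC.
Qed.

Let SZ t (a : R) x : 0 <= t -> S t (a *: x) = a *: S t x.
Proof.
move=> t0; have := SB 0 0 t0; rewrite !subrr => S00.
by rewrite -[a *: x]addr0 S_linear// S00 addr0.
Qed.

Let S_split t h x : 0 <= h -> h <= t -> S t x = S (t - h) (S h x).
Proof. by move=> h0 ht; rewrite -SD ?subr_ge0// subrK. Qed.

Let S_splitl a b x : 0 <= a -> a <= b -> S b x = S a (S (b - a) x).
Proof. by move=> a0 ab; rewrite -SD ?subr_ge0// subrKC. Qed.

(** Otherwise there are times [t_n -> 0] at which the norm of [S t_n] exceeds
[n], while for each [x] the values [S t_n x] are bounded because they converge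
to [x]: this contradicts the uniform boundedness principle. *)
Lemma semigroup_bounded_near0 : exists M (d : R), [/\ 1 <= M, 0 < d &
  forall t x, 0 <= t <= d -> `|S t x| <= M * `|x|].
Proof.
apply: contrapT => nb.
have /choice[tx txP] (n : nat) : exists tx : R * X,
    0 <= tx.1 <= n.+1%:R^-1 /\ n.+1%:R * `|tx.2| < `|S tx.1 tx.2|.
  apply: contrapT => h; apply: nb; exists n.+1%:R, n.+1%:R^-1.
  split; [by rewrite ler1n|by rewrite invr_gt0|move=> t x tn].
  by rewrite leNgt; apply/negP => xt; apply: h; exists (t, x).
pose F := [set S (tx n).1 | n in [set: nat]].
have FP f : F f -> continuous f /\ linear f.
  move=> [n _ <-]; have [/andP[t0 _] _] := txP n.
  by split; [exact: (semigroup_bounded gS.1 t0)|exact: (semigroup_linear gS.1 t0)].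
have [|M M0 FM] := uniform_boundedness cX FP.
  move=> x; have /cvgrPdist_lt/(_ 1 ltr01)[r /= r0 hr] := @semigroup_cvg0 _ _ _ gS.1 x.
  have bd t : 0 <= t < r -> `|S t x| <= `|x| + 1.
    move=> /andP[]; rewrite le_eqVlt => /predU1P[<-|t0] tr.
      by rewrite S0 lerDl.
    have := hr t; rewrite /ball_/= sub0r normrN gtr0_norm// => /(_ tr t0) h.
    have := ler_distD x (S t x) 0; rewrite !subr0 [`|S t x - x|]distrC; lra.
  pose N := Num.truncn r^-1.
  exists (`|x| + 1 + \sum_(i < N) `|S (tx i).1 x|) => _ [n _ <-].
  have [nN|Nn] := ltnP n N.
    by rewrite (bigD1 (Ordinal nN))//= addrCA lerDl !addr_ge0// sumr_ge0.
  apply: (@le_trans _ _ (`|x| + 1)); last by rewrite lerDl sumr_ge0.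
  apply: bd; have [/andP[-> /le_lt_trans tn] _] := txP n; apply: tn.
  rewrite invf_plt ?posrE//; apply: (lt_le_trans (truncnS_gt _)).
  by rewrite ler_nat.
have [_ h1] := txP (Num.truncn M).
have h2 : `|S (tx (Num.truncn M)).1 (tx (Num.truncn M)).2| <= _ :=
  FM _ (tx (Num.truncn M)).2 (ex_intro2 _ _ _ I erefl).
have := lt_le_trans h1 h2; rewrite ltNge => /negP; apply.
by rewrite ler_wpM2r// ltW// truncnS_gt.
Qed.

Lemma semigroup_locally_bounded (T : R) : exists2 M, 0 <= M &
  forall t x, 0 <= t <= T -> `|S t x| <= M * `|x|.
Proof.
have [M [d [M1 d0 hM]]] := semigroup_bounded_near0.
have M0 : 0 <= M by rewrite (le_trans _ M1).
suff H n t x : 0 <= t <= n%:R * d -> `|S t x| <= M ^+ n * `|x|.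
  exists (M ^+ (Num.truncn (T / d)).+1); first exact: exprn_ge0.
  move=> t x /andP[t0 tT]; apply: H; rewrite t0 (le_trans tT)//.
  by rewrite -ler_pdivrMr// ltW// truncnS_gt.
elim: n t x => [|n IH] t x /andP[t0].
  by rewrite mul0r => tle; rewrite (@le_anti _ _ t 0) ?t0 ?tle// S0 expr0 mul1r.
rewrite -natr1 mulrDl mul1r => tn; have [td|dt] := leP t d.
  apply: (le_trans (hM _ _ _)); rewrite ?t0 ?td//.
  by rewrite ler_wpM2r// ler_eXnr.
rewrite (S_split x (ltW d0) (ltW dt)) exprSr -mulrA.
apply: (le_trans (IH _ _ _)); first by rewrite subr_ge0 (ltW dt) lerBlDr.
by rewrite ler_wpM2l ?exprn_ge0// hM// lexx (ltW d0).
Qed.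

Lemma semigroup_right_cvg x t : 0 <= t -> S (t + h) x @[h --> 0^'+] --> S t x.
Proof.
move=> t0; have := @semigroup_cvg0 _ _ _ gS.1 (S t x).
apply: cvg_trans; apply: near_eq_cvg; near=> h.
have h0 : 0 < h by near: h; exact: nbhs_right_gt.
by rewrite addrC SD// ltW.
Unshelve. all: by end_near. Qed.

(** [S t] commutes with the difference quotients at 0. *)
Lemma semigroup_domain x t : 0 <= t -> D x ->
  D (S t x) /\ A (S t x) = S t (A x).
Proof.
move=> t0 Dx; apply/gS.2.
have /gS.2 Bx : D x /\ A x = A x by [].
have cS : {for A x, continuous (S t)} by exact: (semigroup_bounded gS.1 t0).
have SBx : S t (h^-1 *: (S h x - x)) @[h --> 0^'+] --> S t (A x).
  exact: continuous_cvg cS Bx.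
apply: cvg_trans SBx; apply: near_eq_cvg; near=> h.
have h0 : 0 < h by near: h; exact: nbhs_right_gt.
by rewrite SZ// SB// -!SD ?(ltW h0)// [h + t]addrC.
Unshelve. all: by end_near. Qed.

(** Strong continuity is a statement about right limits.  From the left, factor
[S (t - h)] out of the difference, and bound it uniformly in [h]. *)
Lemma semigroup_left_cvg x t : 0 < t -> S (t - h) x @[h --> 0^'+] --> S t x.
Proof.
move=> t0; have [M M0 hM] := semigroup_locally_bounded t.
have M1 : 0 < M + 1 by rewrite ltr_wpDl.
apply/cvgrPdist_le => e e0; near=> h.
have h0 : 0 < h by near: h; exact: nbhs_right_gt.
have ht : h <= t by near: h; exact: nbhs_right_le.
rewrite (S_split _ (ltW h0) ht) -SB ?subr_ge0//.
apply: (le_trans (hM _ _ _)); first by rewrite subr_ge0 ht lerBlDr lerDl ltW.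
apply: (@le_trans _ _ ((M + 1) * `|S h x - x|)).
  by rewrite ler_wpM2r// lerDl.
rewrite -ler_pdivlMl// distrC; near: h.
move/cvgrPdist_le : (@semigroup_cvg0 _ _ _ gS.1 x); apply.
by rewrite mulr_gt0// invr_gt0.
Unshelve. all: by end_near. Qed.

Lemma semigroup_left_quotient x t : 0 < t -> D x ->
  h^-1 *: (S t x - S (t - h) x) @[h --> 0^'+] --> A (S t x).
Proof.
move=> t0 Dx; rewrite (semigroup_domain (ltW t0) Dx).2.
have [M M0 hM] := semigroup_locally_bounded t.
have M1 : 0 < M + 1 by rewrite ltr_wpDl.
have /gS.2 Bx : D x /\ A x = A x by [].
apply/cvgrPdist_le => e e0; have e20 : 0 < e / 2 by rewrite divr_gt0.
near=> h.
have h0 : 0 < h by near: h; exact: nbhs_right_gt.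
have ht : h <= t by near: h; exact: nbhs_right_le.
have th : 0 <= t - h by rewrite subr_ge0.
rewrite [S t x](S_split _ (ltW h0) ht) -SB// -SZ//.
apply: (le_trans (ler_distD (S (t - h) (A x)) _ _)); rewrite [leRHS]splitr.
apply: lerD.
  by near: h; move/cvgrPdist_le : (@semigroup_left_cvg (A x) t t0); apply.
rewrite -SB//; apply: (le_trans (hM _ _ _)).
  by rewrite th lerBlDr lerDl ltW.
apply: (@le_trans _ _ ((M + 1) * `|A x - h^-1 *: (S h x - x)|)).
  by rewrite ler_wpM2r// lerDl.
rewrite -ler_pdivlMl//; near: h; move/cvgrPdist_le : Bx; apply.
by rewrite mulr_gt0// invr_gt0.
Unshelve. all: by end_near. Qed.

(** On the domain by [dissipative_nonincreasing], then everywhere by density;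
for this last step the local bound is enough. *)
Lemma semigroup_contract t x : 0 <= t -> `|S t x| <= `|x|.
Proof.
move=> t0; have contrD y : D y -> `|S t y| <= `|y|.
  move=> Dy; rewrite -{2}(S0 y).
  apply: (dissipative_nonincreasing (G := fun t => S t y)
    (mdis_dissipative mA) t0) => s /andP[s0 _].
    exact: semigroup_right_cvg.
  split; first exact: (semigroup_domain (ltW s0) Dy).1.
  exact: semigroup_left_quotient.
have [M M0 hM] := semigroup_locally_bounded t.
have M2 : 0 < M + 1 by rewrite ltr_wpDl.
apply/ler_addgt0Pr => e e0.
have [y Dy xy] := mdis_dense mA x (divr_gt0 e0 M2).
have h1 := contrD y Dy; have h2 : `|S t (x - y)| <= M * `|x - y|.
  by apply: hM; rewrite t0 lexx.
rewrite SB// in h2; rewrite ltr_pdivlMr// in xy.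
have h3 := ler_distD (S t y) (S t x) 0; have h4 := ler_distD x y 0.
rewrite !subr0 in h3 h4; rewrite [`|y - x|]distrC in h4.
nra.
Qed.

(** On [a, b] factor [S a] out: by contractivity the error is at most the one on
[0, b - a], so the estimate at 0 is uniform in time. *)
Lemma semigroup_primitive_domain x : D x ->
  primitive_of (fun t => S t x) (fun t => S t (A x)).
Proof.
move=> Dx e e0; have e20 : 0 < e / 2 by rewrite divr_gt0.
have /gS.2/cvgrPdist_le/(_ _ e20)[d1 /= d10 h1] : D x /\ A x = A x by [].
have /cvgrPdist_le/(_ _ e20)[d2 /= d20 h2] := @semigroup_cvg0 _ _ _ gS.1 (A x).
exists (Num.min d1 d2); first by rewrite lt_min d10.
move=> a b xi a0 /andP[axi xib]; rewrite lt_min => /andP[bd1 bd2].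
have ab := le_trans axi xib; have r0 : 0 <= b - a by rewrite subr_ge0.
rewrite [S b x](S_splitl _ a0 ab) -SB//.
have [|r0'] := eqVneq (b - a) 0.
  by move=> ->; rewrite S0 SB// subrr scale0r mulr0 subrr normr0.
have {}r0' : 0 < b - a by rewrite lt_neqAle eq_sym r0'.
apply: (le_trans (ler_distD ((b - a) *: S a (A x)) _ _)).
rewrite [e]splitr mulrDl; apply: lerD.
  rewrite -SZ// -SB//; apply: (le_trans (semigroup_contract _ a0)).
  have := h1 (b - a); rewrite /ball_/= sub0r normrN gtr0_norm// => /(_ bd1 r0').
  rewrite -(ler_pM2l r0') -{1}(gtr0_norm r0') -normrZ scalerBr scalerA.
  by rewrite mulfV ?gt_eqF// scale1r distrC mulrC.
rewrite -scalerBr normrZ gtr0_norm// mulrC ler_pM2r//.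
have xa0 : 0 <= xi - a by rewrite subr_ge0.
rewrite [S xi _](S_splitl _ a0 axi) -SB//.
apply: (le_trans (semigroup_contract _ a0)).
have [->|xa] := eqVneq (xi - a) 0; first by rewrite S0 subrr normr0 ltW.
have {}xa : 0 < xi - a by rewrite lt_neqAle eq_sym xa.
apply: h2 => //; rewrite /ball_/= sub0r normrN gtr0_norm//.
by apply: le_lt_trans bd2; rewrite lerD2r.
Qed.

Lemma semigroup_Lipschitz x s t : D x -> 0 <= s -> 0 <= t ->
  `|S s x - S t x| <= `|A x| * `|s - t|.
Proof.
move=> Dx; wlog ts : s t / t <= s.
  move=> H s0 t0; have [ts|/ltW st] := leP t s; first exact: H.
  by rewrite distrC [`|s - t|]distrC; exact: H.
move=> s0 t0; have st : 0 <= s - t by rewrite subr_ge0.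
rewrite ger0_norm// (S_splitl _ t0 ts) -SB//.
apply: (le_trans (semigroup_contract _ t0)).
have := primitive_le (C := `|A x|) (semigroup_primitive_domain Dx) _ st.
by rewrite S0; apply=> r r0; exact: semigroup_contract.
Qed.

(** Write [x = z - A z] with [z] in the domain.  The orbit of [z] is Lipschitz
and so has a primitive, and the orbit of [A z] is the derivative of that of
[z]. *)
Lemma semigroup_has_primitive x : exists F, primitive_of F (fun t => S t x).
Proof.
have [z [Dz]] := mdis_range mA x ltr01; rewrite scale1r => <-.
have [F FP] := Lipschitz_primitive cX (fun s t s0 t0 => semigroup_Lipschitz Dz s0 t0).
exists (fun t => F t - S t z) => e e0.
have [d d0 hd] := primitiveB FP (semigroup_primitive_domain Dz) e0.
exists d => // a b xi a0 axb bad; rewrite SB; first exact: hd.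
by case/andP : axb => /(le_trans a0).
Qed.

(** Applying [S h] to the integral over [0, t] shifts the interval to [h, t + h]
by uniqueness of primitives, so that the difference quotient at 0 reduces to the
two end pieces [t, t + h] and [0, h]. *)
Lemma semigroup_integral x F t : primitive_of F (fun t => S t x) -> 0 <= t ->
  D (F t - F 0) /\ A (F t - F 0) = S t x - x.
Proof.
move=> FP t0; apply/gS.2; rewrite -{2}(S0 x).
have shift h : 0 <= h -> S h (F t) - S h (F 0) = F (t + h) - F h.
  move=> h0; rewrite -[X in _ - F X](add0r h).
  apply: (primitive_unique (F := fun t => S h (F t)) (G := fun t => F (t + h))
    (f := fun t => S (t + h) x)) => //.
    move=> e e0; have [d d0 hd] := FP e e0; exists d => // a b xi a0 axb bad.
    have xi0 : 0 <= xi by case/andP : axb => /(le_trans a0).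
    rewrite [xi + h]addrC SD// -SZ// -!SB//.
    apply: (le_trans (semigroup_contract _ h0)); exact: hd.
  move=> e e0; have [d d0 hd] := FP e e0; exists d => // a b xi a0 axb bad.
  have E : b - a = b + h - (a + h) by rewrite opprD addrACA subrr addr0.
  by rewrite E; apply: hd; rewrite -?E ?addr_ge0// !lerD2r.
have : h^-1 *: (F (t + h) - F t) - h^-1 *: (F (0 + h) - F 0) @[h --> 0^'+]
    --> S t x - S 0 x.
  by apply: cvgB; [exact: primitive_right FP t0|exact: primitive_right FP (lexx 0)].
apply: cvg_trans; apply: near_eq_cvg; near=> h.
have h0 : 0 < h by near: h; exact: nbhs_right_gt.
rewrite SB ?(ltW h0)// shift ?(ltW h0)// add0r.
by rewrite -scalerBr subrACA.
Unshelve. all: by end_near. Qed.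

Lemma semigroup_continuous x : {within `[0, +oo[, continuous (fun t => S t x)}.
Proof.
apply/within_halflineP => t t0 e e0.
have /cvgrPdist_le/(_ _ e0)[d /= d0 hd] := @semigroup_cvg0 _ _ _ gS.1 x.
have near0 r : 0 <= r -> r < d -> `|x - S r x| <= e.
  rewrite le_eqVlt => /predU1P[<-|r0 rd]; first by rewrite S0 subrr normr0 ltW.
  by apply: hd => //; rewrite /ball_/= sub0r normrN gtr0_norm.
have step a b : 0 <= a -> a <= b -> b - a < d -> `|S a x - S b x| <= e.
  move=> a0 ab bad; rewrite [S b x](S_splitl _ a0 ab) -SB//.
  by apply: (le_trans (semigroup_contract _ a0)); rewrite near0// subr_ge0.
exists d => // s s0; have [ts|/ltW st] := leP t s.
  by rewrite distrC ger0_norm ?subr_ge0//; exact: step.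
by rewrite ger0_norm ?subr_ge0// => ?; rewrite distrC; exact: step.
Qed.

Lemma semigroup_mild x : mild_solution D A x (fun t => S t x).
Proof.
split; first exact: semigroup_continuous.
have [F FP] := semigroup_has_primitive x.
move=> t t0; exists (F t - F 0); have [DI AI] := semigroup_integral FP t0.
by split; [exact: primitive_Riemann|by []|rewrite AI subrKC].
Qed.

(** Let [G] be the difference of the integrals of [V] and of the orbit.  It takes
its values in the domain, its derivative is [V s - S s x = A (G s)], and
[G 0 = 0]; by dissipativity [G] vanishes, hence so does [A (G t)]. *)
Lemma mild_solution_unique x V : mild_solution D A x V ->
  forall t, 0 <= t -> V t = S t x.
Proof.
move=> [cV mV] t t0.
have /choice[I IP] (s : R) : exists I, 0 <= s ->
    [/\ is_Riemann_integral V 0 s I, D I & V s = x + A I].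
  by have [/mV[I ?]|] := leP 0 s; [exists I|exists 0].
have IV s : 0 <= s -> is_Riemann_integral V 0 s (I s) by move=> /IP[].
have [F FP] := semigroup_has_primitive x.
pose G s := I s - (F s - F 0).
have GP s : 0 <= s -> D (G s) /\ A (G s) = V s - S s x.
  move=> s0; have [_ DI ->] := IP s s0; have [DF AF] := semigroup_integral FP s0.
  by have [DG ->] := mdisB mA DI DF; rewrite AF opprB addrCA addrA.
have I0 : I 0 = 0.
  apply/eqP; rewrite -normr_le0; apply/ler_addgt0Pr => e e0; rewrite add0r.
  have [d d0 hd] := IV 0 (lexx 0) e e0.
  have := hd 0%N (cst 0) (cst 0); rewrite /Riemann_sum big_ord0 sub0r normrN.
  by move=> H; apply/ltW/H.
have cvI s : 0 <= s -> forall e : R, 0 < e -> exists2 d : R, 0 < d &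
    forall a b, 0 <= a -> a <= s <= b -> b - a < d ->
      `|I b - I a - (b - a) *: V s| <= e * (b - a).
  move=> s0 e e0; move/within_halflineP : cV => /(_ s s0 e e0)[d d0 hd].
  exists d => // a b a0 /andP[as_ sb] bad.
  apply: (Riemann_integral_increment IV) => //; first exact: le_trans sb.
  move=> xi /andP[axi xib]; rewrite distrC; apply: hd.
    exact: le_trans axi.
  by rewrite ltr_norml; apply/andP; split; lra.
have Ileft s : 0 < s -> h^-1 *: (I s - I (s - h)) @[h --> 0^'+] --> V s.
  move=> s0; apply/cvgrPdist_le => e e0; have [d d0 hd] := cvI s (ltW s0) e e0.
  near=> h; have h0 : 0 < h by near: h; exact: nbhs_right_gt.
  have hs : h <= s by near: h; exact: nbhs_right_le.
  have hd' : h < d by near: h; exact: nbhs_right_lt.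
  have E : s - (s - h) = h by rewrite subKr.
  rewrite -(ler_pM2l h0) -{1}(gtr0_norm h0) -normrZ scalerBr scalerA mulfV ?gt_eqF//.
  rewrite scale1r distrC mulrC; have := hd (s - h) s; rewrite E; apply=> //.
    by rewrite subr_ge0.
  by rewrite lexx andbT lerBlDr lerDl ltW.
have Iright s : 0 <= s -> I (s + h) @[h --> 0^'+] --> I s.
  move=> s0; apply/cvgrPdist_le => e e0.
  have [d d0 hd] := cvI s s0 1 ltr01; near=> h.
  have h0 : 0 < h by near: h; exact: nbhs_right_gt.
  have hd' : h < d by near: h; exact: nbhs_right_lt.
  have E : s + h - s = h by rewrite addrAC subrr add0r.
  have := hd s (s + h); rewrite E => /(_ s0); rewrite lexx lerDl (ltW h0).
  move=> /(_ isT hd') h1; have h2 := ler_distD (h *: V s) (I (s + h) - I s) 0.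
  rewrite !subr0 normrZ gtr0_norm// in h2.
  have h3 : h * (1 + `|V s|) <= e.
    rewrite -ler_pdivlMr ?ltr_pwDl//; near: h; apply: nbhs_right_le.
    by rewrite divr_gt0// ltr_pwDl.
  rewrite distrC; lra.
have : `|G t| <= `|G 0|.
  apply: (dissipative_nonincreasing (mdis_dissipative mA) t0).
    move=> s /andP[s0 _]; apply: cvgB; first exact: Iright.
    by apply: cvgB; [exact: primitive_right_cvg FP s0|exact: cvg_cst].
  move=> s /andP[s0 _]; have [DG AG] := GP s (ltW s0); split=> //; rewrite AG.
  have : h^-1 *: (I s - I (s - h)) - h^-1 *: (F s - F (s - h)) @[h --> 0^'+]
      --> V s - S s x.
    by apply: cvgB; [exact: Ileft|exact: primitive_left FP s0].
  apply: cvg_trans; apply: near_eq_cvg; near=> h.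
  rewrite -scalerBr /G; congr (_ *: _); rewrite [in RHS]subrACA; congr (_ - _).
  by rewrite subrACA subrr subr0.
rewrite /G I0 !subrr normr0 normr_le0 => /eqP Gt0.
have [_] := GP t t0; rewrite /G Gt0 (mdis0 mA).2 => /eqP.
by rewrite eq_sym subr_eq0 => /eqP.
Unshelve. all: by end_near. Qed.

(** The orbit of [x] is a primitive of the orbit of [A x], which is continuous;
continuity in the graph norm is continuity of both orbits. *)
Lemma semigroup_classical x : D x -> [/\ C1_halfline (fun t => S t x),
  C0_halfline_domain D A (fun t => S t x) &
  classical_solution D A x (fun t => S t x)].
Proof.
move=> Dx; have SP := semigroup_primitive_domain Dx.
have dS (t : R) : 0 < t -> is_derive t 1 (fun t => S t x) (S t (A x)).
  by move=> t0; exact: (primitive_is_derive SP t0).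
split.
- exists (fun t => S t (A x)); split=> //; first exact: semigroup_continuous.
  have := primitive_right SP (lexx 0).
  by under eq_fun do rewrite add0r.
- move=> t t0; split; first exact: (semigroup_domain t0 Dx).1.
  apply/cvgrPdist_le => e e0; have e20 : 0 < e / 2 by rewrite divr_gt0.
  have /within_halflineP/(_ _ t0 _ e20)[d1 d10 h1] := @semigroup_continuous x.
  have /within_halflineP/(_ _ t0 _ e20)[d2 d20 h2] := @semigroup_continuous (A x).
  exists (Num.min d1 d2) => /=; first by rewrite lt_min d10.
  move=> s /=; rewrite lt_min in_itv/= andbT => /andP[ts1 ts2] s0.
  have [Ds As] := semigroup_domain s0 Dx; have [Dt At] := semigroup_domain t0 Dx.
  rewrite /graph_norm (mdisB mA Ds Dt).2 As At sub0r normrN ger0_norm ?addr_ge0//.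
  by rewrite [leRHS]splitr [`|S s x - _|]distrC [`|S s _ - _|]distrC lerD ?h1 ?h2.
- split; first exact: semigroup_continuous.
  + move=> t t0.
    have cSA := within_halfline_at (@semigroup_continuous (A x)) t0.
    rewrite /prop_for/continuous_at derive1E (@derive_val _ _ _ _ _ _ _ (dS t t0)).
    apply: cvg_trans cSA; apply: near_eq_cvg; near=> s.
    have s0 : 0 < s by near: s; exact: lt_nbhsr.
    by rewrite derive1E (@derive_val _ _ _ _ _ _ _ (dS s s0)).
  + move=> t t0; have [Dt ->] := semigroup_domain (ltW t0) Dx.
    by split=> //; exact: dS.
  + exact: S0.
Unshelve. all: by end_near. Qed.

Lemma classical_solution_unique x V : D x -> classical_solution D A x V ->
  forall t, 0 <= t -> V t = S t x.
Proof.
move=> Dx [cV _ dV V0] t t0.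
apply/eqP; rewrite -subr_eq0 -normr_le0.
have := @dissipative_nonincreasing _ _ D A (fun t => V t - S t x) t
  (mdis_dissipative mA) t0.
rewrite V0 S0 subrr normr0; apply.
  move=> s /andP[s0 _]; apply: cvgB.
    exact: (within_halfline_right cV).
  exact: (within_halfline_right (@semigroup_continuous x)).
move=> s /andP[s0 _]; have [DV dVs] := dV s s0.
have [DS AS] := semigroup_domain (ltW s0) Dx.
have [Dd Ad] := mdisB mA DV DS; split=> //; rewrite Ad.
have : h^-1 *: (V s - V (s - h)) - h^-1 *: (S s x - S (s - h) x) @[h --> 0^'+]
    --> A (V s) - A (S s x).
  apply: cvgB; last exact: semigroup_left_quotient.
  exact: is_derive_left_quotient.
apply: cvg_trans; apply: near_eq_cvg; near=> h.
by rewrite -scalerBr subrACA.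
Unshelve. all: by end_near. Qed.

End generated_semigroup_properties.

(** * The inner product of square-integrable functions *)

(** The measurable structure of the reals is carried by an alias of their type;
this makes the almost everywhere filter known to instance search there. *)
#[global] Instance ae_real_filter (R : realType)
    (mu : {measure set (measurableTypeR R) -> \bar R}) :
  Filter (almost_everywhere mu) := ae_filter_ringOfSetsType mu.

Section L2_inner_product.
Context (R : realType) (l : R).
Local Notation mu := (interval_measure l).
Local Notation measurable_real f :=
  (measurable_fun (setT : set (measurableTypeR R)) (f : _ -> R)).
Implicit Types (u v w : L2 l) (f g : R -> R).

Lemma interval_measure_lty : (mu setT < +oo)%E.
Proof.
rewrite (_ : mu setT = (@lebesgue_measure R) (setT `&` `]0, l[))//.
rewrite setTI lebesgue_measure_itv/=.
by case: ifP => _; rewrite ?ltry.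
Qed.

Lemma ae_eq_Rintegral f g : measurable_real f -> measurable_real g ->
  f = g %[ae mu] -> \int[mu]_x f x = \int[mu]_x g x.
Proof.
move=> mf mg fg; rewrite /Rintegral; congr fine; apply: ae_eq_integral => //.
- exact/measurable_EFinP.
- exact/measurable_EFinP.
- by apply: filterS fg => x /= /(_ I) ->.
Qed.

Lemma L2_fun_measurable u : measurable_real (L2_fun u).
Proof. exact: Lspace_fun_measurable. Qed.

Lemma L2_fun_Lfun u : L2_fun u \in Lfun mu 2%:E.
Proof. exact: Lspace_fun_Lfun. Qed.

Lemma Lfun2_mul_integrable f g : f \in Lfun mu 2%:E -> g \in Lfun mu 2%:E ->
  mu.-integrable setT (EFin \o (fun x => f x * g x)).
Proof. by move=> hf hg; apply/Lfun1_integrable; exact: Lfun2_mul_Lfun1. Qed.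

Definition L2_dot u v : R := \int[mu]_x (L2_fun u x * L2_fun v x).

Lemma L2_mul_integrable u v :
  mu.-integrable setT (EFin \o (fun x => L2_fun u x * L2_fun v x)).
Proof. by apply: Lfun2_mul_integrable; exact: L2_fun_Lfun. Qed.

Lemma L2_dotC u v : L2_dot u v = L2_dot v u.
Proof. by apply: eq_Rintegral => x _; rewrite mulrC. Qed.

Lemma L2_funD u v : L2_fun (u + v) = (fun x => L2_fun u x + L2_fun v x) %[ae mu].
Proof. exact: Lspace_addE. Qed.

Lemma L2_funZ (a : R) u : L2_fun (a *: u) = (fun x => a * L2_fun u x) %[ae mu].
Proof. exact: Lspace_scaleE. Qed.

Lemma L2_dotDl u v w : L2_dot (u + v) w = L2_dot u w + L2_dot v w.
Proof.
have mu_ := @L2_fun_measurable.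
rewrite /L2_dot -RintegralD//; [|exact: L2_mul_integrable..].
apply: ae_eq_Rintegral.
- exact: measurable_funM.
- by apply: measurable_funD; exact: measurable_funM.
- by apply: filterS (L2_funD u v) => x /= h _; rewrite h// mulrDl.
Qed.

Lemma L2_dotZl (a : R) u w : L2_dot (a *: u) w = a * L2_dot u w.
Proof.
have mu_ := @L2_fun_measurable.
rewrite /L2_dot -RintegralZl//; last exact: L2_mul_integrable.
apply: ae_eq_Rintegral.
- exact: measurable_funM.
- by apply: measurable_funM => //; exact: measurable_funM.
- by apply: filterS (L2_funZ a u) => x /= h _; rewrite h// mulrA.
Qed.

Lemma L2_dotBl u v w : L2_dot (u - v) w = L2_dot u w - L2_dot v w.
Proof. by rewrite L2_dotDl -(scaleN1r v) L2_dotZl mulN1r. Qed.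

Lemma L2_dotBr u v w : L2_dot u (v - w) = L2_dot u v - L2_dot u w.
Proof. by rewrite L2_dotC L2_dotBl ![L2_dot _ u]L2_dotC. Qed.

Lemma L2_norm_fin u : 'N[mu]_2[EFin \o L2_fun u]%E = (`|u|)%:E.
Proof.
rewrite L2_normE fineK// ge0_fin_numE ?Lnorm_ge0//.
exact: Lspace_fun_finite.
Qed.

Lemma L2_integral_sqr u :
  (\int[mu]_x (L2_fun u x ^+ 2)%:E)%E = (`|u| ^+ 2)%:E.
Proof.
have := @poweR_Lnorm _ _ _ mu (EFin \o L2_fun u) 2 (lt0r_neq0 (ltr0n R 2)).
rewrite L2_norm_fin /= powR_mulrn// => ->; apply: eq_integral => x _.
by rewrite /= powR_mulrn// real_normK ?num_real.
Qed.

Lemma L2_dot_norm u : L2_dot u u = `|u| ^+ 2.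
Proof. by rewrite /L2_dot /Rintegral L2_integral_sqr. Qed.

(** The Cauchy-Schwarz inequality, as the case of exponents 2 and 2 of Hoelder's
inequality. *)
Lemma L2_dot_le u v : `|L2_dot u v| <= `|u| * `|v|.
Proof.
apply: (le_trans (le_normr_Rintegral _ (L2_mul_integrable u v))) => //.
rewrite -lee_fin /Rintegral fineK; last first.
  by apply: integrable_fin_num => //; exact: integrable_abse (L2_mul_integrable u v).
have := @hoelder _ _ _ mu (L2_fun u) (L2_fun v) 2 2.
rewrite !L2_norm_fin Lnorm1 -EFinM; apply => //; try exact: L2_fun_measurable.
by rewrite -mulr2n -[RHS](@mulVf _ 2)// mulr_natr.
Qed.

Lemma L2_funB u v : L2_fun (u - v) = (fun x => L2_fun u x - L2_fun v x) %[ae mu].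
Proof.
rewrite -scaleN1r; apply: filterS2 (L2_funD u (-1 *: v)) (L2_funZ (-1) v).
by move=> x /= h1 h2 _; rewrite h1// h2// mulN1r.
Qed.

Lemma Lnorm2_le f (c : R) : 0 <= c ->
  (\int[mu]_x (f x ^+ 2)%:E <= (c ^+ 2)%:E)%E -> ('N[mu]_2[EFin \o f] <= c%:E)%E.
Proof.
move=> c0 fc; rewrite unlock /=.
have -> : c%:E = ((c ^+ 2)%:E `^ 2^-1)%E.
  by rewrite poweR_EFin -powR_mulrn// -powRrM mulfV// powRr1.
apply: gt0_ler_poweR; rewrite ?invr_ge0// ?in_itv/= ?leey ?andbT.
- by apply: integral_ge0 => x _; rewrite lee_fin powR_ge0.
- by rewrite lee_fin sqr_ge0.
- apply: le_trans fc; rewrite le_eqVlt; apply/orP; left; apply/eqP.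
  by apply: eq_integral => x _; rewrite powR_mulrn// real_normK ?num_real.
Qed.

Definition L2_of f (hf : f \in Lfun mu 2%:E) : L2 l :=
  Lspace_of (Lfun_Sub (lee1n 2) hf).

Lemma L2_of_ae f (hf : f \in Lfun mu 2%:E) : L2_fun (L2_of hf) = f %[ae mu].
Proof. exact: Lspace_ofE. Qed.

Lemma L2_eq_ae u v : L2_fun u = L2_fun v %[ae mu] -> u = v.
Proof. exact: LspaceP. Qed.

Lemma L2_dist_of u f (hf : f \in Lfun mu 2%:E) :
  'N[mu]_2[(fun x => (L2_fun u x - f x)%:E)]%E = (`|u - L2_of hf|)%:E.
Proof.
have mf : measurable_real f by move: hf => /[!inE] /andP[/[!inE]].
rewrite -L2_norm_fin; apply: ae_eq_Lnorm => //.
- by rewrite lee_fin ler1n.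
- by apply: measurable_funB => //; exact: L2_fun_measurable.
- exact: L2_fun_measurable.
- apply: filterS2 (L2_funB u (L2_of hf)) (L2_of_ae hf) => x /= h1 h2 _.
  by rewrite h1// h2.
Qed.

Lemma Lfun2P f : measurable_real f -> ('N[mu]_2[EFin \o f] < +oo)%E ->
  f \in Lfun mu 2%:E.
Proof. by move=> mf nf; rewrite inE; apply/andP; split; rewrite inE. Qed.

(** On an interval of finite measure convergence in L^2 implies convergence in
L^1; used to control the series of increments of a Cauchy sequence. *)
Lemma L2_norm1_le u : (\int[mu]_x `|L2_fun u x|%:E <=
  (`|u| * fine ('N[mu]_2[EFin \o cst (1%R : R)]))%:E)%E.
Proof.
have N1 : 'N[mu]_2[EFin \o cst (1%R : R)]%E \is a fin_num.
  rewrite ge0_fin_numE ?Lnorm_ge0// (_ : EFin \o cst (1 : R) = cst (1%E : \bar R))//.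
  by rewrite Lnorm_cst1 poweR_lty// interval_measure_lty.
rewrite EFinM (fineK N1) -L2_norm_fin.
have := @hoelder _ _ _ mu (L2_fun u) (cst 1) 2 2.
rewrite Lnorm1 => H; apply: le_trans (H _ _ _ _ _) => //.
- by rewrite le_eqVlt; apply/orP; left; apply/eqP; apply: eq_integral => x _; rewrite /= mulr1.
- exact: L2_fun_measurable.
- by rewrite -mulr2n -[RHS](@mulVf _ 2)// mulr_natr.
Qed.

End L2_inner_product.

(** * Completeness of the space of square-integrable functions *)

Section L2_complete.
Context (R : realType) (l : R).
Local Notation mu := (interval_measure l).
Local Notation measurable_real f :=
  (measurable_fun (setT : set (measurableTypeR R)) (f : _ -> R)).

(** The Riesz-Fischer argument for a sequence whose increments are dominated by
[2^-k]. *)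
Section rapid.
Variable u : nat -> L2 l.
Hypothesis uC : forall k j, (k <= j)%N -> `|u j - u k| <= 2^-1 ^+ k.

Let f k : measurableTypeR R -> R := L2_fun (u k).
Let d k x : R := `|f k.+1 x - f k x|.
Let F x : \bar R := limn_esup (fun k => (f k x)%:E).
(* The pointwise limit where it exists.  The upper limit makes it measurable
   everywhere without selecting the points of convergence. *)
Let g x : R := fine (F x).

Let d_ge0 k x : 0 <= d k x. Proof. exact: normr_ge0. Qed.

Let mf k : measurable_real (f k). Proof. exact: L2_fun_measurable. Qed.

Let md k : measurable_real (d k).
Proof. by apply: measurableT_comp => //; exact: measurable_funB. Qed.

Let mg : measurable_real g.
Proof.
apply: measurableT_comp => //; apply: measurable_fun_limn_esup => n.
exact/measurable_EFinP.
Qed.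

(** The integral of the sum of increments is at most a geometric series, so the
sum is finite almost everywhere. *)
Let sum_d_fin : {ae mu, forall x, (\sum_(k <oo) (d k x)%:E)%E \is a fin_num}.
Proof.
pose C := fine ('N[mu]_2[EFin \o cst (1%R : R)]).
have C0 : 0 <= C by exact/fine_ge0/Lnorm_ge0.
have mS : measurable_fun setT (fun x : measurableTypeR R => (\sum_(k <oo) (d k x)%:E)%E).
  apply: ge0_emeasurable_sum => [k x _ _|k _]; first by rewrite lee_fin.
  exact/measurable_EFinP.
suff iS : mu.-integrable setT (fun x => (\sum_(k <oo) (d k x)%:E)%E).
  by apply: filterS (integrable_ae measurableT iS) => x /(_ I).
apply/integrableP; split => //.
under eq_integral => x _.
  rewrite gee0_abs; last by apply: nneseries_ge0 => k _ _; rewrite lee_fin.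
  over.
rewrite integral_nneseries//; [|by move=> n; exact/measurable_EFinP|
  by move=> n x _; rewrite lee_fin].
apply: (@le_lt_trans _ _ (\sum_(k <oo) (2 * C / (2 ^ (k + 1))%:R)%:E)%E); last first.
  by rewrite (cvg_lim _ (@cvg_geometric_eseries_half R (2 * C) 0))// ltry.
apply: lee_nneseries => [k _ _|k _].
  by apply: integral_ge0 => x _; rewrite lee_fin.
rewrite (_ : (\int[mu]_x _)%E = (\int[mu]_x `|L2_fun (u k.+1 - u k) x|%:E)%E).
  apply: (le_trans (L2_norm1_le _)); rewrite lee_fin -/C mulrC.
  rewrite [leRHS](_ : _ = C * 2^-1 ^+ k); last first.
    by rewrite addn1 expnS natrM natrX exprVn; field; rewrite expf_neq0.
  by rewrite ler_wpM2l// uC.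
apply: ae_eq_integral => //.
- exact/measurable_EFinP.
- by apply/measurable_EFinP; apply: measurableT_comp => //; exact: L2_fun_measurable.
- by apply: filterS (L2_funB (u k.+1) (u k)) => x /= h _; rewrite h.
Qed.

Let f_cvg : {ae mu, forall x, f k x @[k --> \oo] --> g x}.
Proof.
apply: filterS sum_d_fin => x fin_d.
suff cf : cvgn (fun k => f k x).
  have cF : (f k x)%:E @[k --> \oo] --> (limn (fun k => f k x))%:E.
    by apply: cvg_EFin; [exact: nearW|exact: cf].
  by rewrite /g /F is_cvg_limn_esupE ?(cvg_lim _ cF)//; apply/cvg_ex; eexists; exact: cF.
rewrite (_ : (fun k => f k x) =
    (fun k => f 0%N x + series (telescope (fun k => f k x)) k)); last first.
  by apply/funext => k; exact: eq_sum_telescope.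
apply: is_cvgD; first exact: is_cvg_cst.
apply: normed_cvg; apply: nondecreasing_is_cvgn.
  by apply: nondecreasing_series => k _ _; exact: normr_ge0.
exists (fine (\sum_(k <oo) (d k x)%:E)%E) => _ [n _ <-].
rewrite -lee_fin fineK// /series/= -sumEFin; apply: nneseries_lim_ge.
by move=> k _ _; rewrite lee_fin.
Qed.

(** Fatou's lemma applied to [|f_(k+j) - f_k|^2] as [j] grows. *)
Let g_dist k : ('N[mu]_2[EFin \o (fun x => g x - f k x)%R] <= (2^-1 ^+ k)%:E)%E.
Proof.
apply: Lnorm2_le; first by rewrite exprn_ge0// invr_ge0.
pose h j x : \bar R := ((f (k + j)%N x - f k x) ^+ 2)%:E.
have mh j : measurable_fun setT (h j : measurableTypeR R -> \bar R).
  apply/measurable_EFinP; apply: measurable_funX; exact: measurable_funB.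
have h0 j x : (0 <= h j x)%E by rewrite lee_fin sqr_ge0.
have hE : {ae mu, forall x, limn_einf (h^~ x) = ((g x - f k x) ^+ 2)%:E}.
  apply: filterS f_cvg => x fx.
  have ch : h j x @[j --> \oo] --> ((g x - f k x) ^+ 2)%:E.
    apply: cvg_EFin; first exact: nearW.
    have fkx : f (k + j)%N x @[j --> \oo] --> g x.
      have := fx; rewrite -(cvg_shiftn k) => fx'.
      by under eq_fun do rewrite addnC; exact: fx'.
    have dkx : f (k + j)%N x - f k x @[j --> \oo] --> g x - f k x.
      by apply: cvgB => //; exact: cvg_cst.
    exact: (cvgM dkx dkx).
  by rewrite is_cvg_limn_einfE ?(cvg_lim _ ch)//; apply/cvg_ex; eexists; exact: ch.
have -> : (\int[mu]_x ((g x - f k x) ^+ 2)%:E)%E = (\int[mu]_x limn_einf (h^~ x))%E.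
  apply: ae_eq_integral => //.
  - by apply/measurable_EFinP; apply: measurable_funX; exact: measurable_funB.
  - apply: measurableT_comp => //; apply: measurable_fun_limn_esup => j.
    exact: measurableT_comp.
  - by apply: filterS hE => x -> _.
apply: (le_trans (fatou mu measurableT mh (fun j x _ => h0 j x))).
have hj j : (\int[mu]_x h j x <= (2^-1 ^+ k ^+ 2)%:E)%E.
  rewrite (_ : (\int[mu]_x h j x)%E = (`|u (k + j)%N - u k| ^+ 2)%:E).
    rewrite lee_fin lerXn2r ?nnegrE ?exprn_ge0 ?invr_ge0// uC//.
    exact: leq_addr.
  rewrite -L2_integral_sqr; apply: ae_eq_integral => //.
  - by apply/measurable_EFinP; apply: measurable_funX; exact: L2_fun_measurable.
  - by apply: filterS (L2_funB (u (k + j)%N) (u k)) => x /= e _; rewrite e.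
rewrite limn_einf_lim; apply: lime_le; first exact: is_cvg_einfs.
apply: nearW => n; apply: le_trans (hj n); apply: ereal_inf_lbound.
by exists n => //=.
Qed.

Let g_Lfun : g \in Lfun mu 2%:E.
Proof.
rewrite (_ : g = (fun x => (g x - f 0%N x) + f 0%N x)); last first.
  by apply/funext => x; rewrite subrK.
have [_ closed_add] := Lfun_addr_closed mu (@lee1n R 2).
apply: (closed_add (fun x => g x - f 0%N x) (f 0%N)).
  apply: Lfun2P; first exact: measurable_funB.
  by apply: le_lt_trans (g_dist 0) _; rewrite ltry.
exact: L2_fun_Lfun.
Qed.

Lemma rapidly_Cauchy_cvg : exists v : L2 l, forall k, `|v - u k| <= 2^-1 ^+ k.
Proof.
exists (L2_of g_Lfun) => k; rewrite distrC -lee_fin -L2_dist_of.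
apply: le_trans (g_dist k); rewrite -oppe_Lnorm le_eqVlt; apply/orP; left.
by apply/eqP; apply: eq_Lnorm => x; rewrite /= opprB.
Qed.

End rapid.

Lemma L2_complete : seq_complete (L2 l).
Proof.
move=> u uC.
have /choice[N NP] (k : nat) : exists N, forall m n, (N <= m)%N -> (N <= n)%N ->
    `|u m - u n| <= 2^-1 ^+ k.
  by apply: uC; rewrite exprn_gt0// invr_gt0.
pose n k := (\max_(i < k.+1) N i)%N.
have Nn k : (N k <= n k)%N by exact: (leq_bigmax (Ordinal (ltnSn k))).
have nS k j : (k <= j)%N -> (n k <= n j)%N.
  move=> kj; apply/bigmax_leqP => i _.
  have ij : (i < j.+1)%N by rewrite (leq_trans (ltn_ord i)).
  exact: (leq_bigmax (Ordinal ij)).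
have [|v vP] := @rapidly_Cauchy_cvg (u \o n).
  by move=> k j kj; apply: NP; [exact: leq_trans (nS _ _ kj)|exact: Nn].
exists v; apply/cvgrPdist_le => e e0.
have e20 : 0 < e / 2 by rewrite divr_gt0.
have [k hk] : exists k, 2^-1 ^+ k <= e / 2.
  have /cvgrPdist_le/(_ _ e20)[k _ hk] := @cvg_dyadic_mesh R.
  exists k; have := hk k (leqnn k).
  by rewrite sub0r normrN ger0_norm// ltW// dyadic_mesh_gt0.
exists (n k) => // m /= nm; apply: (le_trans (ler_distD (u (n k)) _ _)).
rewrite [leRHS]splitr; apply: lerD; first exact: le_trans (vP k) hk.
by apply: le_trans hk; apply: NP; [|exact: leq_trans nm].
Qed.

End L2_complete.

(** * Orthogonal projections and the phase space *)

(** The inner product is a parameter of the section: it is used both for the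
energy space and for the phase spaces with other weights. *)
Section projection.
Context (R : realType) (X : normedModType R) (dot : X -> X -> R).
Hypothesis cX : seq_complete X.
Hypothesis dotC : forall x y, dot x y = dot y x.
Hypothesis dotDl : forall x y z, dot (x + y) z = dot x z + dot y z.
Hypothesis dotZl : forall (a : R) x y, dot (a *: x) y = a * dot x y.
Hypothesis dot_norm : forall x, dot x x = `|x| ^+ 2.

Let normD2 x y : `|x + y| ^+ 2 = `|x| ^+ 2 + 2 * dot x y + `|y| ^+ 2.
Proof.
rewrite -!dot_norm dotDl ![dot _ (x + y)]dotC !dotDl [dot y x]dotC.
by ring.
Qed.

Lemma dot_normBZ x (t : R) y :
  `|x - t *: y| ^+ 2 = `|x| ^+ 2 - 2 * t * dot x y + t ^+ 2 * `|y| ^+ 2.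
Proof.
by rewrite normD2 normrN normrZ exprMn real_normK ?num_real// -scaleNr dotC dotZl dotC; ring.
Qed.

(** [P] is the point closest to [G] in the closure of the subspace [V].  A
minimizing sequence in [V] is Cauchy by the parallelogram identity, and
minimality along the line [P + t x] forces orthogonality. *)
Lemma orthogonal_projection (V : set X) G : V !=set0 ->
  (forall (a : R) x y, V x -> V y -> V (a *: x + y)) ->
  exists P, (forall e : R, 0 < e -> exists2 x, V x & `|P - x| < e) /\
    forall x, V x -> dot (G - P) x = 0.
Proof.
move=> [v0 Vv0] Vlin; pose E := [set `|G - x| ^+ 2 | x in V].
have E0 : has_inf E.
  by split; [exists (`|G - v0| ^+ 2), v0|exists 0 => _ [x _ <-]; exact: sqr_ge0].
pose d := inf E.
have dE x : V x -> d <= `|G - x| ^+ 2.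
  by move=> Vx; apply: ge_inf; [exact: E0.2|exists x].
have /choice[phi phiP] (n : nat) : exists x, V x /\ `|G - x| ^+ 2 < d + n.+1%:R^-1.
  have n0 : 0 < n.+1%:R^-1 :> R by rewrite invr_gt0.
  by have [_ [x Vx <-] xn] := inf_adherent n0 E0; exists x.
have phi_close m n : `|phi m - phi n| ^+ 2 <= 2 * (m.+1%:R^-1 + n.+1%:R^-1).
  have [Vm hm] := phiP m; have [Vn hn] := phiP n.
  have hmid : d <= `|G - (2^-1 *: phi m + 2^-1 *: phi n)| ^+ 2.
    have V0 : V 0 by have := Vlin (-1) v0 v0 Vv0 Vv0; rewrite scaleN1r addNr.
    apply: dE; rewrite -[2^-1 *: phi n]addr0.
    exact: (Vlin _ _ _ Vm (Vlin _ _ _ Vn V0)).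
  have E1 : `|phi m - phi n| ^+ 2 = 2 * `|G - phi m| ^+ 2 + 2 * `|G - phi n| ^+ 2
      - 4 * `|G - (2^-1 *: phi m + 2^-1 *: phi n)| ^+ 2.
    have -> : `|phi m - phi n| ^+ 2 = `|(G - phi n) - 1 *: (G - phi m)| ^+ 2.
      by rewrite scale1r subrACA subrr sub0r opprB.
    have -> : G - (2^-1 *: phi m + 2^-1 *: phi n) =
        2^-1 *: ((G - phi n) - (-1) *: (G - phi m)).
      have GE : G = 2^-1 *: (G + G).
        by rewrite -mulr2n -(scaler_nat 2 G) scalerA mulVf// scale1r.
      rewrite scaleN1r opprK addrACA scalerDr -GE -opprD scalerN scalerDr.
      by rewrite [X in _ = _ - X]addrC.
    by rewrite normrZ exprMn !dot_normBZ gtr0_norm ?invr_gt0//; field.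
  rewrite E1; move: hm hn hmid; move: (m.+1%:R^-1) (n.+1%:R^-1) => em en.
  lra.
have [P cP] : exists P : X, phi @ \oo --> P.
  apply: cX => e e0; have e20 : 0 < e ^+ 2 / 4 by rewrite divr_gt0// exprn_gt0.
  exists (Num.truncn (e ^+ 2 / 4)^-1) => m n Nm Nn.
  have small k : (Num.truncn (e ^+ 2 / 4)^-1 <= k)%N -> k.+1%:R^-1 <= e ^+ 2 / 4.
    move=> Nk; rewrite invf_ple ?posrE//; apply: ltW.
    by apply: (lt_le_trans (truncnS_gt _)); rewrite ler_nat.
  rewrite -(@ler_pXn2r _ 2) ?nnegrE ?(ltW e0)//.
  have := phi_close m n; have := small m Nm; have := small n Nn.
  move: (m.+1%:R^-1) (n.+1%:R^-1) => em en; lra.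
exists P; split=> [e e0|x Vx].
  move/cvgrPdist_lt : cP => /(_ _ e0)[n _ hn]; exists (phi n).
    exact: (phiP n).1.
  exact: hn (leqnn n).
have sq_cvg y : `|G - phi n - y| ^+ 2 @[n --> \oo] --> `|G - P - y| ^+ 2.
  have h : `|G - phi n - y| @[n --> \oo] --> `|G - P - y|.
    apply: cvg_norm; apply: cvgB; last exact: cvg_cst.
    by apply: cvgB => //; exact: cvg_cst.
  exact: (cvgM h h).
have ge_d t : d <= `|G - P - t *: x| ^+ 2.
  apply: (cvgr_to_ge (sq_cvg (t *: x))); apply: nearW => n.
  by rewrite -addrA -opprD [phi n + _]addrC; apply: dE; apply: Vlin => //; exact: (phiP n).1.
have le_d : `|G - P| ^+ 2 <= d.
  have h := sq_cvg 0; rewrite subr0 in h.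
  have h2 : d + n.+1%:R^-1 @[n --> \oo] --> d + (0 : R).
    by apply: cvgD; [exact: cvg_cst|exact: cvg_harmonic].
  rewrite -[leRHS]addr0; apply: (ler_cvg_to h h2); apply: nearW => n.
  by rewrite subr0 ltW// (phiP n).2.
set c := dot (G - P) x; set q := `|x| ^+ 2.
have q0 : 0 <= q by exact: sqr_ge0.
apply/eqP; rewrite -sqrf_eq0 eq_le sqr_ge0 andbT.
have q1 : 0 < q + 1 by rewrite ltr_wpDl.
(* The optimal [t] is [c / q]; the shift by 1 avoids the case [q = 0]. *)
have := ge_d (c / (q + 1)); rewrite dot_normBZ -/c -/q => h.
have h2 : 0 <= - 2 * (c / (q + 1)) * c + (c / (q + 1)) ^+ 2 * q by lra.
have h3 : - 2 * (c / (q + 1)) * c + (c / (q + 1)) ^+ 2 * q =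
    - (c ^+ 2 * ((q + 2) / (q + 1) ^+ 2)) by field; rewrite gt_eqF.
rewrite h3 oppr_ge0 pmulr_lle0// in h2.
by rewrite divr_gt0 ?exprn_gt0// ltr_wpDl.
Qed.

End projection.

Section phase_space_Hilbert.
Context (R : realType) (l : R) (a b : {posnum R}).
Local Notation H := (phase_space l a b).
Implicit Types U V W : H.

Definition phase_dot U V : R :=
  a%:num * L2_dot U.1 V.1 + b%:num * L2_dot U.2 V.2.

Lemma phase_dotC U V : phase_dot U V = phase_dot V U.
Proof. by rewrite /phase_dot L2_dotC [L2_dot U.2 _]L2_dotC. Qed.

Lemma phase_dotDl U V W : phase_dot (U + V) W = phase_dot U W + phase_dot V W.
Proof. by rewrite /phase_dot !L2_dotDl; ring. Qed.

Lemma phase_dotZl (s : R) U V : phase_dot (s *: U) V = s * phase_dot U V.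
Proof. by rewrite /phase_dot !L2_dotZl; ring. Qed.

Lemma phase_dot_norm U : phase_dot U U = `|U| ^+ 2.
Proof. by rewrite phase_space_normE /phase_dot !L2_dot_norm. Qed.

(** A linear bound that replaces the square root of [1/d] by [1/d + 1]. *)
Lemma weighted_sqr_le (d x y : R) : 0 < d -> 0 <= x -> 0 <= y ->
  d * x ^+ 2 <= y ^+ 2 -> x <= (d^-1 + 1) * y.
Proof.
move=> d0 x0 y0 h; have d10 : 0 < d^-1 by rewrite invr_gt0.
have e0 : 0 <= d^-1 + 1 by rewrite addr_ge0// ltW.
rewrite -(@ler_pXn2r _ 2) ?nnegrE ?mulr_ge0//.
rewrite -(ler_pM2l d0); apply: (le_trans h); rewrite exprMn mulrA.
rewrite ler_peMl ?sqr_ge0// -subr_ge0.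
rewrite (_ : _ - _ = d^-1 + d + 1); last by field; rewrite gt_eqF.
by rewrite !addr_ge0// ltW.
Qed.

Lemma phase_norm_fst U : `|U.1| <= (a%:num^-1 + 1) * `|U|.
Proof.
apply: weighted_sqr_le => //; rewrite phase_space_normE lerDl.
by rewrite mulr_ge0// sqr_ge0.
Qed.

Lemma phase_norm_snd U : `|U.2| <= (b%:num^-1 + 1) * `|U|.
Proof.
apply: weighted_sqr_le => //; rewrite phase_space_normE lerDr.
by rewrite mulr_ge0// sqr_ge0.
Qed.

Lemma phase_space_complete : seq_complete H.
Proof.
move=> u uC.
have [v1 cv1] : exists v : L2 l, (u n).1 @[n --> \oo] --> v.
  apply: L2_complete => e e0.
  have k0 : 0 < a%:num^-1 + 1 by rewrite addr_gt0// invr_gt0.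
  have [N hN] := uC _ (divr_gt0 e0 k0); exists N => m n Nm Nn.
  have := hN m n Nm Nn; rewrite ler_pdivlMr// mulrC; apply: le_trans.
  exact: (phase_norm_fst (u m - u n)).
have [v2 cv2] : exists v : L2 l, (u n).2 @[n --> \oo] --> v.
  apply: L2_complete => e e0.
  have k0 : 0 < b%:num^-1 + 1 by rewrite addr_gt0// invr_gt0.
  have [N hN] := uC _ (divr_gt0 e0 k0); exists N => m n Nm Nn.
  have := hN m n Nm Nn; rewrite ler_pdivlMr// mulrC; apply: le_trans.
  exact: (phase_norm_snd (u m - u n)).
exists ((v1, v2) : H); apply/cvgrPdist_le => e e0.
have k0 : 0 < a%:num + b%:num + 1 by rewrite !addr_gt0.
have ek0 : 0 < e / (a%:num + b%:num + 1) by rewrite divr_gt0.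
move/cvgrPdist_le : cv1 => /(_ _ ek0) h1.
move/cvgrPdist_le : cv2 => /(_ _ ek0) h2.
near=> n.
have k1 : `|v1 - (u n).1| <= e / (a%:num + b%:num + 1) by near: n.
have k2 : `|v2 - (u n).2| <= e / (a%:num + b%:num + 1) by near: n.
rewrite -(@ler_pXn2r _ 2) ?nnegrE ?(ltW e0)// phase_space_normE /=.
set r := e / _ in k1 k2 ek0.
apply: (@le_trans _ _ (a%:num * r ^+ 2 + b%:num * r ^+ 2)).
  by rewrite lerD// ler_pM2l// lerXn2r ?nnegrE ?(ltW ek0).
have -> : e = r * (a%:num + b%:num + 1) by rewrite /r divfK ?gt_eqF.
rewrite -mulrDl [leRHS]exprMn mulrC ler_pM2l ?exprn_gt0//.
rewrite expr2; apply: (@le_trans _ _ (a%:num + b%:num + 1)); first by rewrite lerDl.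
by rewrite ler_peMr ?(ltW k0)// lerDr addr_ge0.
Unshelve. all: by end_near. Qed.

End phase_space_Hilbert.

(** * Smooth functions with compact support *)

Section flat_functions.
Context (R : realType).
Implicit Types (c y x : R) (f g : R -> R).

(** [y^-m exp(-c/y)] extended by 0.  The powers are part of the family so that
it is stable under differentiation. *)
Definition flat c (m : nat) y : R :=
  if 0 < y then y^-1 ^+ m * expR (- (c * y^-1)) else 0.

(** [exp z >= z^(m+1)/(m+1)!] at [z = c/y] compensates [m + 1] powers of [1/y].
Vanishing to first order at 0 is what the derivative there needs. *)
Lemma flat_le c m y : 0 < c -> `|flat c m y| <= m.+1`!%:R / c ^+ m.+1 * `|y|.
Proof.
move=> c0; rewrite /flat; case: ifPn => [y0|_]; last first.
  by rewrite normr0 mulr_ge0// divr_ge0// exprn_ge0// ltW.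
have yV0 : 0 < y^-1 by rewrite invr_gt0.
rewrite (gtr0_norm y0) ger0_norm; last by rewrite mulr_ge0 ?expR_ge0 ?exprn_ge0// ltW.
rewrite expRN ler_pdivrMr ?expR_gt0//.
have h : (c * y^-1) ^+ m.+1 / m.+1`!%:R <= expR (c * y^-1).
  apply: le_trans (expR_ge1Dxn m _); first by rewrite lerDr.
  by rewrite mulr_ge0 ?ltW.
have k0 : 0 < m.+1`!%:R / c ^+ m.+1 * y.
  by rewrite !mulr_gt0// ?invr_gt0 ?exprn_gt0// ltr0n fact_gt0.
rewrite -(ler_pM2l k0) in h; apply: le_trans h; rewrite le_eqVlt; apply/orP; left.
apply/eqP; rewrite exprMn [y^-1 ^+ m.+1]exprS; field.
by rewrite (gt_eqF y0) expf_neq0 ?gt_eqF//= pnatr_eq0 -lt0n fact_gt0.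
Qed.

Lemma is_derive_flat c m y : 0 < c ->
  is_derive y 1 (flat c m) (- m%:R * flat c m.+1 y + c * flat c m.+2 y).
Proof.
move=> c0; case: (ltgtP y 0) => [y0|y0|->].
- have E : \forall z \near y, cst 0 z = flat c m z.
    near=> z; rewrite /flat ltNge ltW//=.
    by near: z; exact: lt_nbhsl.
  rewrite /flat ltNge (ltW y0)/= !mulr0 addr0.
  apply: (near_eq_is_derive E); exact: is_derive_cst.
- have E : \forall z \near y, z^-1 ^+ m * expR (- (c * z^-1)) = flat c m z.
    near=> z; rewrite /flat ifT//.
    by near: z; exact: lt_nbhsr.
  apply: (near_eq_is_derive E).
  have yn0 : y != 0 by rewrite gt_eqF.
  have dV : is_derive y 1 (fun z : R => z^-1) (- y ^- 2).
    have := @is_deriveV _ id y 1 1 yn0 (is_derive_id _ _).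
    by rewrite /= [_ *: _]mulr1.
  have dE : is_derive y 1 (fun z : R => expR (- (c * z^-1)))
      (expR (- (c * y^-1)) * - (c * - y ^- 2)).
    exact: (@is_derive1_comp _ expR (fun z => - (c * z^-1)) _ _ _
      (is_derive_expR _) (is_deriveN (is_deriveZ c dV))).
  have dX : is_derive y 1 (fun z : R => z^-1 ^+ m)
      (m%:R * y^-1 ^+ m.-1 * - y ^- 2).
    rewrite (_ : (fun z : R => z^-1 ^+ m) = (fun z : R => z^-1) ^+ m); last first.
      by rewrite exprfctE.
    exact: (is_deriveX m dV).
  apply: (@is_derive_eq _ _ _ ((fun z : R => z^-1 ^+ m) * _) _ _ _ _ (is_deriveM dX dE)).
  rewrite /flat y0 /=; rewrite ![_ *: _]mulrC.
  case: m {E dX} => [|m]; first by rewrite !mul0r !expr0; field.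
  by rewrite /= !exprS; field.
- rewrite /flat ltxx !mulr0 addr0.
  have H : h^-1 *: (flat c m (h *: 1 + 0) - flat c m 0) @[h --> 0^'] --> (0 : R).
    have K0 : 0 < m.+2`!%:R / c ^+ m.+2.
      by rewrite divr_gt0// ?exprn_gt0// ltr0n fact_gt0.
    apply/cvgrPdist_le => e e0; near=> h.
    have h0 : h != 0 by near: h; exact: nbhs_dnbhs_neq.
    rewrite sub0r normrN addr0 [h *: 1]mulr1 {2}/flat ltxx subr0.
    have -> : h^-1 *: flat c m h = flat c m.+1 h.
      by rewrite /flat; case: ifP => _; rewrite ?scaler0// exprS -mulrA.
    apply: (le_trans (flat_le _ _ c0)); rewrite -ler_pdivlMl//.
    by near: h; apply: dnbhs0_le; rewrite mulr_gt0// invr_gt0.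
  split; first by apply/cvg_ex; exists 0.
  by apply: cvg_lim => //; exact: Rhausdorff.
Unshelve. all: by end_near. Qed.

End flat_functions.

Section smooth.
Context (R : realType).
Implicit Types f g : R -> R.

Definition smooth f : Prop := forall n x, derivable (derive1n n f) x 1.

(** The coinduction principle for smoothness. *)
Lemma smooth_class (C : set (R -> R)) :
  (forall f, C f -> (forall x, derivable f x 1) /\ C (derive1 f)) ->
  forall f, C f -> smooth f.
Proof.
move=> CP f Cf n; suff : C (derive1n n f) by move=> /CP[].
by elim: n => // n IH; rewrite derive1nS; exact: (CP _ IH).2.
Qed.

Lemma smooth_derive1 f : smooth f -> smooth (derive1 f).
Proof. by move=> sf n x; rewrite -derive1Sn; exact: sf. Qed.

Lemma smooth_linear (a : R) f g : smooth f -> smooth g ->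
  smooth (fun x => a * f x + g x).
Proof.
move=> sf sg; apply: (@smooth_class [set h | exists f g, [/\ smooth f, smooth g
  & h = (fun x => a * f x + g x)]]); last by exists f, g.
move=> _ {f g sf sg}[f [g [sf sg ->]]].
have D (x : R) : is_derive x 1 (fun x => a * f x + g x) (a * derive1 f x + derive1 g x).
  rewrite !derive1E.
  exact: (is_deriveD (is_deriveZ a (derivableP (sf 0%N x))) (derivableP (sg 0%N x))).
split=> [x|]; first exact: ex_derive.
exists (derive1 f), (derive1 g).
split; [exact: smooth_derive1|exact: smooth_derive1|].
by apply/funext => x; rewrite derive1E (@derive_val _ _ _ _ _ _ _ (D x)).
Qed.

(** A class stable under differentiation that contains the bump functions, built
for [smooth_class]. *)
Inductive flat_algebra : (R -> R) -> Prop :=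
| flat_algebra_flat c m s a : 0 < c ->
    flat_algebra (fun x => flat c m (s * x + a))
| flat_algebra_linear k f g : flat_algebra f -> flat_algebra g ->
    flat_algebra (fun x => k * f x + g x)
| flat_algebra_mul f g : flat_algebra f -> flat_algebra g ->
    flat_algebra (fun x => f x * g x).

Lemma flat_algebra_derive f : flat_algebra f ->
  exists2 g, flat_algebra g & forall x : R, is_derive x 1 f (g x).
Proof.
elim=> {f} [c m s a c0|k f g _ [f' Ff' df] _ [g' Fg' dg]|f g Ff [f' Ff' df] Fg [g' Fg' dg]].
- exists (fun x => (s * - m%:R) * flat c m.+1 (s * x + a)
      + ((s * c - 1) * flat c m.+2 (s * x + a) + flat c m.+2 (s * x + a))).
    apply: flat_algebra_linear; first exact: flat_algebra_flat.
    by apply: flat_algebra_linear; exact: flat_algebra_flat.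
  move=> x; have dA : is_derive x 1 (fun x : R => s * x + a) s.
    have := is_deriveD (is_deriveZ s (is_derive_id x 1)) (is_derive_cst a x 1).
    by rewrite addr0 [_ *: _]mulr1; exact: id.
  have dF : is_derive x 1 (fun x : R => flat c m (s * x + a)) _ :=
    @is_derive1_comp _ (flat c m) (fun x => s * x + a) _ _ _
      (is_derive_flat m (s * x + a) c0) dA.
  apply: (is_derive_eq dF).
  by ring.
- exists (fun x => k * f' x + g' x); first exact: flat_algebra_linear.
  by move=> x; exact: (is_deriveD (is_deriveZ k (df x)) (dg x)).
- exists (fun x => 0 * f' x + (1 * (f x * g' x) + g x * f' x)).
    apply: flat_algebra_linear => //; apply: flat_algebra_linear.
      exact: flat_algebra_mul.
    exact: flat_algebra_mul.
  move=> x; have dM : is_derive x 1 (fun x : R => f x * g x) _ :=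
    is_deriveM (df x) (dg x).
  apply: (is_derive_eq dM).
  by rewrite mul0r mul1r add0r.
Qed.

Lemma flat_algebra_smooth f : flat_algebra f -> smooth f.
Proof.
apply: smooth_class => {}f /flat_algebra_derive[g Fg df].
split=> [x|]; first exact: ex_derive.
rewrite (_ : derive1 f = g)//; apply/funext => x.
by rewrite derive1E (@derive_val _ _ _ _ _ _ _ (df x)).
Qed.

(** Positive exactly between [a] and [b], and increasing to the indicator
function of that interval as [n] grows, because the exponents [1/n] tend to 0. *)
Definition bump (a b : R) (n : nat) (x : R) : R :=
  flat n.+1%:R^-1 0 (1 * x + - a) * flat n.+1%:R^-1 0 (- 1 * x + b).

Lemma bump_out a b n x : x \notin `]a, b[ -> bump a b n x = 0.
Proof.
rewrite in_itv/= negb_and -!leNgt /bump /flat mul1r mulN1r => /orP[xa|bx].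
  by rewrite subr_gt0 ltNge xa mul0r.
by rewrite [- x + b]addrC [0 < b - x]subr_gt0 [x < b]ltNge bx mulr0.
Qed.

Lemma bump_itv a b n x : 0 <= bump a b n x <= 1.
Proof.
have F (c y : R) : 0 < c -> 0 <= flat c 0 y <= 1.
  move=> c0; rewrite /flat; case: ifP => [y0|_]; last by rewrite lexx ler01.
  rewrite expr0 mul1r expR_ge0/= -expR0 ler_expR oppr_le0.
  by rewrite mulr_ge0// ?invr_ge0 ltW.
have c0 : 0 < n.+1%:R^-1 :> R by rewrite invr_gt0.
have /andP[h1 h2] := F n.+1%:R^-1 (1 * x + - a) c0.
have /andP[h3 h4] := F n.+1%:R^-1 (- 1 * x + b) c0.
by rewrite mulr_ge0//= mulr_ile1.
Qed.

Lemma bump_cvg a b x : bump a b n x @[n --> \oo] --> (\1_`]a, b[ x : R).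
Proof.
rewrite indicE; have [xab|xab] := boolP (x \in `]a, b[); last first.
  rewrite memNset; last by move=> /= ?; move/negP : xab; apply.
  rewrite (_ : (fun n => _) = (fun=> 0)); first exact: cvg_cst.
  by apply/funext => n; exact: bump_out.
rewrite mem_set//= -[X in _ --> X]mulr1.
have F (y : R) : 0 < y -> flat n.+1%:R^-1 0 y @[n --> \oo] --> (1 : R).
  move=> y0; rewrite /flat y0 -[X in _ --> X]expR0.
  under eq_fun do rewrite expr0 mul1r.
  apply: continuous_cvg; first exact: continuous_expR.
  rewrite -[X in _ --> X]oppr0; apply: cvgN; rewrite -[X in _ --> X](mul0r y^-1).
  by apply: cvgM; [exact: cvg_harmonic|exact: cvg_cst].
move: xab; rewrite in_itv/= => /andP[ax xb].
by apply: cvgM; apply: F; rewrite ?mul1r ?mulN1r ?subr_gt0// addrC subr_gt0.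
Qed.

Lemma bump_smooth a b n : smooth (bump a b n).
Proof.
apply: flat_algebra_smooth; apply: flat_algebra_mul;
  by apply: flat_algebra_flat; rewrite invr_gt0.
Qed.

End smooth.

Section test_functions.
Context (R : realType) (l : R).
Implicit Types f g phi psi : R -> R.

Lemma test_bump a b n : 0 < a -> b < l -> test_function l (bump a b n).
Proof.
move=> a0 bl; split; first exact: bump_smooth.
exists a, b; split=> // x xab; apply: bump_out; move: xab.
by apply: contra; rewrite !in_itv/= => /andP[/ltW -> /ltW ->].
Qed.

Lemma test_linear (a : R) f g : test_function l f -> test_function l g ->
  test_function l (fun x => a * f x + g x).
Proof.
move=> [sf [a1 [b1 [a10 b1l f0]]]] [sg [a2 [b2 [a20 b2l g0]]]].
split; first exact: smooth_linear.
exists (Num.min a1 a2), (Num.max b1 b2); split.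
- by rewrite lt_min a10.
- by rewrite gt_max b1l.
- move=> x; rewrite in_itv/= ge_min le_max => xab.
  rewrite f0 ?g0 ?mulr0 ?addr0//; apply: contra xab; rewrite in_itv/= => /andP[-> ->];
    by rewrite ?orbT.
Qed.

Lemma test_derive1 f : test_function l f -> test_function l (derive1 f).
Proof.
move=> [sf [a [b [a0 bl f0]]]]; split; first exact: smooth_derive1.
exists a, b; split=> // x; rewrite in_itv/= negb_and -!ltNge => xab.
rewrite derive1E -(derive_cst (0 : R) x 1); apply: near_eq_derive.
case/orP: xab => [xa|bx].
  near=> y; have ya : y < a by near: y; exact: lt_nbhsl.
  by rewrite f0// in_itv/= leNgt ya.
near=> y; have yb : b < y by near: y; exact: lt_nbhsr.
by rewrite f0// in_itv/= [y <= b]leNgt yb andbF.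
Unshelve. all: by end_near. Qed.

Lemma test_continuous f : test_function l f -> continuous f.
Proof.
move=> [sf _] x; apply/differentiable_continuous/derivable1_diffP.
exact: (sf 0%N).
Qed.

Lemma test_bounded f : test_function l f ->
  exists2 M, 0 <= M & forall x, `|f x| <= M.
Proof.
move=> tf; have cf := test_continuous tf; move: tf => [_ [a [b [a0 bl f0]]]].
have [ab|ba] := leP a b.
  have cn : {within `[a, b], continuous (fun x => `|f x|)}.
    apply: continuous_subspaceT => x.
    by apply: continuous_comp; [exact: cf|exact: norm_continuous].
  have [c cab hc] := EVT_max ab cn; exists `|f c| => // x.
  have [xab|xab] := boolP (x \in `[a, b]); first exact: hc.
  by rewrite f0// normr0.
exists 0 => // x; rewrite f0 ?normr0// in_itv/=; apply/negP => /andP[ax xb].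
by move: ba; rewrite ltNge (le_trans ax).
Qed.

End test_functions.

(** * Weak derivatives *)

Section weak_derivative.
Context (R : realType) (l : R).
Local Notation mu := (interval_measure l).
Local Notation measurable_real f :=
  (measurable_fun (setT : set (measurableTypeR R)) (f : _ -> R)).
Implicit Types (f g phi psi : R -> R) (u v w : L2 l).

Lemma test_measurable f : test_function l f -> measurable_real f.
Proof. by move=> tf; apply: continuous_measurable_fun; exact: test_continuous tf. Qed.

Lemma bounded_Lfun2 f (M : R) : measurable_real f -> (forall x, `|f x| <= M) ->
  f \in Lfun mu 2%:E.
Proof.
move=> mf fM; have M0 : 0 <= M by exact: le_trans (fM 0).
have mT : mu setT \is a fin_num.
  by rewrite ge0_fin_numE// interval_measure_lty.
pose m := fine (mu setT); have m0 : 0 <= m by exact: fine_ge0.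
have c0 : 0 <= M * (m + 1) by rewrite mulr_ge0// addr_ge0.
apply: Lfun2P => //; apply: le_lt_trans (Lnorm2_le c0 _) _; last by rewrite ltry.
apply: (@le_trans _ _ (\int[mu]_x (M ^+ 2)%:E)%E).
  apply: ge0_le_integral => //.
  - by move=> x _; rewrite lee_fin sqr_ge0.
  - by apply/measurable_EFinP; exact: measurable_funX.
  - by move=> x _; rewrite lee_fin -real_normK ?num_real// lerXn2r ?nnegrE.
rewrite integral_cst// -(fineK mT) -EFinM lee_fin exprMn -/m.
rewrite ler_wpM2l ?sqr_ge0// sqrrD1 -subr_ge0.
rewrite (_ : _ - _ = m ^+ 2 + m + 1); last by ring.
by rewrite !addr_ge0// sqr_ge0.
Qed.

Lemma test_Lfun f : test_function l f -> f \in Lfun mu 2%:E.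
Proof.
move=> tf; have [M _ fM] := test_bounded tf.
exact: bounded_Lfun2 (test_measurable tf) fM.
Qed.

Lemma Rintegral_interval f : measurable_real f ->
  \int[mu]_x f x = \int[@lebesgue_measure R]_(x in `]0, l[) f x.
Proof.
move=> mf; rewrite (_ : \int[@lebesgue_measure R]_(x in `]0, l[) f x =
    \int[mu]_(x in `]0, l[) f x); last first.
  congr fine; apply: eq_measure_integral => A mA Al.
  by rewrite /interval_measure/= /mrestr/= setIidl.
rewrite [RHS]Rintegral_mkcond; apply: ae_eq_Rintegral => //.
  by apply/measurable_restrict => //; exact: measurable_funTS.
exists (~` `]0, l[); split.
- exact: measurableC.
- by rewrite /interval_measure/= /mrestr/= setICl measure0.
- move=> x /=; apply: contra_not => xl _; rewrite patchE mem_set//.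
Qed.

(** The boundary terms vanish with the test functions. *)
Lemma test_integration_by_parts phi psi : 0 < l ->
  test_function l phi -> test_function l psi ->
  \int[mu]_x (phi x * derive1 psi x) = - \int[mu]_x (derive1 phi x * psi x).
Proof.
move=> l0 tphi tpsi.
have tphi' := test_derive1 tphi; have tpsi' := test_derive1 tpsi.
have toitv f g : test_function l f -> test_function l g ->
    \int[mu]_x (f x * g x) = \int[@lebesgue_measure R]_(x in `[0, l]) (f x * g x).
  move=> tf tg; rewrite Rintegral_interval; last first.
    by apply: measurable_funM; exact: test_measurable.
  have mfg : measurable_fun (setT : set (measurableTypeR R)) (fun x => f x * g x).
    by apply: measurable_funM; exact: test_measurable.
  rewrite /Rintegral integral_itv_obnd_cbnd; last first.
    by apply: measurable_funTS; exact/measurable_EFinP.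
  rewrite integral_itv_bndo_bndc//.
  by apply: measurable_funTS; exact/measurable_EFinP.
have LR f : test_function l f -> derivable_oo_LRcontinuous f 0 l.
  move=> tf; split; first by move=> x _; exact: tf.1 0%N x.
    by apply: cvg_at_right_filter; exact: test_continuous tf _.
  by apply: cvg_at_left_filter; exact: test_continuous tf _.
have bd f x : test_function l f -> x \notin `]0, l[ -> f x = 0.
  move=> [_ [a [b [a0 bl f0]]]] xl; apply: f0; apply: contra xl.
  by rewrite !in_itv/= => /andP[/(lt_le_trans a0) -> /le_lt_trans ->].
rewrite !toitv// (@Rintegration_by_parts _ phi psi (derive1 phi) (derive1 psi) 0 l)//;
  try exact: LR.
- by rewrite !(bd phi) ?in_itv/= ?ltxx ?andbF// !mul0r subrr sub0r.
- by apply: continuous_subspaceT; exact: test_continuous tphi'.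
- by apply: continuous_subspaceT; exact: test_continuous tpsi'.
Qed.

Lemma Rintegral_test u phi (tphi : test_function l phi) :
  \int[mu]_x (L2_fun u x * phi x) = L2_dot u (L2_of (test_Lfun tphi)).
Proof.
apply: ae_eq_Rintegral.
- by apply: measurable_funM; [exact: L2_fun_measurable|exact: test_measurable].
- by apply: measurable_funM; exact: L2_fun_measurable.
- by apply: filterS (L2_of_ae (test_Lfun tphi)) => x /= h _; rewrite h.
Qed.

Lemma L2_fun0 : L2_fun (0 : L2 l) = cst 0 %[ae mu].
Proof. exact: Lspace_zeroE. Qed.

(** The fundamental lemma of the calculus of variations.  Bump functions increase
to indicators, so by dominated convergence [w] integrates to 0 on every interval
inside [0, l]: its primitive is constant there, and Lebesgue differentiation
recovers [w] as the derivative almost everywhere. *)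
Lemma L2_test_eq0 w : (forall phi, test_function l phi ->
  \int[mu]_x (L2_fun w x * phi x) = 0) -> w = 0.
Proof.
move=> w0.
have iw : mu.-integrable setT (EFin \o L2_fun w).
  have h1 : (fun=> 1 : R) \in Lfun mu 2%:E.
    by apply: (@bounded_Lfun2 _ 1) => [|x]; [exact: measurable_cst|rewrite normr1].
  have := Lfun2_mul_integrable (L2_fun_Lfun w) h1.
  by under [X in EFin \o X]eq_fun do rewrite mulr1.
have w_itv a b : 0 < a -> b < l -> \int[mu]_x (L2_fun w x * \1_`]a, b[ x) = 0.
  move=> a0 bl.
  have mbump n : measurable_real (bump a b n).
    exact: test_measurable (test_bump n a0 bl).
  have mind : measurable_real (\1_`]a, b[ : R -> R).
    by apply: measurable_indic; exact: measurable_itv.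
  have mwn n : measurable_fun setT
      (fun x : measurableTypeR R => (L2_fun w x * bump a b n x)%:E).
    by apply/measurable_EFinP; apply: measurable_funM => //; exact: L2_fun_measurable.
  have mw : measurable_fun setT
      (fun x : measurableTypeR R => (L2_fun w x * \1_`]a, b[ x)%:E).
    by apply/measurable_EFinP; apply: measurable_funM => //; exact: L2_fun_measurable.
  have cv : {ae mu, forall x, setT x -> (L2_fun w x * bump a b n x)%:E @[n --> \oo]
      --> (L2_fun w x * \1_`]a, b[ x)%:E}.
    apply: aeW => x _; apply: cvg_EFin; first exact: nearW.
    by apply: cvgM; [exact: cvg_cst|exact: bump_cvg].
  have dom : {ae mu, forall x n, setT x ->
      (`|(L2_fun w x * bump a b n x)%:E| <= `|(L2_fun w x)%:E|)%E}.
    apply: aeW => x n _; rewrite lee_fin normrM ler_piMr//.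
    by have /andP[h1 h2] := bump_itv a b n x; rewrite ger0_norm.
  have [_ _] := dominated_convergence measurableT mwn mw cv (integrable_abse iw) dom.
  rewrite (_ : [sequence _]_n = cst 0%E); last first.
    apply/funext => n; rewrite /= -[LHS]fineK; first by congr EFin; exact: w0 _ (test_bump n a0 bl).
    apply: integrable_fin_num => //.
    by apply: Lfun2_mul_integrable; [exact: L2_fun_Lfun|exact: test_Lfun (test_bump n a0 bl)].
  by move=> /(cvg_unique _ (cvg_cst _)) h; rewrite /Rintegral -h.
pose f0 := L2_fun w \_ `]0, l[.
have iwl : (@lebesgue_measure R).-integrable `]0, l[ (EFin \o L2_fun w).
  apply/integrableP; split.
    by apply: measurable_funTS; apply/measurable_EFinP; exact: L2_fun_measurable.
  rewrite (_ : (\int[_]_(x in _) _)%E = (\int[mu]_(x in `]0%R, l[) `|(L2_fun w x)%:E|)%E).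
    apply: le_lt_trans (integrable_lty measurableT (integrable_abse iw)).
    apply: ge0_subset_integral => //; apply: measurableT_comp => //.
    by apply/measurable_EFinP; exact: L2_fun_measurable.
  apply: eq_measure_integral => A mA Al.
  by rewrite /interval_measure/= /mrestr/= setIidl.
have if0 : (@lebesgue_measure R).-integrable setT (EFin \o f0).
  have mD : measurable (`]0, l[%classic : set (measurableTypeR R)) by [].
  rewrite -restrict_EFin.
  exact: ((@integrable_mkcond _ _ _ (@lebesgue_measure R) _ (EFin \o L2_fun w) mD).1 iwl).
have f0_itv a b : 0 < a -> b < l ->
    \int[@lebesgue_measure R]_(x in `]a, b]) f0 x = 0.
  move=> a0 bl; rewrite -[RHS](w_itv a b a0 bl) Rintegral_interval; last first.
    apply: measurable_funM; first exact: L2_fun_measurable.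
    by apply: measurable_indic; exact: measurable_itv.
  rewrite /Rintegral integral_itv_bndoo; last first.
    by apply: measurable_funTS; exact: measurable_int if0.
  rewrite -/(Rintegral _ _ _) -/(Rintegral _ _ _) Rintegral_mkcond [RHS]Rintegral_mkcond.
  apply: eq_Rintegral => x _; rewrite /f0 !patchE indicE.
  case: ifPn => xab; last by rewrite mulr0 if_same.
  by rewrite mulr1.
have iy y : (@lebesgue_measure R).-integrable `]-oo, y] (EFin \o f0).
  exact: integrableS if0.
have locf0 : locally_integrable [set: R] f0.
  exact: integrable_locally_restrict.
have := FTC1Ny iy locf0; set F := (fun _ => _) => FTC.
have F_const x y : 0 < x -> x <= y -> y < l -> F y = F x.
  move=> x0 xy yl; apply/eqP; rewrite -subr_eq0; apply/eqP.
  rewrite /F (Rintegral_itvB (iy y)) ?bnd_simp//; exact: f0_itv.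
have f0_eq0 : {ae @lebesgue_measure R, forall x, x \in `]0, l[ -> L2_fun w x = 0}.
  apply: filterS FTC.
  move=> x [_ Fx] xl; have <- : f0 x = L2_fun w x by rewrite /f0 patchE mem_set.
  rewrite -Fx derive1E -(derive_cst (F x) x 1); apply: near_eq_derive.
  move: xl; rewrite in_itv/= => /andP[x0 xl].
  near=> y; have y0 : 0 < y by near: y; exact: lt_nbhsr.
  have yl : y < l by near: y; exact: lt_nbhsl.
  by have [yx|/ltW xy] := leP y x; [rewrite -(F_const y x)|rewrite (F_const x y)].
have w_ae : {ae mu, forall x, L2_fun w x = 0}.
  case: f0_eq0 => N [mN N0 subN]; exists (N `|` ~` `]0, l[); split.
  - by apply: measurableU => //; exact: measurableC.
  - rewrite /interval_measure/= /mrestr/= setIUl setICl setU0.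
    apply/eqP; rewrite -measure_le0 -N0 le_measure ?inE//.
    exact: measurableI.
  - move=> x /= nx; have [xl|xl] := boolP (x \in `]0, l[).
      by left; apply: subN => /= h; exact: nx (h xl).
    by right => /=; exact/negP.
apply: L2_eq_ae; apply: filterS2 L2_fun0 w_ae => x /= h1 h2 _.
by rewrite h1.
Unshelve. all: by end_near. Qed.

Lemma weak_derivative_unique u w1 w2 :
  is_weak_derivative u w1 -> is_weak_derivative u w2 -> w1 = w2.
Proof.
move=> d1 d2; apply/eqP; rewrite -subr_eq0; apply/eqP/L2_test_eq0 => phi tphi.
have := d1 _ tphi; rewrite (d2 _ tphi) => /oppr_inj; rewrite !(Rintegral_test _ tphi).
by rewrite -scaleN1r L2_dotDl L2_dotZl => ->; rewrite mulN1r subrr.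
Qed.

Lemma weak_derivativeE u w : is_weak_derivative u w -> weak_derivative u = w.
Proof.
move=> uw; rewrite /weak_derivative; case: xgetP => [w' _ uw'|/(_ w)//].
exact: weak_derivative_unique uw' uw.
Qed.

Lemma is_weak_derivative_linear (a : R) u1 u2 w1 w2 :
  is_weak_derivative u1 w1 -> is_weak_derivative u2 w2 ->
  is_weak_derivative (a *: u1 + u2) (a *: w1 + w2).
Proof.
move=> d1 d2 phi tphi; have := d1 _ tphi; have := d2 _ tphi.
rewrite !(Rintegral_test _ tphi) !(Rintegral_test _ (test_derive1 tphi)).
by rewrite !L2_dotDl !L2_dotZl => -> ->; ring.
Qed.

End weak_derivative.

(** * Limits of test functions *)

Section test_functions_limits.
Context (R : realType) (l : R) (l0 : 0 < l).
Implicit Types (u v w z s : L2 l) (phi : R -> R).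

Lemma L2_dot_of (f g : R -> R) (hf : f \in Lfun (interval_measure l) 2%:E)
    (hg : g \in Lfun (interval_measure l) 2%:E) :
  L2_dot (L2_of hf) (L2_of hg) = \int[interval_measure l]_x (f x * g x).
Proof.
have mf : measurable_fun (setT : set (measurableTypeR R)) f.
  by move: hf => /[!inE] /andP[/[!inE]].
have mg : measurable_fun (setT : set (measurableTypeR R)) g.
  by move: hg => /[!inE] /andP[/[!inE]].
apply: ae_eq_Rintegral.
- by apply: measurable_funM; exact: L2_fun_measurable.
- exact: measurable_funM.
- apply: filterS2 (L2_of_ae hf) (L2_of_ae hg) => x /= h1 h2 _.
  by rewrite h1// h2.
Qed.

Lemma L2_of_linear (a : R) (f g h : R -> R)
    (hf : f \in Lfun (interval_measure l) 2%:E)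
    (hg : g \in Lfun (interval_measure l) 2%:E)
    (hh : h \in Lfun (interval_measure l) 2%:E) :
  h = (fun x => a * f x + g x) -> L2_of hh = a *: L2_of hf + L2_of hg.
Proof.
move=> hE; apply: L2_eq_ae.
have e1 : {ae interval_measure l, forall x, L2_fun (a *: L2_of hf + L2_of hg) x =
    a * L2_fun (L2_of hf) x + L2_fun (L2_of hg) x}.
  apply: filterS2 (L2_funD (a *: L2_of hf) (L2_of hg)) (L2_funZ a (L2_of hf)).
  by move=> x /= r1 r2; rewrite r1// r2.
have e2 : {ae interval_measure l, forall x, L2_fun (L2_of hh) x =
    a * L2_fun (L2_of hf) x + L2_fun (L2_of hg) x}.
  apply: filterS3 (L2_of_ae hh) (L2_of_ae hf) (L2_of_ae hg).
  by move=> x /= r1 r2 r3; rewrite r1// r2// r3// hE.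
by apply: filterS2 e1 e2 => x /= -> ->.
Qed.

Lemma L2_of_test_linear (a : R) phi psi (tphi : test_function l phi)
    (tpsi : test_function l psi) :
  L2_of (test_Lfun (test_linear a tphi tpsi)) =
  a *: L2_of (test_Lfun tphi) + L2_of (test_Lfun tpsi).
Proof. exact: L2_of_linear. Qed.

Lemma L2_of_test_derive1_linear (a : R) phi psi (tphi : test_function l phi)
    (tpsi : test_function l psi) :
  L2_of (test_Lfun (test_derive1 (test_linear a tphi tpsi))) =
  a *: L2_of (test_Lfun (test_derive1 tphi)) + L2_of (test_Lfun (test_derive1 tpsi)).
Proof.
apply: L2_of_linear; apply/funext => x; rewrite !derive1E.
exact: (@derive_val _ _ _ _ _ _ _ (is_deriveD (is_deriveZ a
  (derivableP (tphi.1 0%N x))) (derivableP (tpsi.1 0%N x)))).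
Qed.

(** The pairs [(v, v_x)] with [v] in H^1_0, as the closure of the pairs
[(phi, phi')] in L^2 x L^2.  Unlike membership in H^1_0 it does not presuppose
that [w] is the weak derivative of [v]; that follows. *)
Definition test_approximable v w : Prop := forall e : R, 0 < e ->
  exists phi (tphi : test_function l phi),
    `|v - L2_of (test_Lfun tphi)| < e /\
    `|w - L2_of (test_Lfun (test_derive1 tphi))| < e.

(** Integration by parts for test functions, and continuity of the inner product
in [v] and [w]. *)
Lemma test_approximable_weak_derivative v w :
  test_approximable v w -> is_weak_derivative v w.
Proof.
move=> vw psi tpsi; rewrite (Rintegral_test _ tpsi).
rewrite (Rintegral_test _ (test_derive1 tpsi)).
set p := L2_of (test_Lfun tpsi); set p' := L2_of _.
apply/eqP; rewrite -addr_eq0 -normr_le0; apply/ler_addgt0Pr => e e0; rewrite add0r.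
have k0 : 0 < `|p| + `|p'| + 1 by rewrite ltr_wpDl// addr_ge0.
have [phi [tphi [h1 h2]]] := vw _ (divr_gt0 e0 k0).
set q := L2_of (test_Lfun tphi) in h1; set q' := L2_of _ in h2.
have ibp : L2_dot q p' + L2_dot q' p = 0.
  rewrite (L2_dot_of (test_Lfun tphi) (test_Lfun (test_derive1 tpsi))).
  rewrite (L2_dot_of (test_Lfun (test_derive1 tphi)) (test_Lfun tpsi)).
  by rewrite (test_integration_by_parts l0 tphi tpsi) addNr.
have -> : L2_dot v p' + L2_dot w p = L2_dot (v - q) p' + L2_dot (w - q') p.
  by rewrite !L2_dotBl addrACA -opprD ibp subr0.
have h3 := L2_dot_le (v - q) p'; have h4 := L2_dot_le (w - q') p.
apply: (le_trans (ler_normD _ _)); apply: (le_trans (lerD h3 h4)).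
apply: (@le_trans _ _ (e / (`|p| + `|p'| + 1) * (`|p| + `|p'|))).
  by rewrite mulrDr addrC lerD// ler_wpM2r// ltW.
by rewrite -mulrA ger_pMr// mulrC ler_pdivrMr// mul1r lerDl.
Qed.

Lemma test_approximableP v :
  (exists w, test_approximable v w) <-> Sobolev_H10 v.
Proof.
split=> [[w vw]|[w vw H]].
  exists w; first exact: test_approximable_weak_derivative.
  move=> e e0; have [phi [tphi [h1 h2]]] := vw e e0; exists phi; split=> //.
    by rewrite (L2_dist_of v (test_Lfun tphi)) lte_fin.
  by rewrite (L2_dist_of w (test_Lfun (test_derive1 tphi))) lte_fin.
exists w => e e0; have [phi [tphi h1 h2]] := H e e0; exists phi, tphi.
rewrite (L2_dist_of v (test_Lfun tphi)) lte_fin in h1.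
by rewrite (L2_dist_of w (test_Lfun (test_derive1 tphi))) lte_fin in h2.
Qed.

(** The definition of weak derivative extends from test functions to H^1_0 by
density; no boundary term appears, although [s] need not vanish at the ends. *)
Lemma weak_integration_by_parts v w s z : test_approximable v w ->
  is_weak_derivative s z -> L2_dot z v = - L2_dot s w.
Proof.
move=> vw sz; apply/eqP; rewrite -addr_eq0 -normr_le0.
apply/ler_addgt0Pr => e e0; rewrite add0r.
have k0 : 0 < `|z| + `|s| + 1 by rewrite ltr_wpDl// addr_ge0.
have [phi [tphi [h1 h2]]] := vw _ (divr_gt0 e0 k0).
set q := L2_of (test_Lfun tphi) in h1; set q' := L2_of _ in h2.
have ibp : L2_dot z q + L2_dot s q' = 0.
  have := sz _ tphi; rewrite (Rintegral_test _ tphi).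
  by rewrite (Rintegral_test _ (test_derive1 tphi)) -/q -/q' => ->; rewrite addrN.
have -> : L2_dot z v + L2_dot s w = L2_dot z (v - q) + L2_dot s (w - q').
  by rewrite !L2_dotBr addrACA -opprD ibp subr0.
have h3 := L2_dot_le z (v - q); have h4 := L2_dot_le s (w - q').
apply: (le_trans (ler_normD _ _)); apply: (le_trans (lerD h3 h4)).
apply: (@le_trans _ _ ((`|z| + `|s|) * (e / (`|z| + `|s| + 1)))).
  by rewrite mulrDl lerD// ler_wpM2l// ltW.
by rewrite mulrCA ger_pMr// ler_pdivrMr// mul1r lerDl.
Qed.

Lemma test_approximable_linear (a : R) v1 v2 w1 w2 :
  test_approximable v1 w1 -> test_approximable v2 w2 ->
  test_approximable (a *: v1 + v2) (a *: w1 + w2).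
Proof.
move=> h1 h2 e e0; have k0 : 0 < `|a| + 1 + 1 by rewrite addr_gt0// ltr_wpDl.
have d0 := divr_gt0 e0 k0; set d := e / _ in d0.
have [phi [tphi [p1 p2]]] := h1 d d0; have [psi [tpsi [q1 q2]]] := h2 d d0.
exists _, (test_linear a tphi tpsi).
have dist (v v' q q' : L2 l) : `|v - q| < d -> `|v' - q'| < d ->
    `|a *: v + v' - (a *: q + q')| < e.
  move=> r1 r2; rewrite opprD addrACA -scalerBr.
  apply: (le_lt_trans (ler_normD _ _)); rewrite normrZ.
  have : e = `|a| * d + d + d by rewrite /d; field; rewrite gt_eqF.
  have : `|a| * `|v - q| <= `|a| * d by rewrite ler_wpM2l// ltW.
  lra.
split.
  by rewrite L2_of_test_linear; exact: dist.
by rewrite L2_of_test_derive1_linear; exact: dist.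
Qed.

End test_functions_limits.

(** * The Guyer-Krumhansl operator *)

Section GK_operator_m_dissipative.
Context (R : realType) (l rho c tauq k : {posnum R}) (mu : R).
Hypothesis mu2_gt0 : 0 < mu ^+ 2.
Local Notation H := (GK_space l rho c tauq k).
Local Notation L := (l%:num).
Local Notation rc := (rho%:num * c%:num).
Local Notation tau := (tauq%:num).
Local Notation kk := (k%:num).
Local Notation D := (@GK_domain R l rho c tauq k mu).
Local Notation A := (@GK_operator R l rho c tauq k mu).
Implicit Types (U V : H).

Let L_gt0 : 0 < L. Proof. by []. Qed.

(** A relational form of membership in the domain, in which the choice operator
behind weak derivatives is replaced by the derivatives [w = v_x] and
[z = (mu^2 v_x - k u)_x] themselves. *)
Definition GK_graph U (w z : L2 L) : Prop :=
  test_approximable U.2 w /\ is_weak_derivative (mu ^+ 2 *: w - kk *: U.1) z.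

Lemma GK_graph_domain U w z : GK_graph U w z ->
  D U /\ A U =
    ((- rc^-1 *: w, tau^-1 *: z - tau^-1 *: U.2) : H).
Proof.
move=> [Uw wz]; have dU := test_approximable_weak_derivative L_gt0 Uw.
have E : weak_derivative U.2 = w by exact: weak_derivativeE.
have F : GK_flux mu U = mu ^+ 2 *: w - kk *: U.1 by rewrite /GK_flux E.
split; first by split; [apply/(test_approximableP L_gt0); exists w|exists z; rewrite F].
by rewrite /GK_operator F E (weak_derivativeE wz).
Qed.

Lemma GK_domain_graph U : D U -> exists w z, GK_graph U w z.
Proof.
move=> [/(test_approximableP L_gt0)[w Uw] [z fz]]; exists w, z; split=> //.
have dU := test_approximable_weak_derivative L_gt0 Uw.
by move: fz; rewrite /GK_flux (weak_derivativeE dU).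
Qed.

Lemma GK_graph_linear (a : R) U V w1 w2 z1 z2 : GK_graph U w1 z1 ->
  GK_graph V w2 z2 -> GK_graph (a *: U + V) (a *: w1 + w2) (a *: z1 + z2).
Proof.
move=> [Uw Uz] [Vw Vz]; split; first exact: test_approximable_linear.
have := is_weak_derivative_linear a Uz Vz.
rewrite (_ : a *: _ + _ =
  mu ^+ 2 *: (a *: w1 + w2) - kk *: (a *: U + V : H).1)//.
rewrite [(a *: U + V : H).1](_ : _ = a *: U.1 + V.1)//.
rewrite !scalerBr !scalerDr !scalerA opprD !addrA; congr (_ + _).
rewrite [a * mu ^+ 2]mulrC [a * kk]mulrC -!addrA; congr (_ + _).
by rewrite addrC.
Qed.

Lemma GK_operator_linear (a : R) U V : D U -> D V ->
  D (a *: U + V) /\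
  A (a *: U + V) = a *: A U + A V.
Proof.
move=> /GK_domain_graph[w1 [z1 gU]] /GK_domain_graph[w2 [z2 gV]].
have [_ EU] := GK_graph_domain gU; have [_ EV] := GK_graph_domain gV.
have [DUV ->] := GK_graph_domain (GK_graph_linear a gU gV); split=> //.
rewrite EU EV; congr pair.
  rewrite [RHS](_ : _ = a *: (- rc^-1 *: w1) + - rc^-1 *: w2)//.
  by rewrite scalerDr !scalerA mulrC.
rewrite [RHS](_ : _ = a *: (tau^-1 *: z1 - tau^-1 *: U.2) +
  (tau^-1 *: z2 - tau^-1 *: V.2))//.
rewrite [(a *: U + V : H).2](_ : _ = a *: U.2 + V.2)//.
by rewrite scalerBr !scalerDr !scalerA ![a * _]mulrC opprD addrACA.
Qed.

Local Notation dot := (@phase_dot R L (rho%:num * c%:num)%:pos (tauq%:num / k%:num)%:pos).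

(** The energy dissipation.  The terms [<v_x, u>] of the two components cancel,
thanks to the weights of the norm. *)
Lemma GK_dot_le0 U : D U -> dot (A U) U <= 0.
Proof.
move=> /GK_domain_graph[w [z gU]]; have [_ ->] := GK_graph_domain gU.
have [Uw fz] := gU; have ibp := weak_integration_by_parts Uw fz.
rewrite /phase_dot /= L2_dotZl L2_dotBl !L2_dotZl ibp L2_dotBl !L2_dotZl.
rewrite !L2_dot_norm [L2_dot U.1 w]L2_dotC.
have rc0 : rho%:num * c%:num != 0 by rewrite gt_eqF.
have tau0 : tauq%:num != 0 by rewrite gt_eqF.
have k0 : 0 < k%:num by [].
have kn0 : k%:num != 0 by rewrite gt_eqF.
rewrite (_ : _ + _ = - ((mu ^+ 2 * `|w| ^+ 2 + `|U.2| ^+ 2) / kk)); last first.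
  by field; rewrite kn0 tau0 !gt_eqF.
by rewrite oppr_le0 divr_ge0// addr_ge0// mulr_ge0// sqr_ge0.
Qed.

Lemma GK_dissipative : @dissipative R H D
  A.
Proof.
move=> h U h0 DU; rewrite -(@ler_pXn2r _ 2) ?nnegrE//.
rewrite (dot_normBZ (@phase_dotC _ _ _ _) (@phase_dotDl _ _ _ _)
  (@phase_dotZl _ _ _ _) (@phase_dot_norm _ _ _ _)).
have := GK_dot_le0 DU; rewrite phase_dotC => hd.
have h1 : 0 <= h ^+ 2 * `|A U| ^+ 2 by rewrite mulr_ge0 ?sqr_ge0.
have h2 : h * dot U (A U) <= 0 by rewrite mulr_ge0_le0.
move: h1 h2; rewrite -[2 * h * _]mulrA; lra.
Qed.

(** [u = f - h/(rho c) v_x] by the first equation; the second then is the Euler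
equation of the orthogonal projection of [G] onto the closure of the pairs
[(phi, phi')], for the inner product with weights [m] and [ka]. *)
Lemma GK_range (h : R) (F : H) : 0 < h ->
  exists U, D U /\ U - h *: A U = F.
Proof.
move=> h0.
have rc0 : 0 < rc by [].
have m0 : 0 < tau / h + 1 by rewrite addr_gt0// divr_gt0.
have ka0 : 0 < mu ^+ 2 + kk * h / rc by rewrite addr_gt0// divr_gt0// mulr_gt0.
set m := tau / h + 1 in m0; set ka := mu ^+ 2 + _ in ka0.
pose E : normedModType R := phase_space L (PosNum m0) (PosNum ka0).
pose V : set E := [set p | exists phi (tphi : test_function L phi),
  p = (L2_of (test_Lfun tphi), L2_of (test_Lfun (test_derive1 tphi)))].
have V0 : V !=set0.
  have a0 : 0 < L / 3 by rewrite divr_gt0.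
  have b0 : L / 3 * 2 < L by have := L_gt0; lra.
  by eexists; exists _, (test_bump 0 a0 b0).
have Vlin (a : R) x y : V x -> V y -> V (a *: x + y).
  move=> [phi [tphi ->]] [psi [tpsi ->]]; exists _, (test_linear a tphi tpsi).
  by rewrite L2_of_test_linear L2_of_test_derive1_linear.
(* Chosen so that the inner product of [G] with [(phi, phi')] is
   [tau/h <g, phi> + k <f, phi'>], the right-hand side of the weak equation. *)
pose G : E := ((tau / (h * m)) *: F.2, (kk / ka) *: F.1).
have [[v w] [Papp Porth]] := orthogonal_projection
  (@phase_space_complete _ _ (PosNum m0) (PosNum ka0))
  (@phase_dotC _ _ _ _) (@phase_dotDl _ _ _ _) (@phase_dotZl _ _ _ _)
  (@phase_dot_norm _ _ _ _) G V0 Vlin.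
have vw : test_approximable v w.
  move=> e e0.
  have mi0 : 0 < m^-1 by rewrite invr_gt0.
  have ki0 : 0 < ka^-1 by rewrite invr_gt0.
  have c0 : 0 < m^-1 + ka^-1 + 1 by rewrite !addr_gt0.
  have [_ [phi [tphi ->]] hP] := Papp _ (divr_gt0 e0 c0).
  exists phi, tphi; pose P : E := (v, w).
  pose p : E := (L2_of (test_Lfun tphi), L2_of (test_Lfun (test_derive1 tphi))).
  move: hP; rewrite ltr_pdivlMr// mulrC -/p -/P => hP.
  have n0 : 0 <= `|P - p| by [].
  have h1 : `|v - p.1| <= (m^-1 + 1) * `|P - p|.
    exact: (@phase_norm_fst R L (PosNum m0) (PosNum ka0) (P - p)).
  have h2 : `|w - p.2| <= (ka^-1 + 1) * `|P - p|.
    exact: (@phase_norm_snd R L (PosNum m0) (PosNum ka0) (P - p)).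
  split; apply: le_lt_trans hP.
    by apply: (le_trans h1); rewrite ler_wpM2r// lerD2r lerDl ltW.
  by apply: (le_trans h2); rewrite ler_wpM2r// lerD2r lerDr ltW.
pose u := F.1 - (h / rc) *: w; pose z := m *: v - (tau / h) *: F.2.
have fz : is_weak_derivative (mu ^+ 2 *: w - kk *: u) z.
  have -> : mu ^+ 2 *: w - kk *: u = ka *: w - kk *: F.1.
    by rewrite /u scalerBr opprB addrA scalerA -scalerDl mulrA.
  move=> phi tphi; rewrite (Rintegral_test _ tphi).
  rewrite (Rintegral_test _ (test_derive1 tphi)).
  have Vp : V (L2_of (test_Lfun tphi), L2_of (test_Lfun (test_derive1 tphi))).
    by exists phi, tphi.
  have := Porth _ Vp; rewrite /phase_dot /= !L2_dotBl !L2_dotZl => hp.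
  apply/eqP; rewrite -subr_eq0 opprK -oppr_eq0; apply/eqP.
  rewrite -[RHS]hp; field.
  by rewrite !gt_eqF.
exists ((u, v) : H).
have [dU ->] := @GK_graph_domain (u, v) w z (conj vw fz); split=> //.
rewrite [F]surjective_pairing; congr pair => /=.
  by rewrite scalerA mulrN scaleNr opprK subrK.
rewrite /z !scalerBr !scalerA.
have -> : h * tau^-1 * m = 1 + h * tau^-1 by rewrite /m; field; rewrite !gt_eqF.
have -> : h * tau^-1 * (tau / h) = 1 by field; rewrite !gt_eqF.
rewrite scalerDl !scale1r.
by rewrite addrAC addrK subKr.
Qed.

(** The distance vector [G - P] to the closure of the domain is orthogonal to
the domain and of the form [U - A U] with [U] in the domain, so
[|U|^2 = <A U, U> <= 0]. *)
Lemma GK_dense (G : H) (e : R) : 0 < e ->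
  exists2 U, D U & `|G - U| < e.
Proof.
have D0 : D !=set0.
  by have [U [DU _]] := GK_range (0 : H) (@ltr01 R); exists U.
have [P [Papp Porth]] := @orthogonal_projection R H dot
  (@phase_space_complete _ _ _ _) (@phase_dotC _ _ _ _) (@phase_dotDl _ _ _ _)
  (@phase_dotZl _ _ _ _) (@phase_dot_norm _ _ _ _) D G D0
  (fun a U V DU DV => (GK_operator_linear a DU DV).1).
have [U [DU UE]] := GK_range (G - P) (@ltr01 R).
have := Porth _ DU; rewrite -UE scale1r.
rewrite phase_dotDl -[- A U]scaleN1r phase_dotZl phase_dot_norm => hU.
have U0 : U = 0.
  apply/eqP; rewrite -normr_eq0 -sqrf_eq0 eq_le sqr_ge0 andbT.
  by have := GK_dot_le0 DU; move: hU; lra.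
have A0 : A U = 0.
  have := (GK_operator_linear (-1) DU DU).2.
  by rewrite !scaleN1r !addNr U0.
move=> e0; suff -> : G = P by exact: Papp.
by apply/eqP; rewrite -subr_eq0 -UE A0 U0 scaler0 subr0.
Qed.

Lemma GK_m_dissipative : @m_dissipative R H D
  A.
Proof.
split; [exact: GK_operator_linear|exact: GK_dissipative|exact: GK_range|].
exact: GK_dense.
Qed.

End GK_operator_m_dissipative.

(** * Well-posedness of the Cauchy problem *)

Theorem theorem3p1 (R : realType) (l rho c tauq k : {posnum R}) (mu : R)
    (mu2_gt0 : 0 < mu ^+ 2) :
  let H := GK_space l rho c tauq k in
  let D : set H := @GK_domain R l rho c tauq k mu in
  let A : H -> H := @GK_operator R l rho c tauq k mu in
  (exists S : R -> H -> H, C0_semigroup_generated_by S D A) /\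
  forall S : R -> H -> H, C0_semigroup_generated_by S D A ->
  forall U0 : H,
    let U : R -> H := fun t => S t U0 in
    [/\ {within `[0, +oo[, continuous U},
        mild_solution D A U0 U &
        forall V : R -> H, mild_solution D A U0 V ->
          forall t, 0 <= t -> V t = U t] /\
    (D U0 ->
     [/\ C1_halfline U, C0_halfline_domain D A U,
         classical_solution D A U0 U &
         forall V : R -> H, classical_solution D A U0 V ->
           forall t, 0 <= t -> V t = U t]).
Proof.
move=> H D A.
have cH : seq_complete H by exact: phase_space_complete.
have mA : m_dissipative D A by exact: GK_m_dissipative.
split=> [|S gS U0 U]; first exact: m_dissipative_generates cH mA.
split=> [|DU0].
  split.
  - exact: (semigroup_continuous cH mA gS (x := U0)).
  - exact: (semigroup_mild cH mA gS).
  - by move=> V sV t t0; exact: (mild_solution_unique cH mA gS sV t0).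
have [C1U C0U clU] := semigroup_classical cH mA gS DU0; split=> //.
by move=> V sV t t0; exact: (classical_solution_unique cH mA gS DU0 sV t0).
Qed.
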